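(* In the $K$-tier network model described in the context with $W=0$ (interference-limited), let $\mathcal O_k^{int}=\mathbb P\{P_k\|\mathbf h\|^2X_k^{-\alpha_k}/I_o<\beta\}$ for target $\beta>0$. Then $$\mathcal O_k^{int}=1-\frac{\lambda_k}{\mathcal T_k}\sum_{i=0}^{M_k-1}\sum_{m=0}^{M_k-1}\int_0^{R_k^2}\frac{\pi^{i+1}}{i!}\exp\Big(-\pi g_{k,0}(x)-\pi\sum_{j=1}^K\lambda_j\Omega_{j,k}^{\delta_j}x^{\delta_{j,k}}\Big)\mathbf Q^i_{M_k}(x)(m+1,1)\,dx.$$ If moreover $\alpha_j=\alpha$ for all $j$, then $$\mathcal O_k^{int}=1-\frac{\lambda_k}{\mathcal T_k}\sum_{i=0}^{M_k-1}\frac{\|\mathbf\Theta^i_{M_k}\|_1}{\mathcal Z_k^{i+1}}\Big(1-\sum_{l=0}^{i}\frac{(\pi\mathcal Z_kR_k^2)^l}{l!}e^{-\pi\mathcal Z_kR_k^2}\Big),$$ where $\|\mathbf A\|_1=\max_{q}\sum_p|A_{pq}|$ is the maximum absolute column sum.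
   Context: Network model: $\mathcal K=\{1,\dots,K\}$. In $\mathbb R^2$, tier-$k$ BSs form a homogeneous PPP of intensity $\lambda_k>0$ and users a homogeneous PPP of intensity $\lambda_u>0$, all independent. Tier-$k$ BSs have transmit power $P_k>0$, $M_k\in\mathbb N$ antennas, bias $B_k>0$, path-loss exponent $\alpha_k>2$. $\Omega_k=P_kM_kB_k$, $\delta_k=2/\alpha_k$, $\mathcal V_{j,k}=\mathcal V_j/\mathcal V_k$ for $\mathcal V\in\{P,M,B,\Omega,\delta\}$. Access threshold $\epsilon>0$, $R_k=(\Omega_k/\epsilon)^{1/\alpha_k}$. Association: with $D_k$ the distance from a typical user to its nearest tier-$k$ BS, $\hat\rho_k=\Omega_kD_k^{-\alpha_k}$ if $D_k\le R_k$, else $0$; the user is associated with tier $k$ iff $\hat\rho_k>\hat\rho_j$ for all $j\ne k$, with probability $\mathcal T_k=\pi\lambda_k\int_0^{R_k^2}\exp(-\pi\sum_j\lambda_j\Omega_{j,k}^{\delta_j}r^{\delta_{j,k}})dr$. Activation probability of tier $j$: $\mathcal A_j=1-\exp\big(-\pi\lambda_u\int_0^{R_j^2}\exp(-\pi\sum_l\lambda_l\Omega_{l,j}^{\delta_l}r^{\delta_{l,j}})dr\big)$; active tier-$j$ BSs are modeled as a homogeneous PPP of intensity $\mathcal A_j\lambda_j$. SINR model: conditional on association with tier $k$, the serving distance $X_k$ has density $\frac{2\pi\lambda_k}{\mathcal T_k}x\exp(-\pi\sum_j\lambda_j\Omega_{j,k}^{\delta_j}x^{2\delta_{j,k}})$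 on $(0,R_k]$; given $X_k$, interferers of tier $j$ are the points of independent homogeneous PPPs of intensity $\mathcal A_j\lambda_j$ outside the disk around the user of radius $\Omega_{j,k}^{1/\alpha_j}X_k^{\alpha_k/\alpha_j}$; the signal gain $\|\mathbf h\|^2\sim\mathrm{Gamma}(M_k,1)$ (maximum ratio transmission), an interferer of tier $j$ at distance $r$ contributes $P_jVr^{-\alpha_j}$ with $V\sim\mathrm{Exp}(1)$, all fading independent of each other and of the point processes; $I_o$ is the total interference. Auxiliary quantities: $\tau_{j,k}=\beta/(M_{j,k}B_{j,k})$; $\varphi_{j,k}(0)=\frac{\delta_j\tau_{j,k}{}_2F_1(1,1-\delta_j;2-\delta_j;-\tau_{j,k})}{1-\delta_j}$, $\varphi_{j,k}(n)=\frac{\delta_j\tau_{j,k}^n{}_2F_1(n+1,n-\delta_j;n+1-\delta_j;-\tau_{j,k})}{n-\delta_j}$ for $n\ge1$; $g_{k,n}(x)=\sum_j\mathcal A_j\lambda_j\Omega_{j,k}^{\delta_j}\varphi_{j,k}(n)x^{\delta_{j,k}}$; $\mathbf Q_{M_k}(x)$ is the $M_k\times M_k$ lower triangular Toeplitz matrix with zero diagonal and $(p,q)$ entry $g_{k,p-q}(x)$ for $p>q$; $\mathbf Q^i_{M_k}(x)(p,q)$ is the $(p,q)$ entry of its $i$-th power. For equal exponents $\alpha_j=\alpha$ ($\delta_j=\delta$): $\Lambda=\sum_j\lambda_j\Omega_j^\delta$, $\theta_{k,n}=\sum_j\mathcal A_j\lambda_j\Omega_{j,k}^\delta\varphi_{j,k}(n)$,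 $\mathbf\Theta_{M_k}$ is the $M_k\times M_k$ lower triangular Toeplitz matrix with zero diagonal and $(p,q)$ entry $\theta_{k,p-q}$ for $p>q$, and $\mathcal Z_k=\theta_{k,0}+\Lambda/\Omega_k^\delta$. *)

(* Defs.v *)
From HB Require Import structures.
From mathcomp Require Import all_boot all_order all_algebra.
From mathcomp Require Import all_classical all_reals all_analysis.
Set Implicit Arguments. Unset Strict Implicit. Unset Printing Implicit Defensive.
Import Order.TTheory GRing.Theory Num.Theory.
Import numFieldNormedType.Exports.
Local Open Scope classical_set_scope.
Local Open Scope ring_scope.

Section NetDefs.
Context {R : realType} {K : nat}.
Variables (lam P B alpha : 'I_K -> R) (M : 'I_K -> nat).

Definition Omega (k : 'I_K) : R := P k * (M k)%:R * B k.
Definition delta (k : 'I_K) : R := 2 / alpha k.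
Definition Rk (eps : R) (k : 'I_K) : R := powR (Omega k / eps) (1 / alpha k).

Definition assoc_exp (k : 'I_K) (r : R) : R :=
  expR (- (pi * \sum_(j < K) lam j * powR (Omega j / Omega k) (delta j)
                              * powR r (delta j / delta k))).

Definition Tk (eps : R) (k : 'I_K) : R :=
  pi * lam k * Rintegral lebesgue_measure `[0, Rk eps k ^+ 2] (assoc_exp k).

Definition Aact (lam_u eps : R) (j : 'I_K) : R :=
  1 - expR (- (pi * lam_u *
        Rintegral lebesgue_measure `[0, Rk eps j ^+ 2] (assoc_exp j))).

Definition tau (beta : R) (j k : 'I_K) : R :=
  beta / (((M j)%:R / (M k)%:R) * (B j / B k)).
End NetDefs.

(* Gauss hypergeometric function 2F1(a,b;c;z), given (for real c > b > 0 and
   real z < 1, the only range used below) by Euler's integral representation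
   2F1(a,b;c;z) = (1/Beta(b,c-b)) int_0^1 t^(b-1) (1-t)^(c-b-1) (1-zt)^(-a) dt. *)
Definition hyp2F1 {R : realType} (a b c z : R) : R :=
  Rintegral lebesgue_measure `]0, 1[
     (fun t => powR t (b - 1) * powR (1 - t) (c - b - 1) * powR (1 - z * t) (- a))
  / Rintegral lebesgue_measure `]0, 1[
     (fun t => powR t (b - 1) * powR (1 - t) (c - b - 1)).

Section NetDefs2.
Context {R : realType} {K : nat}.
Variables (lam P B alpha : 'I_K -> R) (M : 'I_K -> nat) (lam_u eps beta : R).

Local Notation Om := (Omega P B M).
Local Notation dl := (delta alpha).
Local Notation A := (Aact lam P B alpha M lam_u eps).

Definition varphi (j k : 'I_K) (n : nat) : R :=
  let t := tau B M beta j k in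
  if n == 0%N then
    dl j * t * hyp2F1 1 (1 - dl j) (2 - dl j) (- t) / (1 - dl j)
  else
    dl j * t ^+ n * hyp2F1 (n.+1)%:R (n%:R - dl j) (n.+1%:R - dl j) (- t)
      / (n%:R - dl j).

Definition gfun (k : 'I_K) (n : nat) (x : R) : R :=
  \sum_(j < K) A j * lam j * powR (Om j / Om k) (dl j) * varphi j k n
               * powR x (dl j / dl k).

(* Q_{M_k}(x): lower triangular Toeplitz, zero diagonal, (p,q) entry
   g_{k,p-q}(x) for p > q (0-based indices here; p - q is unchanged). *)
Definition Qmat (k : 'I_K) (x : R) : 'M[R]_(M k) :=
  \matrix_(p, q) if (q < p)%N then gfun k (p - q) x else 0.

(* Equal path-loss exponents alpha_j = a for all j, delta = 2/a. *)
Definition Lambda (a : R) : R := \sum_(j < K) lam j * powR (Om j) (2 / a).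

Definition theta (a : R) (k : 'I_K) (n : nat) : R :=
  \sum_(j < K) A j * lam j * powR (Om j / Om k) (2 / a) * varphi j k n.

Definition Theta (a : R) (k : 'I_K) : 'M[R]_(M k) :=
  \matrix_(p, q) if (q < p)%N then theta a k (p - q) else 0.

Definition Zk (a : R) (k : 'I_K) : R :=
  theta a k 0 + Lambda a / powR (Om k) (2 / a).
End NetDefs2.

(* entry (m, first column) of a square matrix, m 0-based; i.e. the paper's
   (m+1, 1) entry *)
Definition col1_entry {R : realType} {n : nat} (A : 'M[R]_n) (m : 'I_n) : R :=
  \sum_(q < n | nat_of_ord q == 0%N) A m q.

Definition mx_norm1 {R : realType} {n : nat} (A : 'M[R]_n) : R :=
  \big[Num.max/0]_(q < n) \sum_(p < n) `|A p q|.

Definition fin_inter {T : Type} (G : set (set T)) : set (set T) :=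
  [set E | exists n (F : 'I_n -> set T), (forall i, G (F i)) /\
                                         E = \bigcap_(i : 'I_n) F i].

Definition mutually_indep {R : realType} {d} {Om : measurableType d}
    (Pr : probability Om R) (I : finType) (G : I -> set (set Om)) : Prop :=
  forall E : I -> set Om, (forall i, G i (E i)) ->
    Pr (\bigcap_(i : I) E i) = (\prod_(i : I) Pr (E i))%E.

Definition poisson_p {R : realType} (mu : R) (n : nat) : R :=
  mu ^+ n / (n`!)%:R * expR (- mu).

Definition count_eq {T Om : Type} (Phi : Om -> set T) (A : set T) (n : nat)
  : set Om := [set w | card_eq (Phi w `&` A) `I_n].

Definition is_ppp {R : realType} {d} {Om : measurableType d} {dT}
    {T : measurableType dT} (Pr : probability Om R)
    (nu : set T -> \bar R) (Phi : Om -> set T) : Prop :=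
  (forall (A : set T) (n : nat), measurable A -> (nu A < +oo)%E ->
      measurable (count_eq Phi A n) /\
      Pr (count_eq Phi A n) = (poisson_p (fine (nu A)) n)%:E) /\
  (forall n (A : 'I_n -> set T) (c : 'I_n -> nat),
      (forall i, measurable (A i) /\ (nu (A i) < +oo)%E) ->
      (forall i i', i != i' -> A i `&` A i' = set0) ->
      mutually_indep Pr (fun i => [set count_eq Phi (A i) (c i)])).

(* intensity measure of an independently Exp(1)-marked homogeneous PPP of
   intensity mu on the plane: mu * (Leb x Leb) x Exp(1), on (R*R)*R,
   points are (location, fading mark) *)
Definition marked_intensity {R : realType} (mu : R) : set ((R * R) * R) -> \bar R :=
  fun A => (mu%:E * ((lebesgue_measure \x lebesgue_measure)
                      \x exponential_prob 1) A)%E.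

Definition dist0 {R : realType} (y : R * R) : R := Num.sqrt (y.1 ^+ 2 + y.2 ^+ 2).

Definition gamma_pdf {R : realType} (m : nat) (x : R) : R :=
  if 0 <= x then x ^+ m.-1 * expR (- x) / (m.-1`!)%:R else 0.

Section ModelDefs.
Context {R : realType} {K : nat}.
Variables (lam P B alpha : 'I_K -> R) (M : 'I_K -> nat) (eps : R).

(* density of the serving distance X_k, conditional on association with k:
   2 pi lam_k / T_k * x * exp(-pi sum_j lam_j Omega_{j,k}^{delta_j}
   x^{2 delta_{j,k}}) on (0, R_k] *)
Definition serving_pdf (k : 'I_K) (x : R) : R :=
  if (0 < x) && (x <= Rk P B alpha M eps k) then
    2 * pi * lam k / Tk lam P B alpha M eps k * x *
    expR (- (pi * \sum_(j < K) lam j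
                 * powR (Omega P B M j / Omega P B M k) (delta alpha j)
                 * powR x (2 * (delta alpha j / delta alpha k))))
  else 0.

(* exclusion radius around the user for tier-j interferers, given the serving
   distance x: Omega_{j,k}^{1/alpha_j} x^{alpha_k/alpha_j} *)
Definition excl_radius (k j : 'I_K) (x : R) : R :=
  powR (Omega P B M j / Omega P B M k) (1 / alpha j) * powR x (alpha k / alpha j).

(* total interference I_o: tier-j interferers are the points (y, v) of the
   marked process Phi_j with |y| > excl_radius; each contributes
   P_j v |y|^(-alpha_j) *)
Definition interference {Om : Type} (k : 'I_K) (X : Om -> R)
   (Phi : 'I_K -> Om -> set ((R * R) * R)) (w : Om) : \bar R :=
  (\sum_(j < K)
     \esum_(z in [set z | Phi j w z /\ (excl_radius k j (X w) < dist0 z.1)%R])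
        (P j * z.2 * powR (dist0 z.1) (- alpha j))%:E)%E.
End ModelDefs.

(* Main.v *)
(* Condition on the serving distance being [x] and scale the interference so
   that coverage reads [S <= ||h||^2]. As [||h||^2 ~ Gamma(M, 1)], coverage has
   probability [E (sum_(m < M) e^-S S^m / m!)], the probability that a compound
   Poisson variable driven by [S] is less than [M]. For a Poisson process [S] the
   terms satisfy the Panjer recursion whose coefficients are the integrals of
   [e^-f f^n / n!] over the intensity measure, and the exponential of a nilpotent
   Toeplitz matrix solves this recursion. Polar coordinates and the substitution
   [t = (r0 / r)^alpha] turn these integrals into Euler's integral of [2F1].
   The serving distance is random, and conditioning on it is replaced by a
   sandwich: coverage is monotone in the received power and in the exclusion
   radius separately, so on each cell of a geometric grid it lies between two
   events with deterministic parameters, and the mesh is refined by dominated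
   convergence. *)
Require Import Defs.
From HB Require Import structures.
From mathcomp Require Import all_boot all_order all_algebra.
From mathcomp Require Import all_classical all_reals all_analysis.
From mathcomp Require Import measurable_realfun ring lra zify.
Set Implicit Arguments. Unset Strict Implicit. Unset Printing Implicit Defensive.
Import Order.TTheory GRing.Theory Num.Theory.
Import numFieldNormedType.Exports.
Local Open Scope classical_set_scope.
Local Open Scope ring_scope.

(** * Compound Poisson counts *)

(** The hypotheses speak of the point processes only through the events that a set of finite
    intensity contains exactly [n] points. The gain is therefore replaced by a dyadic step function,
    which turns the interference into a finite weighted sum of independent Poisson counts; for such
    sums the recursion is a statement about plain series. The limit is taken through the coverage
    event itself: written with a weak inequality, it is the decreasing intersection of its dyadic
    versions. The constant coefficient is special: [e^-f] is not integrable against an infinite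
    intensity, so index 0 of every coefficient sequence carries the integral of [1 - e^-f]. Since
    the exclusion region is random, coverage is studied as a function [cover y z] of two distances,
    [y] in the path loss and [z] in the exclusion radius. A geometric grid fits because the ends of
    a cell are within a fixed factor of its points: both bounds then have the form
    [cover (x / r) (r * x)], where the ratio of the two distances does not depend on [x]. *)

Lemma cvgr_sum {R : realType} {T : Type} {F : set_system T} {FF : Filter F}
    (I : Type) (r : seq I) (f : I -> T -> R) (l : I -> R) :
  (forall i, f i x @[x --> F] --> l i) ->
  \sum_(i <- r) f i x @[x --> F] --> \sum_(i <- r) l i.
Proof.
move=> fl; elim: r => [|i r IH].
  by rewrite big_nil; under eq_fun do rewrite big_nil; exact: cvg_cst.
by rewrite big_cons; under eq_fun do rewrite big_cons; exact: cvgD.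
Qed.

Section compound_poisson_coef.
Context {R : realType}.
Implicit Types (q h : nat -> R) (M m n : nat).

(** Generating polynomial of the jump sizes, with rate [q n] for size [n]. Slot 0 of [q] is reserved
    for the total rate and is masked here; the resulting divisibility by ['X] makes truncation at
    [M] harmless. *)
Definition cpoly q M : {poly R} := \poly_(n < M) (if n == 0 then 0 else q n).

(** Coefficient [m] of the exponential of [cpoly q M - q 0], cut after [M] terms. For [m < M] the
    cut loses nothing, since [cpoly q M ^+ i] starts at degree [i]; the powers kept match those of a
    nilpotent matrix of size [M]. *)
Definition cpmf q M m : R :=
  expR (- q 0) * (\sum_(i < M) (i`!%:R)^-1 *: cpoly q M ^+ i)`_m.

Lemma coef_cpoly q M n :
  (cpoly q M)`_n = if (0 < n < M)%N then q n else 0.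
Proof.
rewrite coef_poly; case: ltnP => nM; last by rewrite andbF.
by rewrite andbT; case: n nM.
Qed.

Lemma coef_cpoly_exp_small q M i m : (m < i)%N -> (cpoly q M ^+ i)`_m = 0.
Proof.
elim: i m => [//|i IH] m mi.
rewrite exprS coefM big1// => -[l /= lm] _.
rewrite coef_cpoly; case: l lm => [|l] lm; first by rewrite mul0r.
by rewrite IH ?mulr0//; lia.
Qed.

Lemma cvg_coef_cpoly_exp {T : Type} {F : set_system T} {FF : Filter F}
    (q_ : T -> nat -> R) q M i m :
  (forall n, q_ x n @[x --> F] --> q n) ->
  (cpoly (q_ x) M ^+ i)`_m @[x --> F] --> (cpoly q M ^+ i)`_m.
Proof.
move=> qq; elim: i m => [|i IH] m.
  by rewrite expr0; under eq_fun do rewrite expr0; exact: cvg_cst.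
rewrite exprS coefM; under eq_fun do rewrite exprS coefM.
apply: cvgr_sum => l; apply: cvgM; last exact: IH.
rewrite coef_cpoly; under eq_fun do rewrite coef_cpoly.
by case: ifP => _; [exact: qq|exact: cvg_cst].
Qed.

Lemma cpolyZ q M (c : R) : cpoly (fun n => c * q n) M = c *: cpoly q M.
Proof.
by apply/polyP => n; rewrite coefZ !coef_cpoly; case: ifP; rewrite ?mulr0.
Qed.

Lemma coef_cpoly_exp_ge0 q M i m : (forall n, 0 <= q n) -> 0 <= (cpoly q M ^+ i)`_m.
Proof.
move=> q0; elim: i m => [|i IH] m; first by rewrite expr0 coef1 ler0n.
rewrite exprS coefM sumr_ge0// => l _; rewrite mulr_ge0// coef_cpoly.
by case: ifP.
Qed.

Lemma cpmf0 q M : (0 < M)%N -> cpmf q M 0 = expR (- q 0).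
Proof.
case: M => // M _; rewrite /cpmf coef_sum big_ord_recl/= expr0 big1 ?addr0.
  by rewrite coefZ fact0 invr1 mul1r coefC mulr1.
by move=> i _; rewrite coefZ coef_cpoly_exp_small// mulr0.
Qed.

(** Panjer recursion, from [E' = p' E] for an exponential [E] of [p]. The truncated exponential
    satisfies this up to the last power of [p], which has no coefficient of index at most [m]. *)
Lemma cpmfS q M m : (m.+1 < M)%N ->
  m.+1%:R * cpmf q M m.+1 =
  \sum_(l < m.+1) (m.+1 - l)%:R * q (m.+1 - l)%N * cpmf q M l.
Proof.
case: M => [//|[//|M]] mM; set p := cpoly q M.+2; rewrite /cpmf -/p.
set E := \sum_(i < M.+2) _.
have dE : E^`() = p^`() * (E - (M.+1`!%:R)^-1 *: p ^+ M.+1).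
  rewrite /E [in RHS]big_ord_recr/= addrK linear_sum/=.
  rewrite big_ord_recl /= linearZ/= expr0 derivC scaler0 add0r.
  rewrite mulr_sumr; apply: eq_bigr => i _.
  rewrite linearZ/= deriv_exp /bump /= add1n /=.
  rewrite -scalerMnr scalerMnl -scalerAr; congr (_ *: _).
  by rewrite factS natrM invfM -mulr_natl mulrA mulfV ?mul1r// pnatr_eq0.
have : (E^`())`_m = (p^`() * E)`_m.
  rewrite dE mulrBr coefB; suff -> : (p^`() * (M.+1`!%:R^-1 *: p ^+ M.+1))`_m = 0.
    by rewrite subr0.
  rewrite -scalerAr coefZ coefM big1 ?mulr0// => -[l /= lm] _.
  by rewrite (@coef_cpoly_exp_small _ _ M.+1 (m - l)) ?mulr0//; lia.
rewrite coef_deriv coefMr => Em.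
rewrite mulrCA mulr_natl Em mulr_sumr; apply: eq_bigr => -[l /= lm] _.
rewrite coef_deriv coef_cpoly.
have -> : ((m - l).+1 = m.+1 - l)%N by lia.
have -> : (0 < m.+1 - l < M.+2)%N by lia.
by rewrite -(mulr_natl (q _)); ring.
Qed.

(** Solved form of the recursion, from which continuity and measurability in [q] follow by strong
    induction on [m]. *)
Lemma cpmf_recE q M m : (m.+1 < M)%N ->
  cpmf q M m.+1 = m.+1%:R^-1 *
  \sum_(l < m.+1) (m.+1 - l)%:R * q (m.+1 - l)%N * cpmf q M l.
Proof. by move=> mM; rewrite -cpmfS// mulKf// pnatr_eq0. Qed.

Lemma cvg_cpmf {T : Type} {F : set_system T} {FF : Filter F}
    (q_ : T -> nat -> R) q M m : (m < M)%N ->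
  (forall n, q_ i n @[i --> F] --> q n) ->
  cpmf (q_ i) M m @[i --> F] --> cpmf q M m.
Proof.
move=> + qq; elim/ltn_ind: m => -[|m] IH mM.
  rewrite cpmf0//; under eq_fun do rewrite cpmf0//.
  by apply: continuous_cvg; [exact: continuous_expR|exact: cvgN].
rewrite cpmf_recE//; under eq_fun do rewrite cpmf_recE//.
apply: cvgM; first exact: cvg_cst.
apply: cvgr_sum => l; apply: cvgM.
  by apply: cvgM; [exact: cvg_cst|exact: qq].
by apply: IH => //; apply: ltn_trans mM.
Qed.

Lemma measurable_cpmf {d} {T : measurableType d} (q_ : T -> nat -> R) M m :
  (m < M)%N -> (forall n, measurable_fun setT (fun x => q_ x n)) ->
  measurable_fun setT (fun x => cpmf (q_ x) M m).
Proof.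
move=> + mq; elim/ltn_ind: m => -[|m] IH mM.
  under eq_fun do rewrite cpmf0//.
  by do 2 apply: measurableT_comp => //.
under eq_fun do rewrite cpmf_recE//.
apply: measurable_funM => //; apply: measurable_sum => l.
apply: measurable_funM; first by apply: measurable_funM.
by apply: IH => //; apply: ltn_trans mM.
Qed.

End compound_poisson_coef.

Section poisson_p.
Context {R : realType}.
Implicit Types (mu u t : R) (m n c : nat).

Lemma poisson_p_ge0 mu n : 0 <= mu -> 0 <= poisson_p mu n.
Proof. by move=> mu0; rewrite /poisson_p !mulr_ge0 ?exprn_ge0 ?expR_ge0. Qed.

Lemma poisson_p0 mu : poisson_p mu 0 = expR (- mu).
Proof. by rewrite /poisson_p expr0 fact0 divr1 mul1r. Qed.

Lemma poisson_pS mu n : n.+1%:R * poisson_p mu n.+1 = mu * poisson_p mu n.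
Proof.
rewrite /poisson_p factS natrM exprS invfM; have : n.+1%:R != 0 :> R by [].
by move: (_ %:R) => x x0; field; rewrite x0 pnatr_eq0 -lt0n fact_gt0.
Qed.

(** Binomial theorem. It separates the added jump from the rest once Mecke's formula has shifted the
    argument. *)
Lemma poisson_pD t u m :
  poisson_p (t + u) m = \sum_(l < m.+1) poisson_p u (m - l) * poisson_p t l.
Proof.
rewrite addrC /poisson_p opprD expRD exprDn.
rewrite mulr_suml mulr_suml; apply: eq_bigr => -[l /= lm] _.
have := bin_fact (ltnSE lm) => /(congr1 (fun n => n%:R : R)); rewrite !natrM => <-.
have f0 n : n`!%:R != 0 :> R by rewrite pnatr_eq0 -lt0n fact_gt0.
have b0 : 'C(m, l)%:R != 0 :> R by rewrite pnatr_eq0 -lt0n bin_gt0.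
rewrite -mulr_natr.
by field; rewrite !f0 b0.
Qed.

Lemma nneseries_poisson_p mu : 0 <= mu -> (\sum_(c <oo) (poisson_p mu c)%:E = 1)%E.
Proof.
rewrite le_eqVlt => /predU1P[<-|mu0].
  rewrite nneseries_recl//; last by move=> *; rewrite lee_fin poisson_p_ge0.
  rewrite poisson_p0 oppr0 expR0 eseries0 ?adde0// => -[//|n] _ _.
  by rewrite /poisson_p exprS !mul0r.
have <- := @probability_setT _ _ _ (poisson_prob mu 0%N).
rewrite /= /poisson_prob mu0 nneseries_esumT; last first.
  by move=> *; rewrite lee_fin poisson_p_ge0// ltW.
by apply: eq_esum => n _; rewrite /poisson_pmf mu0.
Qed.

(** The quotient by [mu] is a Poisson weight divided by [n.+1], hence at most 1. With this bound [f]
    itself dominates the cumulant integrands. *)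
Lemma poisson_p_le mu n : 0 <= mu -> poisson_p mu n.+1 <= mu.
Proof.
move=> mu0; have -> : poisson_p mu n.+1 = mu * (poisson_p mu n / n.+1%:R).
  by rewrite mulrA -poisson_pS mulrC mulKf// pnatr_eq0.
rewrite ler_piMr// ler_pdivrMr// mul1r (@le_trans _ _ 1) ?ler1n//.
rewrite -lee_fin -[X in (_ <= X)%E](nneseries_poisson_p mu0).
rewrite (@nneseriesD1 _ _ n)//; last by move=> *; rewrite lee_fin poisson_p_ge0.
by rewrite leeDl// nneseries_ge0// => *; rewrite lee_fin poisson_p_ge0.
Qed.

End poisson_p.

Section compound_poisson.
Context {R : realType}.
Implicit Types (mu u t : R) (m n c : nat) (s : seq (R * R)) (phi psi : R -> \bar R).

(** Expectation of [phi] at [t] plus a sum of independent Poisson counts of means [mu] weighted by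
    [u], written as iterated series so that no probability space is involved. The argument [t]
    accumulates the jumps already chosen. *)
Fixpoint cpT s phi t : \bar R :=
  if s is (mu, u) :: s' then
    (\sum_(c <oo) (poisson_p mu c)%:E * cpT s' phi (t + c%:R * u)%R)%E
  else phi t.

Definition nnp (x : R * R) := (0 <= x.1) && (0 <= x.2).

Let cu_ge0 t u c : 0 <= t -> 0 <= u -> 0 <= t + c%:R * u.
Proof. by move=> t0 u0; rewrite addr_ge0// mulr_ge0. Qed.

Lemma cpT_ge0 s phi t : all nnp s -> (forall t, 0 <= t -> (0 <= phi t)%E) ->
  0 <= t -> (0 <= cpT s phi t)%E.
Proof.
move=> + phi0; elim: s t => [|[mu u] s IH] t /=; first by move=> _; exact: phi0.
move=> /andP[/andP[/= mu0 u0] sn] t0; apply: nneseries_ge0 => c _ _.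
by rewrite mule_ge0 ?lee_fin ?poisson_p_ge0// IH// cu_ge0.
Qed.

Lemma eq_cpT s phi psi t : all nnp s -> (forall t, 0 <= t -> phi t = psi t) ->
  0 <= t -> cpT s phi t = cpT s psi t.
Proof.
move=> + pp; elim: s t => [|[mu u] s IH] t /=; first by move=> _; exact: pp.
move=> /andP[/andP[/= mu0 u0] sn] t0; apply: eq_eseriesr => c _.
by rewrite IH// cu_ge0.
Qed.

Lemma cpTD s phi psi t : all nnp s -> (forall t, 0 <= t -> (0 <= phi t)%E) ->
  (forall t, 0 <= t -> (0 <= psi t)%E) -> 0 <= t ->
  cpT s (fun t => phi t + psi t)%E t = (cpT s phi t + cpT s psi t)%E.
Proof.
move=> + phi0 psi0; elim: s t => [//|[mu u] s IH] t /=.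
move=> /andP[/andP[/= mu0 u0] sn] t0.
rewrite -nneseriesD; last 2 first.
- by move=> c _ _; rewrite mule_ge0 ?lee_fin ?poisson_p_ge0 ?cpT_ge0 ?cu_ge0.
- by move=> c _ _; rewrite mule_ge0 ?lee_fin ?poisson_p_ge0 ?cpT_ge0 ?cu_ge0.
apply: eq_eseriesr => c _; rewrite IH ?cu_ge0//.
by rewrite ge0_muleDr ?cpT_ge0 ?cu_ge0.
Qed.

Lemma cpTZ s phi t k : all nnp s -> (forall t, 0 <= t -> (0 <= phi t)%E) ->
  0 <= t -> cpT s (fun t => k%:E * phi t)%E t = (k%:E * cpT s phi t)%E.
Proof.
move=> + phi0; elim: s t => [//|[mu u] s IH] t /=.
move=> /andP[/andP[/= mu0 u0] sn] t0.
rewrite -nneseriesZl; last first.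
  by move=> c _; rewrite mule_ge0 ?lee_fin ?poisson_p_ge0 ?cpT_ge0 ?cu_ge0.
by apply: eq_eseriesr => c _; rewrite IH ?cu_ge0// muleCA.
Qed.

Lemma cpT_sum s (I : Type) (r : seq I) (F : I -> R -> \bar R) t : all nnp s ->
  (forall i t, 0 <= t -> (0 <= F i t)%E) -> 0 <= t ->
  cpT s (fun t => \sum_(i <- r) F i t)%E t = (\sum_(i <- r) cpT s (F i) t)%E.
Proof.
move=> sn F0 t0; elim: r => [|i r IH].
  rewrite big_nil; under [fun t : R => _]eq_fun do rewrite big_nil -(mul0e 0%E).
  by rewrite (@cpTZ s (fun=> 0%E))// mul0e.
under [fun t : R => _]eq_fun do rewrite big_cons.
rewrite (@cpTD s (F i) (fun t => \sum_(j <- r) F j t)%E)//; first by rewrite IH big_cons.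
- by move=> *; exact: F0.
- by move=> x x0; apply: sume_ge0 => j _; exact: F0.
Qed.

Lemma cpT_shift s phi t u : cpT s (fun t => phi (t + u)%R) t = cpT s phi (t + u).
Proof.
elim: s t => [//|[mu v] s IH] t /=; apply: eq_eseriesr => c _.
by rewrite IH addrAC.
Qed.

(* Mecke's formula for a finite sum of weighted Poisson variables *)
Lemma cpT_mecke s phi t : all nnp s -> (forall t, 0 <= t -> (0 <= phi t)%E) ->
  0 <= t -> cpT s (fun t => t%:E * phi t)%E t =
  (t%:E * cpT s phi t + \sum_(a <- s) (a.1 * a.2)%:E * cpT s phi (t + a.2)%R)%E.
Proof.
move=> + phi0; elim: s t => [|[mu u] s IH] t /=.
  by move=> _ t0; rewrite big_nil adde0.
move=> /andP[/andP[/= mu0 u0] sn] t0; rewrite big_cons /=.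
have a0 (a : R * R) : a \in s -> 0 <= a.1 /\ 0 <= a.2.
  by move=> /(allP sn) /andP[].
have T0 x : 0 <= x -> (0 <= cpT s phi x)%E by move=> ?; exact: cpT_ge0.
have p0 c : (0 <= (poisson_p mu c)%:E)%E by rewrite lee_fin poisson_p_ge0.
under eq_eseriesr => c _.
  rewrite IH ?cu_ge0// EFinD ge0_muleDl ?lee_fin ?mulr_ge0//.
  rewrite ge0_muleDr; last 2 first.
  - by rewrite adde_ge0// mule_ge0 ?lee_fin ?mulr_ge0 ?T0 ?cu_ge0.
  - rewrite big_seq sume_ge0// => a /a0[a1 a2].
    by rewrite mule_ge0 ?lee_fin ?mulr_ge0 ?T0 ?addr_ge0 ?mulr_ge0.
  rewrite ge0_muleDr; last 2 first.
  - by rewrite mule_ge0 ?lee_fin ?T0 ?cu_ge0.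
  - by rewrite mule_ge0 ?lee_fin ?mulr_ge0 ?T0 ?cu_ge0.
  over.
rewrite nneseriesD; last 2 first.
- by move=> c _ _; apply: adde_ge0; rewrite !mule_ge0 ?p0 ?lee_fin ?mulr_ge0 ?T0 ?cu_ge0.
- move=> c _ _; rewrite mule_ge0// big_seq sume_ge0// => a /a0[a1 a2].
  by rewrite mule_ge0 ?lee_fin ?mulr_ge0 ?T0 ?addr_ge0 ?mulr_ge0.
rewrite nneseriesD; last 2 first.
- by move=> c _ _; rewrite !mule_ge0 ?p0 ?lee_fin ?mulr_ge0 ?T0 ?cu_ge0.
- by move=> c _ _; rewrite !mule_ge0 ?p0 ?lee_fin ?mulr_ge0 ?T0 ?cu_ge0.
rewrite -addeA; congr (_ + (_ + _))%E.
- rewrite -nneseriesZl; last by move=> c _; rewrite mule_ge0 ?T0 ?cu_ge0.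
  by apply: eq_eseriesr => c _; rewrite muleCA.
(* The term of index 0 vanishes; in the others [c.+1 * poisson_p mu c.+1] equals
   [mu * poisson_p mu c], and one unit of [u] moves into the argument of [phi]. *)
- rewrite nneseries_recl//; last first.
    by move=> c _; rewrite !mule_ge0 ?p0 ?lee_fin ?mulr_ge0 ?T0 ?cu_ge0.
  rewrite mul0r !mul0e mule0 add0e -nneseries_addn; last first.
    by move=> c; rewrite !mule_ge0 ?p0 ?lee_fin ?mulr_ge0 ?T0 ?cu_ge0.
  rewrite -nneseriesZl; last first.
    by move=> c _; rewrite mule_ge0 ?T0 ?cu_ge0 ?addr_ge0.
  apply: eq_eseriesr => c _; rewrite addn1 !muleA -!EFinM.
  have -> : t + c.+1%:R * u = t + u + c%:R * u by rewrite -natr1; ring.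
  by congr (_%:E * _)%E; rewrite mulrA (mulrC (poisson_p _ _)) poisson_pS; ring.
- transitivity (\sum_(c <oo) \sum_(a <- s | a \in s)
      (poisson_p mu c)%:E * ((a.1 * a.2)%:E * cpT s phi (t + c%:R * u + a.2)%R))%E.
    apply: eq_eseriesr => c _; rewrite big_seq ge0_sume_distrr//.
    move=> a /a0[a1 a2].
    by rewrite mule_ge0 ?lee_fin ?mulr_ge0 ?T0 ?addr_ge0 ?mulr_ge0.
  rewrite nneseries_sum; last first.
    move=> a c /a0[a1 a2].
    by rewrite !mule_ge0 ?p0 ?lee_fin ?mulr_ge0 ?T0 ?addr_ge0 ?mulr_ge0.
  rewrite [RHS]big_seq; apply: eq_bigr => a /a0[a1 a2].
  rewrite -nneseriesZl; last first.
    by move=> c _; rewrite mule_ge0 ?T0 ?cu_ge0 ?addr_ge0.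
  by apply: eq_eseriesr => c _; rewrite muleCA addrAC.
Qed.

(** Exponential tilting: a Poisson weight of mean [mu] times the [c]-th power of [expR (- u)] is, up
    to a constant, a Poisson weight of mean [mu * expR (- u)], and these sum to 1. *)
Lemma cpT_expRN s t : all nnp s -> 0 <= t ->
  cpT s (fun t => (expR (- t))%:E) t =
  (expR (- t) * expR (- \sum_(a <- s) a.1 * (1 - expR (- a.2))))%:E.
Proof.
elim: s t => [|[mu u] s IH] t /=.
  by move=> _ _; rewrite big_nil oppr0 expR0 mulr1.
move=> /andP[/andP[/= mu0 u0] sn] t0; rewrite big_cons/=.
set S := \sum_(a <- s) _.
under eq_eseriesr => c _.
  rewrite IH ?cu_ge0// -/S -EFinM.
  have -> : poisson_p mu c * (expR (- (t + c%:R * u)) * expR (- S)) =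
    (expR (- t) * expR (- (mu * (1 - expR (- u)) + S))) *
      poisson_p (mu * expR (- u)) c.
    rewrite /poisson_p exprMn -expRM_natl.
    have -> : - (mu * (1 - expR (- u)) + S) = - mu + mu * expR (- u) - S by ring.
    rewrite !opprD !expRD (expRN (mu * _)).
    have /lt0r_neq0 := expR_gt0 (mu * expR (- u)).
    have -> : (- (c%:R * u)) = c%:R * - u by rewrite mulrN.
    move: (expR (c%:R * - u)) (c`!%:R^-1) (expR (mu * _)) => x y z z0.
    by field.
  rewrite EFinM; over.
rewrite /= nneseriesZl; last first.
  by move=> c _; rewrite lee_fin poisson_p_ge0// mulr_ge0// expR_ge0.
by rewrite nneseries_poisson_p ?mule1// mulr_ge0// expR_ge0.
Qed.

(** Both sides satisfy the same recursion. Since [(m+1) p_(m+1)(t) = t p_m(t)], Mecke's formula adds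
    one jump [u] to the argument, and the convolution identity expands [p_m(t + u)] in the [p_l(t)]
    with [l <= m], to which the induction applies. *)
Lemma cpT_poisson s (q : nat -> R) M m : all nnp s ->
  q 0 = \sum_(a <- s) a.1 * (1 - expR (- a.2)) ->
  (forall n, q n.+1 = \sum_(a <- s) a.1 * poisson_p a.2 n.+1) ->
  (m < M)%N -> cpT s (fun t => (poisson_p t m)%:E) 0 = (cpmf q M m)%:E.
Proof.
move=> sn q0 qS; elim/ltn_ind: m => -[|m] IH mM.
  under [fun t : R => _]eq_fun do rewrite poisson_p0.
  by rewrite cpT_expRN// oppr0 expR0 mul1r -q0 cpmf0.
have a0 (a : R * R) : a \in s -> 0 <= a.1 /\ 0 <= a.2.
  by move=> /(allP sn) /andP[].
have pm0 (t : R) n : 0 <= t -> (0 <= (poisson_p t n)%:E)%E.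
  by move=> t0; rewrite lee_fin poisson_p_ge0.
rewrite cpmf_recE//.
transitivity (cpT s (fun t => (m.+1%:R^-1)%:E * (t%:E * (poisson_p t m)%:E))%E 0).
  by apply: eq_cpT => // t t0; rewrite -!EFinM -poisson_pS mulKf// pnatr_eq0.
rewrite cpTZ//; last by move=> t t0; rewrite mule_ge0 ?pm0 ?lee_fin.
rewrite cpT_mecke//; last by move=> t t0; rewrite pm0.
rewrite mul0e add0e EFinM; congr (_ * _)%E.
under eq_big_seq => a /a0[a1 a2].
  rewrite add0r -(add0r a.2) -cpT_shift.
  rewrite (@eq_cpT s _ (fun t => \sum_(l <- index_enum 'I_m.+1)
     (poisson_p a.2 (m - l))%:E * (poisson_p t l)%:E)%E)//; last first.
    by move=> t t0; rewrite poisson_pD -sumEFin; apply: eq_bigr.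
  rewrite cpT_sum//; last first.
    by move=> l t t0; rewrite mule_ge0 ?pm0.
  under eq_bigr => l _.
    rewrite cpTZ//; last by move=> t t0; rewrite pm0.
    rewrite IH//; last by apply: ltn_trans mM; case: l.
    rewrite -EFinM; over.
  rewrite sumEFin -EFinM add0r; over.
rewrite sumEFin; congr (_%:E).
under eq_bigr do rewrite mulr_sumr.
rewrite exchange_big/=; apply: eq_bigr => -[l /= lm] _.
rewrite subSn// qS mulr_sumr mulr_suml; apply: eq_bigr => a _.
by rewrite [X in _ = X * _]mulrCA poisson_pS; ring.
Qed.

End compound_poisson.

(** * Independence of Poisson counts *)

Section independent_counts.
Context {R : realType} {d} {Om : measurableType d} (Pr : probability Om R).
Context {J : eqType} (N : J -> nat -> set Om) (D : R -> set Om).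
Context (mu u : J -> R) (G : R -> \bar R) (full : seq J).
Hypothesis mN : forall a c, a \in full -> measurable (N a c).
Hypothesis mD : forall t, measurable (D t).
Hypothesis NI : forall a c c' w, a \in full -> N a c w -> N a c' w -> c = c'.
Hypothesis mu0 : forall a, 0 <= mu a.
Hypothesis u0 : forall a, 0 <= u a.
Hypothesis G0 : forall t, 0 <= t -> (0 <= G t)%E.
Hypothesis joint : forall (c : J -> nat) t, 0 <= t ->
  Pr (D t `&` \bigcap_(a in [set` full]) N a (c a)) =
  (G t * \prod_(a <- full) (poisson_p (mu a) (c a))%:E)%E.

(** The counts of the indices in [r] are prescribed by [c]; those in [s] are free and enter only
    through their weighted total, offset by [t]. *)
Let Ev (s r : seq J) (c : J -> nat) (t : R) : set Om :=
  [set w | (forall a, a \in r -> N a (c a) w) /\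
    exists c' : J -> nat, (forall a, a \in s -> N a (c' a) w) /\
       D (t + \sum_(a <- s) (c' a)%:R * u a) w].

Let upd (c : J -> nat) a n b := if b == a then n else c b.

Let EvS a s r c t : a \notin s -> a \notin r ->
  Ev (a :: s) r c t = \bigcup_n Ev s (a :: r) (upd c a n) (t + n%:R * u a).
Proof.
move=> as_ ar; apply/seteqP; split => w /=.
  move=> [rw [c' [sw Dw]]]; exists (c' a) => //=; split.
    move=> b; rewrite inE /upd => /predU1P[->|br].
      by rewrite eqxx; apply: sw; rewrite mem_head.
    by case: eqP => [->|_]; [apply: sw; rewrite mem_head|exact: rw].
  exists c'; split=> [b bs|]; first by apply: sw; rewrite inE bs orbT.
  by move: Dw; rewrite big_cons addrA.
move=> [n _ [rw [c' [sw Dw]]]]; split.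
  move=> b br; have := rw b; rewrite inE br orbT /upd => /(_ isT).
  by case: eqP => // ba; rewrite -ba br in ar.
exists (upd c' a n); split.
  move=> b; rewrite inE => /predU1P[->|bs].
    by have := rw a; rewrite mem_head => /(_ isT); rewrite /upd eqxx.
  rewrite /upd; case: eqP => [ba|_]; last exact: sw.
  by rewrite -ba bs in as_.
rewrite big_cons {1}/upd eqxx addrA; move: Dw.
congr D; congr (_ + _); apply: eq_big_seq => b bs; rewrite /upd.
by case: eqP => // ba; rewrite -ba bs in as_.
Qed.

(** Induction on [s]: the head index moves to [r], and the disjoint union over its count becomes the
    outer series of [cpT]. For empty [s] the event is the one of [joint]. *)
Let EvE s r c t : uniq full -> perm_eq (r ++ s) full -> 0 <= t ->
  measurable (Ev s r c t) /\
  Pr (Ev s r c t) = ((\prod_(a <- r) (poisson_p (mu a) (c a))%:E) *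
    cpT [seq (mu a, u a) | a <- s] G t)%E.
Proof.
move=> uf; elim: s r c t => [|a s IH] r c t pf t0.
  rewrite cats0 in pf.
  have -> : Ev [::] r c t = D t `&` \bigcap_(a in [set` full]) N a (c a).
    apply/seteqP; split => w /=.
      move=> [rw [c' [_]]]; rewrite big_nil addr0 => Dw; split => // a /=.
      by rewrite -(perm_mem pf) => /rw.
    move=> [Dw Nw]; split.
      by move=> a; rewrite (perm_mem pf) => /Nw.
    by exists c; rewrite big_nil addr0.
  split.
    apply: measurableI => //; apply: fin_bigcap_measurable => // a.
    exact: mN.
  by rewrite joint//= muleC (perm_big _ pf).
have up : uniq (r ++ a :: s) by rewrite (perm_uniq pf).
have pf' : perm_eq ((a :: r) ++ s) full.
  by rewrite /= -cat1s perm_catCA.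
have af : a \in full by rewrite -(perm_mem pf) mem_cat mem_head orbT.
have [ar as_] : a \notin r /\ a \notin s.
  move: up; rewrite cat_uniq => /and3P[_ /hasPn/(_ a)].
  by rewrite mem_head => /(_ isT) -> /=/andP[].
have IHn n := IH (a :: r) (upd c a n) _ pf' (addr_ge0 t0 (mulr_ge0 (ler0n R n) (u0 a))).
rewrite EvS//; split; first by apply: bigcupT_measurable => n; have [] := IHn n.
rewrite measure_semi_bigcup; last 3 first.
- by move=> n; have [] := IHn n.
- apply/trivIsetP => n n' _ _ nn'; apply/seteqP; split => // w [[Nn _] [Nn' _]].
  have := Nn a; rewrite /upd mem_head eqxx => /(_ isT) Na.
  have := Nn' a; rewrite /upd mem_head eqxx => /(_ isT) /(NI af Na) E.
  by rewrite E eqxx in nn'.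
- by apply: bigcupT_measurable => n; have [] := IHn n.
have nns : all nnp [seq (mu a, u a) | a <- s].
  by apply/allP => _ /mapP[b _ ->]; rewrite /nnp/= mu0 u0.
rewrite prodEFin /= -nneseriesZl; last first.
  move=> n _; rewrite mule_ge0 ?lee_fin ?poisson_p_ge0// cpT_ge0//.
  by rewrite addr_ge0// mulr_ge0.
apply: eq_eseriesr => n _; have [_ ->] := IHn n.
rewrite big_cons /upd eqxx [in RHS]muleCA -muleA; congr (_ * (_ * _))%E.
rewrite -prodEFin; apply: eq_big_seq => b br.
by case: eqP => // ba; rewrite -ba br in ar.
Qed.

(** The existential over count vectors stands for a random total, and it also requires each count to
    be a natural number. *)
Lemma prob_independent_counts : uniq full ->
  let E := [set w | exists c : J -> nat,
    (forall a, a \in full -> N a (c a) w) /\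
    D (\sum_(a <- full) (c a)%:R * u a) w] in
  measurable E /\ Pr E = cpT [seq (mu a, u a) | a <- full] G 0.
Proof.
move=> uf E; have -> : E = Ev full [::] (fun=> 0) 0.
  apply/seteqP; split => w /=; first by move=> [c ?]; split => //; exists c; rewrite add0r.
  by move=> [_ [c]]; rewrite add0r => ?; exists c.
by have [? ->] := @EvE full [::] (fun=> 0) 0 uf (perm_refl _) (lexx _); rewrite big_nil mul1e.
Qed.

End independent_counts.

(** * Functionals of Poisson point processes *)

Section esum_complements.
Context {R : realType} {d} {T : measurableType d}.
Implicit Types (S A : set T) (f : T -> R).

Lemma esumZl S (k : R) (a : T -> \bar R) : 0 <= k -> (forall z, 0 <= a z)%E ->
  (\esum_(z in S) (k%:E * a z) = k%:E * \esum_(z in S) a z)%E.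
Proof.
move=> k0 a0; rewrite /esum -ereal_supZl//; last first.
  by apply/set0P; exists (\sum_(x \in set0) a x)%E; exists set0 => //; exact: fsets_set0.
congr ereal_sup; apply/seteqP; split => [_ [A SA <-]|_ [_ [A SA <-] <-]] /=.
  by exists (\sum_(x \in A) a x)%E; [exists A|rewrite ge0_mule_fsumr].
by exists A => //; rewrite ge0_mule_fsumr.
Qed.

(** The sum is a supremum over finite subsets, so negative terms are simply left out. Fading marks
    can be negative on a null event; this identity allows every argument to be made with positive
    parts instead of almost surely. *)
Lemma esum_pos_part S f :
  (\esum_(z in S) (f z)%:E = \esum_(z in S) (Num.max (f z) 0)%:E)%E.
Proof.
apply/eqP; rewrite eq_le; apply/andP; split.
  by apply: le_esum => z _; rewrite lee_fin le_max lexx.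
apply: ge_ereal_sup => _ [A [fA AS] <-].
rewrite (fsbigID [set z | 0 < f z])//= addeC fsbig1 ?add0e; last first.
  by move=> z [_ /negP]; rewrite -leNgt => fz; rewrite max_r.
apply: ereal_sup_ubound; exists (A `&` [set z | 0 < f z]).
  by split; [exact: finite_setIl|move=> z [/AS]].
by apply: eq_fsbigr => z; rewrite inE => -[_ /= fz]; rewrite max_l// ltW.
Qed.

Lemma esum_card S c : (S #= `I_c)%card -> (\esum_(z in S) 1 = c%:R%:E :> \bar R)%E.
Proof.
move=> Sc; rewrite finite_card_sum; last by apply/finite_setP; exists c.
by rewrite (card_fset_set Sc).
Qed.

Lemma esum_infinite S : infinite_set S -> (\esum_(z in S) 1 = +oo :> \bar R)%E.
Proof.
move=> iS; rewrite -(infinite_card_dirac R iS).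
by apply: eq_esum => z Sz; rewrite diracE mem_set.
Qed.

End esum_complements.

(** * Dyadic step approximation *)

Section dyadic.
Context {R : realType} {d} {T : measurableType d} (f : T -> R).
Hypothesis f0 : forall z, 0 <= f z.

Definition dyk n z : nat := Num.truncn (2 ^+ n * Num.min (f z) n%:R).
Definition dya n z : R := (dyk n z)%:R / 2 ^+ n.
(** Level 0 gets no atom, hence the shift [i.+1]: the set where the step function vanishes may have
    infinite intensity, while positive levels have finite intensity by Markov's inequality. *)
Definition dyatom n i : set T := [set z | dyk n z = i.+1].

Let p2 n : 0 < 2 ^+ n :> R. Proof. by rewrite exprn_gt0. Qed.
Let arg0 n z : 0 <= 2 ^+ n * Num.min (f z) n%:R.
Proof. by rewrite mulr_ge0 ?(ltW (p2 n))// le_min f0 /=. Qed.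

Lemma dyk_le n z : (dyk n z <= n * 2 ^ n)%N.
Proof.
rewrite -(@ler_nat R) natrM natrX (@le_trans _ _ (2 ^+ n * Num.min (f z) n%:R))//.
  by rewrite truncn_le.
by rewrite mulrC ler_pM2r// ge_min lexx orbT.
Qed.

Lemma dya_ge0 n z : 0 <= dya n z.
Proof. by rewrite divr_ge0// ltW. Qed.

Lemma dya_le n z : dya n z <= f z.
Proof.
rewrite ler_pdivrMr// mulrC (@le_trans _ _ (2 ^+ n * Num.min (f z) n%:R))//.
  by rewrite truncn_le.
by rewrite ler_pM2l// ge_min lexx.
Qed.

Lemma dya_ndS n z : dya n z <= dya n.+1 z.
Proof.
rewrite /dya ler_pdivrMr// mulrAC ler_pdivlMr// exprS mulrA ler_pM2r//.
rewrite -natrM ler_nat truncn_ge_nat// natrM.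
rewrite exprS mulrC -mulrA ler_pM2l//.
rewrite (@le_trans _ _ (2 ^+ n * Num.min (f z) n%:R))//.
  by rewrite truncn_le.
by rewrite ler_pM2l// le_min2// ler_nat.
Qed.

Lemma dya_nd z : {homo dya^~ z : m n / (m <= n)%N >-> m <= n}.
Proof. by apply/nondecreasing_seqP => n; exact: dya_ndS. Qed.

Lemma cvg_dya z : dya n z @[n --> \oo] --> f z.
Proof.
apply/cvgrPdist_le => e e0; near=> n.
have fn : f z <= n%:R by near: n; exact: nbhs_infty_ger.
have en : (2^-1 : R) ^+ n <= e.
  near: n; have : (2^-1 : R) ^+ n @[n --> \oo] --> (0:R).
    by apply: cvg_expr; rewrite ger0_norm ?invr_ge0// invf_lt1 ?ltr1n.
  move=> /cvgrPdist_le /(_ _ e0); apply: filterS => n.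
  by rewrite sub0r normrN ger0_norm// exprn_ge0// invr_ge0.
rewrite ger0_norm ?subr_ge0 ?dya_le// (le_trans _ en)//.
rewrite exprVn lerBlDr /dya -[X in X + _]mul1r -mulrDl ler_pdivlMr// nat1r.
have := truncnS_gt (2 ^+ n * Num.min (f z) n%:R); rewrite min_l// mulrC => /ltW.
by rewrite /dyk min_l// (mulrC (2 ^+ n)).
Unshelve. all: by end_near. Qed.

(** The condition [phi 0 = 0] accounts for the missing level 0. *)
Lemma dya_sum (phi : R -> R) n z : phi 0 = 0 ->
  phi (dya n z) = \sum_(i < n * 2 ^ n) phi (i.+1%:R / 2 ^+ n) * \1_(dyatom n i) z.
Proof.
move=> phi0; rewrite /dya; have := dyk_le n z.
case E : (dyk n z) => [|k] kn.
  rewrite mul0r phi0 big1// => i _.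
  by rewrite indicE memNset ?mulr0// /dyatom /= E.
rewrite (bigD1 (Ordinal kn))//= indicE mem_set ?mulr1// big1 ?addr0// => i /eqP ik.
rewrite indicE memNset ?mulr0// /dyatom /= E => -[ki].
by apply: ik; apply/val_inj.
Qed.

Lemma esum_dya n (S : set T) : (\esum_(z in S) (dya n z)%:E =
  \sum_(i < n * 2 ^ n) (i.+1%:R / 2 ^+ n)%:E * \esum_(z in S `&` dyatom n i) 1)%E.
Proof.
under eq_esum do rewrite (@dya_sum id)// -sumEFin.
rewrite esum_sum/=; last first.
  by move=> z i _ _; rewrite lee_fin mulr_ge0// divr_ge0// ltW.
apply: eq_bigr => i _; rewrite esum_mkcondr.
rewrite -esumZl ?divr_ge0 ?(ltW (p2 n))//; last by move=> z; case: ifP.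
by apply: eq_esum => z _; rewrite EFinM indicE; case: (z \in _).
Qed.

(** Monotone convergence for a sum over an arbitrary, possibly uncountable set: the sums are suprema
    over finite subsets, and on a finite subset convergence is termwise. *)
Lemma cvg_esum_dya (S : set T) :
  (\esum_(z in S) (dya n z)%:E)%E @[n --> \oo] --> (\esum_(z in S) (f z)%:E)%E.
Proof.
have -> : (\esum_(z in S) (f z)%:E)%E =
    ereal_sup (range (fun n => \esum_(z in S) (dya n z)%:E)%E).
  apply/eqP; rewrite eq_le; apply/andP; split; last first.
    apply: ge_ereal_sup => _ [n _ <-]; apply: le_esum => z _.
    by rewrite lee_fin dya_le.
  apply: ge_ereal_sup => _ [A [fA AS] <-].
  rewrite fsbig_finite//= sumEFin.
  set s := finmap.enum_fset _.
  have c : (\sum_(z <- s) dya n z)%:E @[n --> \oo] --> (\sum_(z <- s) f z)%:E.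
    by apply: cvg_EFin; [near=> n => //|apply: cvgr_sum => z; exact: cvg_dya].
  rewrite -(cvg_lim _ c)//; apply: lime_le; first by apply/cvg_ex; eexists; exact: c.
  near=> n; apply: (@le_trans _ _ (\esum_(z in S) (dya n z)%:E)%E); last first.
    by apply: ereal_sup_ubound; exists n.
  apply: ereal_sup_ubound; exists A => //.
  by rewrite fsbig_finite//= sumEFin.
apply: ereal_nondecreasing_cvgn => m n mn; apply: le_esum => z _.
by rewrite lee_fin dya_nd.
Unshelve. all: by end_near. Qed.

Hypothesis mf : measurable_fun setT f.

Lemma measurable_dyatom n i : measurable (dyatom n i).
Proof.
have -> : dyatom n i = (fun z => 2 ^+ n * Num.min (f z) n%:R) @^-1` `[i.+1%:R, i.+2%:R[.
  apply/seteqP; split => z /=; rewrite /dyatom /= /dyk in_itv/=.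
    by move=> <-; exact: truncn_itv.
  by move=> /truncn_def.
rewrite -[X in measurable X]setTI.
have m : measurable_fun setT (fun z => 2 ^+ n * Num.min (f z) n%:R).
  by apply: measurable_funM => //; apply: measurable_minr.
exact: m.
Qed.

Lemma measurable_dya (phi : R -> R) n : phi 0 = 0 ->
  measurable_fun setT (fun z => phi (dya n z)).
Proof.
move=> phi0; under eq_fun do rewrite dya_sum//.
apply: measurable_sum => i; apply: measurable_funM => //.
by apply: measurable_indic; exact: measurable_dyatom.
Qed.

Context (nu : {measure set T -> \bar R}).
Hypothesis intf : (\int[nu]_z (f z)%:E < +oo)%E.

Lemma dyatom_fin n i : (nu (dyatom n i) < +oo)%E.
Proof.
have e0 : 0 < i.+1%:R / 2 ^+ n :> R by rewrite divr_gt0.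
have mfE : measurable_fun setT (EFin \o f) by exact/measurable_EFinP.
have := le_integral_abse nu measurableT mfE e0.
set A := _ `&` _ => leA.
have mA : measurable A.
  by apply: emeasurable_fun_c_infty => //; exact: measurableT_comp.
apply: (@le_lt_trans _ _ (nu A)).
  apply: le_measure; rewrite ?inE//; first exact: measurable_dyatom.
  move=> z dz; split => //=; rewrite lee_fin ger0_norm//.
  by apply: le_trans (dya_le n z); rewrite /dya dz.
have : ((i.+1%:R / 2 ^+ n)%:E * nu A < +oo)%E.
  apply: (le_lt_trans leA); under eq_integral do rewrite /= ger0_norm//.
  exact: intf.
case: (nu A) => [r _||//]; first by rewrite ltry.
by rewrite gt0_muley// lte_fin.
Qed.

Lemma integral_dya (phi : R -> R) n : phi 0 = 0 -> (forall x, 0 <= x -> 0 <= phi x) ->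
  (\int[nu]_z (phi (dya n z))%:E)%E =
  (\sum_(i < n * 2 ^ n) fine (nu (dyatom n i)) * phi (i.+1%:R / 2 ^+ n))%:E.
Proof.
move=> phi0 phi_ge0; under eq_integral do rewrite dya_sum// -sumEFin.
have px i : 0 <= phi (i.+1%:R / 2 ^+ n) by rewrite phi_ge0// divr_ge0// ltW.
rewrite ge0_integral_sum//; last 2 first.
- move=> i; apply/measurable_EFinP; apply: measurable_funM => //.
  by apply: measurable_indic; exact: measurable_dyatom.
- by move=> i z _; rewrite lee_fin mulr_ge0.
rewrite -sumEFin; apply: eq_bigr => i _.
under eq_integral do rewrite EFinM.
rewrite ge0_integralZl_EFin//; last first.
  apply/measurable_EFinP; apply: measurable_indic; exact: measurable_dyatom.
rewrite integral_indic//; last exact: measurable_dyatom.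
by rewrite setIT EFinM fineK 1?muleC// ge0_fin_numE ?dyatom_fin.
Qed.

(** The bounds on [phi] make [f] a dominating function and force [phi 0 = 0]. *)
Lemma cvg_integral_dya (phi : R -> R) : (forall x, 0 <= x -> 0 <= phi x <= x) ->
  continuous phi ->
  \sum_(i < n * 2 ^ n) fine (nu (dyatom n i)) * phi (i.+1%:R / 2 ^+ n)
    @[n --> \oo] --> fine (\int[nu]_z (phi (f z))%:E)%E.
Proof.
move=> phi_le cphi.
have phi0 : phi 0 = 0.
  by apply/eqP; rewrite eq_le; have /andP[-> ->] := phi_le _ (lexx 0).
have phi_ge0 x : 0 <= x -> 0 <= phi x by move=> /phi_le /andP[].
have mphif : measurable_fun setT (EFin \o (phi \o f)).
  apply/measurable_EFinP; apply: measurableT_comp => //.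
  exact: continuous_measurable_fun.
have fin : (\int[nu]_z (phi (f z))%:E)%E \is a fin_num.
  rewrite ge0_fin_numE; last by apply: integral_ge0 => z _; rewrite lee_fin phi_ge0.
  apply: le_lt_trans intf; apply: ge0_le_integral => //.
  - by move=> z _; rewrite lee_fin phi_ge0.
  - exact/measurable_EFinP.
  - by move=> z _; rewrite lee_fin; have /andP[] := phi_le _ (f0 z).
have : (\int[nu]_z (phi (dya n z))%:E)%E @[n --> \oo] --> (\int[nu]_z (phi (f z))%:E)%E.
  apply: (@dominated_cvg _ _ _ _ _ measurableT _ _ (EFin \o f)) => //.
  - by move=> n; apply/measurable_EFinP; exact: measurable_dya.
  - move=> z _; apply: cvg_EFin; first by near=> n.
    by apply: continuous_cvg; [exact: cphi|exact: cvg_dya].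
  - apply/integrableP; split; first exact/measurable_EFinP.
    by under eq_integral do rewrite /= ger0_norm//.
  - move=> n z _ /=; rewrite lee_fin ger0_norm ?phi_ge0 ?dya_ge0//.
    by apply: le_trans (dya_le n z); have /andP[] := phi_le _ (dya_ge0 n z).
under eq_fun do rewrite integral_dya//.
by rewrite -(fineK fin) => /fine_cvgP[].
Unshelve. all: by end_near. Qed.

End dyadic.

Lemma big_option (R : Type) (idx : R) (op : Monoid.com_law idx) (I : finType)
    (F : option I -> R) :
  \big[op/idx]_i F i = op (F None) (\big[op/idx]_i F (Some i)).
Proof.
rewrite (bigD1 None)//=; congr (op _ _).
rewrite (reindex_omap (fun i : I => Some i) id) /=; last by case.
by apply: eq_bigl => i; rewrite eqxx.
Qed.

Lemma measurable_ltr_set {R : realType} {d} {T : measurableType d} (f g : T -> R) :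
  measurable_fun setT f -> measurable_fun setT g ->
  measurable [set x | f x < g x].
Proof.
move=> mf mg; have := measurable_fun_ltr mf mg measurableT (Y := [set true]) I.
by rewrite setTI; congr (measurable _); apply/seteqP; split => x.
Qed.

Lemma measurable_le_EFin {R : realType} {d} {T : measurableType d}
    (I : T -> \bar R) (h : T -> R) :
  measurable_fun setT I -> measurable_fun setT h ->
  measurable [set x | (I x <= (h x)%:E)%E].
Proof.
move=> mI mh; have := emeasurable_fun_infty_c measurableT
  (emeasurable_funB mI (measurableT_comp (@EFin_measurable R setT) mh)) 0%E.
rewrite setTI; congr (measurable _); apply/funext => x /=; apply/propext.
by rewrite EFinN leeBlDr// add0e.
Qed.

Lemma seq_lt_gap {R : realType} {T : eqType} (rho : T -> R) (r : R) (s : seq T) :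
  (forall z, z \in s -> r < rho z) ->
  exists2 e, r < e & forall z, z \in s -> e < rho z.
Proof.
elim: s => [|z s IH] rs; first by exists (r + 1) => //; rewrite ltrDl.
have [e re es] := IH (fun z zs => rs z (mem_behead (s := _ :: _) zs)).
have rz := rs z (mem_head _ _).
exists (Num.min e ((r + rho z) / 2)); first by rewrite lt_min re midf_lt.
move=> y; rewrite inE => /predU1P[->|/es ey]; rewrite gt_min ?ey//.
by rewrite (midf_lt rz) orbT.
Qed.

(** * Measurability of sums over a Poisson process *)

Section ppp_functional.
Context {R : realType} {d} {Om : measurableType d} (Pr : probability Om R).
Context {dT} {T : measurableType dT}.
Context (nu : {measure set T -> \bar R}) (Phi : Om -> set T).
Hypothesis ppp : is_ppp Pr nu Phi.

Lemma measurable_count (A : set T) : measurable A -> (nu A < +oo)%E ->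
  measurable_fun setT (fun w => \esum_(z in Phi w `&` A) (1 : \bar R))%E.
Proof.
move=> mA nuA mT; apply: (measurability _ (ErealGenCInfty.measurableE R)) => //.
move=> _ [_ [y ->] <-]; rewrite setTI.
(* Passing to the complement of finitely many finite counts puts the infinite count into the
   event. *)
rewrite [X in measurable X](_ : _ =
    ~` \bigcup_(c in [set c : nat | c%:R < y]) count_eq Phi A c).
  apply: measurableC; apply: bigcup_measurable => c _.
  by have [] := ppp.1 A c mA nuA.
apply/seteqP; split => w /=; rewrite in_itv/= andbT.
  move=> yw [c /= cy cw]; move: yw; rewrite (esum_card cw) lee_fin.
  by rewrite leNgt cy.
move=> Nw; have [|/esum_infinite ->] := pselect (finite_set (Phi w `&` A)).
  move=> /finite_setP[c cw]; rewrite (esum_card cw) lee_fin leNgt.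
  by apply/negP => cy; apply: Nw; exists c.
by rewrite leey.
Qed.

Lemma measurable_ppp_esum (f : T -> R) : (forall z, 0 <= f z) ->
  measurable_fun setT f -> (\int[nu]_z (f z)%:E < +oo)%E ->
  measurable_fun setT (fun w => \esum_(z in Phi w) (f z)%:E)%E.
Proof.
move=> f0 mf intf.
apply: (emeasurable_fun_cvg (fun n w => \esum_(z in Phi w) (dya f n z)%:E)%E).
  move=> n; under eq_fun do rewrite esum_dya//.
  apply: emeasurable_sum => i; apply: emeasurable_funM => //.
  by apply: measurable_count; [exact: measurable_dyatom|exact: dyatom_fin].
by move=> w _; exact: cvg_esum_dya.
Qed.

(** A finite subsum exceeding [y] uses finitely many points, all strictly beyond the threshold, so
    it is still present beyond some rational [q > r w]. Countably many deterministic thresholds thus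
    suffice, and they are positive since [r] is nonnegative. *)
Lemma measurable_ppp_esum_random (g rho : T -> R) (r : Om -> R) :
  (forall z, 0 <= g z) -> measurable_fun setT g -> measurable_fun setT rho ->
  measurable_fun setT r -> (forall w, 0 <= r w) ->
  (forall q, 0 < q -> (\int[nu]_z (g z * \1_[set z | (q < rho z)%R] z)%:E < +oo)%E) ->
  measurable_fun setT
    (fun w => \esum_(z in [set z | Phi w z /\ (r w < rho z)%R]) (g z)%:E)%E.
Proof.
move=> g0 mg mrho mr r0 intg.
have mrq q : measurable [set z | q < rho z].
  exact: measurable_ltr_set.
pose I q w := (\esum_(z in Phi w) (g z * \1_[set z | (q < rho z)%R] z)%:E)%E.
have IE q w : I q w = (\esum_(z in [set z | Phi w z /\ (q < rho z)%R]) (g z)%:E)%E.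
  rewrite (esum_mkcondr (Phi w) [set z | q < rho z]); apply: eq_esum => z _.
  by rewrite indicE; case: (z \in _); rewrite ?mulr1 ?mulr0.
have mI q : 0 < q -> measurable_fun setT (I q).
  move=> q0; apply: measurable_ppp_esum => [z||]; first by rewrite mulr_ge0.
    by apply: measurable_funM => //; exact: measurable_indic.
  exact: intg.
move=> mT; apply: (measurability _ (ErealGenOInfty.measurableE R)) => //.
move=> _ [_ [y ->] <-]; rewrite setTI.
rewrite [X in measurable X](_ : _ = \bigcup_(q in [set q : rat | 0 < ratr q :> R])
    ([set w | r w < ratr q] `&` [set w | (y%:E < I (ratr q) w)%E])).
  rewrite bigcup_mkcond; apply: bigcupT_measurable_rat => q.
  case: ifPn; rewrite ?inE//= => q0; apply: measurableI.
    exact: measurable_ltr_set.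
  rewrite -[X in measurable X]setTI; apply: emeasurable_fun_o_infty => //.
  exact: mI.
apply/seteqP; split => w /=; rewrite in_itv/= andbT; last first.
  move=> [q /= q0 [rq]]; rewrite IE => /lt_le_trans; apply.
  apply: le_ereal_sup => _ [A [fA AS] <-]; exists A => //; split=> // z /AS[? ?].
  by split => //; apply: lt_trans rq _.
move=> /ereal_sup_gt[_ [A [fA AS] <-]] yA.
have [e re eA] : exists2 e, r w < e & forall z, A z -> e < rho z.
  move/finite_fsetP : fA => [s sA].
  have [|e re es] := @seq_lt_gap _ _ rho (r w) (finmap.enum_fset s).
    by move=> z zs; have [] := AS z; rewrite ?sA.
  by exists e => // z; rewrite sA => /es.
have [q] := rat_in_itvoo re; rewrite in_itv/= => /andP[rq qe].
exists q => /=; first by apply: le_lt_trans rq.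
split => //; rewrite IE; apply: lt_le_trans yA _; apply: ereal_sup_ubound.
exists A => //; split => // z Az; split; first by have [] := AS z Az.
by apply: lt_trans qe _; exact: eA.
Qed.

End ppp_functional.

(** * Coverage against independent Poisson processes *)

Section ppp_outage.
Context {R : realType} {K : nat} {d} {Om : measurableType d} (Pr : probability Om R).
Context {dT} {T : measurableType dT}.
Context (nu : 'I_K -> {measure set T -> \bar R}) (Phi : 'I_K -> Om -> set T).
Context (X H : Om -> R) (M : nat).
Hypothesis ppp : forall j, is_ppp Pr (nu j) (Phi j).
Hypothesis mX : measurable_fun setT X.
Hypothesis mH : measurable_fun setT H.
Hypothesis Hlaw : forall t, 0 <= t ->
  Pr (H @^-1` `[t, +oo[) = (\sum_(m < M) poisson_p t m)%:E.
Hypothesis indep : mutually_indep Pr (fun s : option (option 'I_K) =>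
  match s with
  | None => fin_inter [set X @^-1` S | S in @measurable _ R]
  | Some None => fin_inter [set H @^-1` S | S in @measurable _ R]
  | Some (Some j) => fin_inter
      [set E | exists (A : set T) (n : nat),
         [/\ measurable A, (nu j A < +oo)%E & E = count_eq (Phi j) A n]]
  end).
Context (f : 'I_K -> T -> R).
Hypothesis f0 : forall j z, 0 <= f j z.
Hypothesis mf : forall j, measurable_fun setT (f j).
Hypothesis intf : forall j, (\int[nu j]_z (f j z)%:E < +oo)%E.

Let fin_inter1 (G : set (set Om)) E : G E -> fin_inter G E.
Proof.
move=> GE; exists 1, (fun=> E); split => //; apply/seteqP; split => w.
  by move=> Ew i _.
by move=> /(_ ord0 I).
Qed.

(** Mutual independence factors the probability over [X], [H] and the tiers; disjointness of the
    dyadic atoms factors it further within a tier. *)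
Let joint_counts (S : set R) n (c : 'I_K * 'I_(n * 2 ^ n) -> nat) t :
  measurable S -> 0 <= t ->
  Pr ((X @^-1` S `&` H @^-1` `[t, +oo[) `&`
      \bigcap_(a in [set` enum {: 'I_K * 'I_(n * 2 ^ n)}])
         count_eq (Phi a.1) (dyatom (f a.1) n a.2) (c a)) =
  (Pr (X @^-1` S) * (\sum_(m < M) poisson_p t m)%:E *
   \prod_(a <- enum {: 'I_K * 'I_(n * 2 ^ n)})
      (poisson_p (fine (nu a.1 (dyatom (f a.1) n a.2))) (c a))%:E)%E.
Proof.
move=> mS t0.
have fa j i : measurable (dyatom (f j) n i) /\ (nu j (dyatom (f j) n i) < +oo)%E.
  by split; [exact: measurable_dyatom|exact: dyatom_fin].
pose C j (i : 'I_(n * 2 ^ n)) := count_eq (Phi j) (dyatom (f j) n i) (c (j, i)).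
pose E (s : option (option 'I_K)) := match s with
  | None => X @^-1` S | Some None => H @^-1` `[t, +oo[
  | Some (Some j) => \bigcap_i C j i end.
have -> : (X @^-1` S `&` H @^-1` `[t, +oo[) `&`
      \bigcap_(a in [set` enum {: 'I_K * 'I_(n * 2 ^ n)}])
         count_eq (Phi a.1) (dyatom (f a.1) n a.2) (c a) = \bigcap_s E s.
  apply/seteqP; split => w /=.
    move=> [[Xw Hw] Cw] [[j|]|]//= _ i _.
    by have := Cw (j, i); rewrite /= mem_enum => /(_ isT).
  move=> Ew; split; first by split; [exact: (Ew None)|exact: (Ew (Some None))].
  by move=> [j i] _; exact: (Ew (Some (Some j)) I i I).
rewrite indep; last first.
  move=> [[j|]|] /=.
  - exists (n * 2 ^ n)%N, (C j); split => // i; exists (dyatom (f j) n i), (c (j, i)).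
    by have [] := fa j i.
  - by apply: fin_inter1; exists `[t, +oo[%classic.
  - by apply: fin_inter1; exists S.
rewrite !big_option /= Hlaw// muleA; congr (_ * _)%E.
rewrite big_enum/= [RHS](eq_bigr (fun a : 'I_K * 'I_(n * 2 ^ n) =>
  (poisson_p (fine (nu a.1 (dyatom (f a.1) n a.2))) (c (a.1, a.2)))%:E)); last by case.
rewrite -(pair_bigA _ (fun (j : 'I_K) (i : 'I_(n * 2 ^ n)) =>
  (poisson_p (fine (nu j (dyatom (f j) n i))) (c (j, i)))%:E))/=.
apply: eq_bigr => j _.
have := (ppp j).2 _ (fun i : 'I_(n * 2 ^ n) => dyatom (f j) n i) (fun i => c (j, i)).
rewrite /mutually_indep => -> //; last first.
  move=> i i' /eqP ii'; apply/seteqP; split => // z []; rewrite /dyatom/= => -> [?].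
  by apply: ii'; apply/val_inj.
apply: eq_bigr => i _; have [mA nA] := fa j i.
by have [_ ->] := (ppp j).1 _ (c (j, i)) mA nA.
Qed.

(** Every level is positive, so a single infinite count would push the sum above [H]. On the event
    all counts are therefore natural numbers and the sum is a weighted total. *)
Let step_event (S : set R) n :
  X @^-1` S `&` [set w | (\sum_(j < K) \esum_(z in Phi j w) (dya (f j) n z)%:E
                          <= (H w)%:E)%E] =
  [set w | exists c : 'I_K * 'I_(n * 2 ^ n) -> nat,
    (forall a, a \in enum {: 'I_K * 'I_(n * 2 ^ n)} ->
       count_eq (Phi a.1) (dyatom (f a.1) n a.2) (c a) w) /\
    (X @^-1` S `&` H @^-1` `[\sum_(a <- enum {: 'I_K * 'I_(n * 2 ^ n)})
        (c a)%:R * (a.2.+1%:R / 2 ^+ n), +oo[) w].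
Proof.
have p2 i : 0 < i.+1%:R / 2 ^+ n :> R by rewrite divr_gt0// exprn_gt0.
have sumE w : (\sum_(j < K) \esum_(z in Phi j w) (dya (f j) n z)%:E =
    \sum_(a : 'I_K * 'I_(n * 2 ^ n)) (a.2.+1%:R / 2 ^+ n)%:E *
      \esum_(z in Phi a.1 w `&` dyatom (f a.1) n a.2) 1)%E.
  rewrite -(pair_bigA _ (fun (j : 'I_K) (i : 'I_(n * 2 ^ n)) =>
    (i.+1%:R / 2 ^+ n)%:E * \esum_(z in Phi j w `&` dyatom (f j) n i) 1)%E)/=.
  by apply: eq_bigr => j _; rewrite esum_dya.
apply/seteqP; split => w /=; rewrite sumE.
  move=> [Xw le_w].
  have fin (a : 'I_K * 'I_(n * 2 ^ n)) : exists c, count_eq (Phi a.1) (dyatom (f a.1) n a.2) c w.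
    apply/finite_setP; apply: contrapT => /(esum_infinite (R := R)) inf_a.
    move: le_w; rewrite (bigD1 a)//= inf_a gt0_muley ?lte_fin// addye//.
    apply/eqP => E; have : (0 <= -oo :> \bar R)%E.
      rewrite -E; apply: sume_ge0 => b _.
      by rewrite mule_ge0 ?lee_fin ?(ltW (p2 _))// esum_ge0.
    by [].
  have [c cw] := choice fin; exists c; split; first by move=> a _; exact: cw.
  split => //; rewrite in_itv/= andbT -lee_fin; apply: le_trans le_w.
  rewrite big_enum/= -sumEFin; apply: lee_sum => a _.
  by rewrite (esum_card (cw a)) EFinM muleC.
move=> [c [cw [Xw]]]; rewrite in_itv/= andbT -lee_fin => le_w; split => //.
apply: le_trans le_w; rewrite big_enum/= -sumEFin; apply: lee_sum => a _.
by rewrite (esum_card (cw a _)) ?mem_enum// EFinM muleC.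
Qed.

(** Index 0 is the exponent of the Laplace functional; index [n >= 1] is the rate of jumps of size
    [n] of the associated compound Poisson variable. *)
Definition ppp_cumulant (n : nat) : R := \sum_(j < K)
  fine (\int[nu j]_z (if n == 0 then 1 - expR (- f j z) else poisson_p (f j z) n)%:E)%E.

Let step_cumulant n (m : nat) : R := \sum_(a <- [seq (fine (nu a.1 (dyatom (f a.1) n a.2)),
    a.2.+1%:R / 2 ^+ n) | a : 'I_K * 'I_(n * 2 ^ n) <- enum {: 'I_K * 'I_(n * 2 ^ n)}])
  a.1 * (if m == 0 then 1 - expR (- a.2) else poisson_p a.2 m).

Let cvg_step_cumulant m : step_cumulant n m @[n --> \oo] --> ppp_cumulant m.
Proof.
pose phi (x : R) := if m == 0 then 1 - expR (- x) else poisson_p x m.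
have -> : step_cumulant ^~ m = (fun n => \sum_(j < K) \sum_(i < n * 2 ^ n)
    fine (nu j (dyatom (f j) n i)) * phi (i.+1%:R / 2 ^+ n)).
  apply/funext => n; rewrite /step_cumulant big_map big_enum/=.
  by rewrite (pair_bigA _ (fun (j : 'I_K) (i : 'I_(n * 2 ^ n)) =>
    fine (nu j (dyatom (f j) n i)) * phi (i.+1%:R / 2 ^+ n))).
apply: cvgr_sum => j.
apply: (@cvg_integral_dya _ _ _ (f j) (f0 j) (mf j) (nu j) (intf j) phi).
  move=> x x0; rewrite {}/phi; case: m => [|m] /=.
    rewrite subr_ge0 -expR0 ler_expR oppr_le0 x0/= lerBlDr -lerBlDl.
    by rewrite expR0; exact: expR_ge1Dx.
  by rewrite poisson_p_ge0// poisson_p_le.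
rewrite {}/phi; case: m => [|m] x /=.
  apply: cvgB; first exact: cvg_cst.
  by apply: continuous_comp; [exact: continuousN|exact: continuous_expR].
apply: cvgM.
  by apply: cvgM; [exact: exprn_continuous|exact: cvg_cst].
by apply: continuous_comp; [exact: continuousN|exact: continuous_expR].
Qed.

(** The step functions increase to [f], so the step events decrease, and because the inequality is
    weak their intersection is the event itself. Continuity from above then meets the continuity of
    [cpmf]. The set [S] is carried along for use on each cell of serving distances. *)
Theorem prob_ppp_le (S : set R) : measurable S ->
  Pr (X @^-1` S `&` [set w | (\sum_(j < K) \esum_(z in Phi j w) (f j z)%:E
                              <= (H w)%:E)%E]) =
  (Pr (X @^-1` S) * (\sum_(m < M) cpmf ppp_cumulant M m)%:E)%E.
Proof.
move=> mS.
pose E n := X @^-1` S `&` [set w |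
  (\sum_(j < K) \esum_(z in Phi j w) (dya (f j) n z)%:E <= (H w)%:E)%E].
have pS : Pr (X @^-1` S) \is a fin_num.
  by apply: fin_num_measure; rewrite -[X in measurable X]setTI; exact: mX.
have En n : measurable (E n) /\
    Pr (E n) = (fine (Pr (X @^-1` S)) * \sum_(m < M) cpmf (step_cumulant n) M m)%:E.
  rewrite /E step_event.
  pose mu := fun a : 'I_K * 'I_(n * 2 ^ n) => fine (nu a.1 (dyatom (f a.1) n a.2)).
  pose u := fun a : 'I_K * 'I_(n * 2 ^ n) => a.2.+1%:R / 2 ^+ n : R.
  have mu0 a : 0 <= mu a by rewrite fine_ge0.
  have u0 a : 0 <= u a by rewrite divr_ge0// exprn_ge0.
  have fa j i : measurable (dyatom (f j) n i) /\ (nu j (dyatom (f j) n i) < +oo)%E.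
    by split; [exact: measurable_dyatom|exact: dyatom_fin].
  have nns : all nnp [seq (mu a, u a) | a <- enum {: 'I_K * 'I_(n * 2 ^ n)}].
    by apply/allP => _ /mapP[b _ ->]; rewrite /nnp/= mu0 u0.
  have Gp t m : 0 <= t -> (0 <= (poisson_p t m)%:E :> \bar R)%E.
    by move=> t0; rewrite lee_fin poisson_p_ge0.
  have := @prob_independent_counts _ _ _ Pr _
    (fun a : 'I_K * 'I_(n * 2 ^ n) => count_eq (Phi a.1) (dyatom (f a.1) n a.2))
    (fun t => X @^-1` S `&` H @^-1` `[t, +oo[) mu u
    (fun t => Pr (X @^-1` S) * (\sum_(m < M) poisson_p t m)%:E)%E (enum {: 'I_K * 'I_(n * 2 ^ n)}).
  move=> [].
  - by move=> a c _; have [mA fA] := fa a.1 a.2; have [] := (ppp a.1).1 _ c mA fA.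
  - move=> t; apply: measurableI; rewrite -[X in measurable X]setTI.
      exact: mX.
    exact: mH.
  - move=> a c c' w _ ac ac'; have := esum_card (R := R) ac.
    by rewrite (esum_card ac') => -[] /eqP; rewrite eqr_nat => /eqP.
  - exact: mu0.
  - exact: u0.
  - by move=> t t0; rewrite mule_ge0// lee_fin sumr_ge0// => m _; rewrite poisson_p_ge0.
  - by move=> c t t0; exact: joint_counts.
  - exact: enum_uniq.
  move=> mE ->; split; first exact: mE.
  rewrite -(fineK pS) cpTZ//; last first.
    by move=> t t0; rewrite lee_fin sumr_ge0// => m _; rewrite poisson_p_ge0.
  rewrite EFinM fineK//; congr (_ * _)%E.
  under [fun t : R => _]eq_fun do rewrite -sumEFin.
  rewrite cpT_sum//; last by move=> m t t0; exact: Gp.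
  rewrite -sumEFin; apply: eq_bigr => m _.
  by apply: cpT_poisson.
have cap : \bigcap_n E n = X @^-1` S `&` [set w |
    (\sum_(j < K) \esum_(z in Phi j w) (f j z)%:E <= (H w)%:E)%E].
  apply/seteqP; split => w /=.
    move=> Ew; split; first by have [] := Ew 0%N I.
    have c : (\sum_(j < K) \esum_(z in Phi j w) (dya (f j) n z)%:E)%E
        @[n --> \oo] --> (\sum_(j < K) \esum_(z in Phi j w) (f j z)%:E)%E.
      apply: cvg_nnesum => j _; last exact: cvg_esum_dya.
      by near=> n; apply: esum_ge0 => z _; rewrite lee_fin dya_ge0.
    rewrite -(cvg_lim _ c)//; apply: lime_le; first by apply/cvg_ex; eexists; exact: c.
    by near=> n; have [] := Ew n I.
  move=> [Xw le_w] n _; split => //=; apply: le_trans le_w; apply: lee_sum => j _.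
  by apply: le_esum => z _; rewrite lee_fin dya_le.
have c1 : (Pr \o E) n @[n --> \oo] --> Pr (\bigcap_n E n).
  apply: nonincreasing_cvg_mu.
  - by rewrite (le_lt_trans (probability_le1 _ (En 0%N).1)) ?ltry.
  - by move=> n; exact: (En n).1.
  - by apply: bigcapT_measurable => n; exact: (En n).1.
  - move=> m n mn; apply/subsetPset => w [Xw le_w]; split => //=.
    apply: le_trans le_w; apply: lee_sum => j _; apply: le_esum => z _.
    by rewrite lee_fin dya_nd.
rewrite -cap -(fineK pS) -EFinM; apply: (cvg_unique _ c1) => //.
have -> : Pr \o E = EFin \o (fun n => fine (Pr (X @^-1` S)) *
    \sum_(m < M) cpmf (step_cumulant n) M m).
  by apply/funext => n /=; rewrite (En n).2.
apply: cvg_EFin; first by near=> n.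
apply: cvgM; first exact: cvg_cst.
by apply: cvgr_sum => m; apply: cvg_cpmf => //; exact: cvg_step_cumulant.
Unshelve. all: by end_near. Qed.

End ppp_outage.

(** * Integration on the line *)

Section integration_tools.
Context {R : realType}.
Implicit Types (f F G : R -> R) (a b : R) (U : set R).
Local Notation lam := (@lebesgue_measure R).

(** Differentiability on an open set containing the interval supplies the one-sided limits at the
    endpoints. *)
Lemma FTC2_open U f F a b : open U -> (forall x, U x -> is_derive x 1 F (f x)) ->
  (forall x, U x -> {for x, continuous f}) -> `[a, b] `<=` U -> a < b ->
  (\int[lam]_(x in `[a, b]) (f x)%:E = (F b - F a)%:E)%E.
Proof.
move=> oU dF cf abU ab.
have aU : U a by apply: abU; rewrite /= in_itv/= lexx ltW.
have bU : U b by apply: abU; rewrite /= in_itv/= lexx ltW.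
have cF x : U x -> {for x, continuous F}.
  move=> Ux; have := dF x Ux => -[/derivable1_diffP dfx _].
  exact: differentiable_continuous.
have ooU x : x \in `]a, b[ -> U x by move=> xab; apply: abU; apply: subset_itv_oo_cc.
rewrite EFinB; apply: continuous_FTC2 => //.
- apply: continuous_in_subspaceT => x /[!inE] /abU; exact: cf.
- split.
  + by move=> x /ooU /dF[].
  + by apply: cvg_at_right_filter; exact: cF.
  + by apply: cvg_at_left_filter; exact: cF.
- by move=> x /ooU /dF[_ <-]; rewrite derive1E.
Qed.

Let derive1_near U F F' x : open U -> (forall x, U x -> is_derive x 1 F (F' x)) ->
  U x -> \forall y \near x, F' y = derive1 F y.
Proof.
move=> oU dF Ux; have := open_nbhs_nbhs (conj oU Ux).
by apply: filterS => y /dF[_ <-]; rewrite derive1E.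
Qed.

Let derive1_cvg U F F' x : open U -> (forall x, U x -> is_derive x 1 F (F' x)) ->
  (forall x, U x -> {for x, continuous F'}) -> U x -> derive1 F y @[y --> x] --> F' x.
Proof.
move=> oU dF cF' Ux; apply: cvg_trans (cF' x Ux).
by apply: near_eq_cvg; exact: derive1_near dF Ux.
Qed.

Lemma integration_by_substitution_open_incr U F F' G a b : open U ->
  (forall x, U x -> is_derive x 1 F (F' x)) ->
  (forall x, U x -> {for x, continuous F'}) -> `[a, b] `<=` U -> a < b ->
  {in `[a, b] &, {homo F : x y / x < y}} ->
  {within `[F a, F b], continuous G} ->
  (\int[lam]_(x in `[F a, F b]) (G x)%:E =
   \int[lam]_(x in `[a, b]) (G (F x) * F' x)%:E)%E.
Proof.
move=> oU dF cF' abU ab incr cG.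
have aU : U a by apply: abU; rewrite /= in_itv/= lexx ltW.
have bU : U b by apply: abU; rewrite /= in_itv/= lexx ltW.
have cF x : U x -> {for x, continuous F}.
  move=> Ux; have := dF x Ux => -[/derivable1_diffP dfx _].
  exact: differentiable_continuous.
have ooU x : x \in `]a, b[ -> U x by move=> xab; apply: abU; apply: subset_itv_oo_cc.
have dE x : U x -> derive1 F x = F' x by move=> /dF[_ <-]; rewrite derive1E.
rewrite integration_by_substitution_increasing ?ltW//.
- by apply: eq_integral => x /[!inE] /abU Ux /=; rewrite -dE.
- by move=> x /ooU Ux; rewrite /continuous_at dE//; exact: derive1_cvg dF cF' Ux.
- apply/cvg_ex; exists (F' a); apply: cvg_at_right_filter.
  exact: derive1_cvg dF cF' aU.
- apply/cvg_ex; exists (F' b); apply: cvg_at_left_filter.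
  exact: derive1_cvg dF cF' bU.
- split.
  + by move=> x /ooU /dF[].
  + by apply: cvg_at_right_filter; exact: cF.
  + by apply: cvg_at_left_filter; exact: cF.
Qed.

Lemma integration_by_substitution_open_decr U F F' G a b : open U ->
  (forall x, U x -> is_derive x 1 F (F' x)) ->
  (forall x, U x -> {for x, continuous F'}) -> `[a, b] `<=` U -> a < b ->
  {in `[a, b] &, {homo F : x y /~ x < y}} ->
  {within `[F b, F a], continuous G} ->
  (\int[lam]_(x in `[F b, F a]) (G x)%:E =
   \int[lam]_(x in `[a, b]) (G (F x) * - F' x)%:E)%E.
Proof.
move=> oU dF cF' abU ab incr cG.
have aU : U a by apply: abU; rewrite /= in_itv/= lexx ltW.
have bU : U b by apply: abU; rewrite /= in_itv/= lexx ltW.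
have cF x : U x -> {for x, continuous F}.
  move=> Ux; have := dF x Ux => -[/derivable1_diffP dfx _].
  exact: differentiable_continuous.
have ooU x : x \in `]a, b[ -> U x by move=> xab; apply: abU; apply: subset_itv_oo_cc.
have dE x : U x -> derive1 F x = F' x by move=> /dF[_ <-]; rewrite derive1E.
rewrite integration_by_substitution_decreasing ?ltW//.
- by apply: eq_integral => x /[!inE] /abU Ux /=; rewrite -dE.
- by move=> x /ooU Ux; rewrite /continuous_at dE//; exact: derive1_cvg dF cF' Ux.
- apply/cvg_ex; exists (F' a); apply: cvg_at_right_filter.
  exact: derive1_cvg dF cF' aU.
- apply/cvg_ex; exists (F' b); apply: cvg_at_left_filter.
  exact: derive1_cvg dF cF' bU.
- split.
  + by move=> x /ooU /dF[].
  + by apply: cvg_at_right_filter; exact: cF.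
  + by apply: cvg_at_left_filter; exact: cF.
Qed.

(** Exhausting the interval away from 0 admits integrands singular there; [n.+2] keeps the left
    endpoint strictly below 1. *)
Lemma cvg_integral_itv01 f : measurable_fun setT f -> (forall t, 0 <= f t) ->
  (\int[lam]_(t in `[(n.+2%:R^-1)%R, 1%R]) (f t)%:E)%E @[n --> \oo] -->
  (\int[lam]_(t in `]0%R, 1%R[) (f t)%:E)%E.
Proof.
move=> mf f0.
have -> : (\int[lam]_(t in `]0%R, 1%R[) (f t)%:E =
           \int[lam]_(t in \bigcup_n `[(n.+2%:R^-1)%R, 1%R]%classic) (f t)%:E)%E.
  have -> : \bigcup_n `[(n.+2%:R^-1)%R, 1%R]%classic = `]0%R, 1%R]%classic :> set R.
    apply/seteqP; split => t /=.
      move=> [n _ /=]; rewrite !in_itv/= => /andP[nt ->]; rewrite andbT.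
      by apply: lt_le_trans nt; rewrite invr_gt0.
    rewrite in_itv/= => /andP[t0 t1]; exists (Num.truncn t^-1) => //=.
    rewrite in_itv/= t1 andbT invf_ple ?posrE//.
    have := truncnS_gt t^-1 => /ltW /le_trans; apply.
    by rewrite ler_nat.
  by rewrite integral_itv_bndo_bndc//; apply/measurable_funTS/measurable_EFinP.
apply: ge0_nondecreasing_set_cvg_integral.
- apply/nondecreasing_seqP => n; apply/subsetPset => t /=.
  rewrite !in_itv/= => /andP[nt ->]; rewrite andbT (le_trans _ nt)//.
  by rewrite lef_pV2 ?posrE// ler_nat.
- by move=> n; exact: measurable_itv.
- by move=> n; apply: measurable_funTS; exact/measurable_EFinP.
- by move=> n t _; rewrite lee_fin.
Qed.

End integration_tools.

(** * Erlang tails *)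

Section erlang.
Context {R : realType}.
Implicit Types (c t x : R) (n : nat).
Local Notation lam := (@lebesgue_measure R).

Lemma poisson_p_le1 x n : 0 <= x -> poisson_p x n <= 1.
Proof.
move=> x0; rewrite -lee_fin -[X in (_ <= X)%E](nneseries_poisson_p x0).
rewrite (@nneseriesD1 _ _ n)//; last by move=> *; rewrite lee_fin poisson_p_ge0.
by rewrite leeDl// nneseries_ge0// => *; rewrite lee_fin poisson_p_ge0.
Qed.

Lemma continuous_poisson_p n : continuous (fun x : R => poisson_p x n).
Proof.
move=> x; apply: cvgM.
  by apply: cvgM; [exact: exprn_continuous|exact: cvg_cst].
by apply: continuous_comp; [exact: continuousN|exact: continuous_expR].
Qed.

Lemma is_derive_poisson_p x n : is_derive x 1 (fun x => poisson_p x n)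
  ((if n is m.+1 then poisson_p x m else 0) - poisson_p x n).
Proof.
have dexp : is_derive x 1 (fun x : R => expR (- x)) (- expR (- x)).
  by apply: is_derive_eq; rewrite /GRing.scale/= mulrN1.
case: n => [|n].
  have -> : (fun x : R => poisson_p x 0) = (fun x => expR (- x)).
    by apply/funext => y; rewrite poisson_p0.
  by rewrite poisson_p0 sub0r.
have dX : is_derive x 1 (fun y : R => y ^+ n.+1) (n.+1%:R * x ^+ n).
  rewrite (_ : (fun y : R => y ^+ n.+1) = (@id R) ^+ n.+1); last first.
    by apply/funext => y; rewrite fctE.
  by apply: is_derive_eq; rewrite /GRing.scale/= mulr1 mulr_natl.
have -> : (fun y : R => poisson_p y n.+1) =
    (n.+1`!%:R^-1 : R) \*: ((fun y : R => y ^+ n.+1) * (fun y : R => expR (- y))).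
  by apply/funext => y; rewrite /poisson_p mulrAC mulrC.
have dM := is_deriveM dX dexp.
apply: (is_derive_eq (is_deriveZ (n.+1`!%:R^-1 : R) dM)); rewrite /GRing.scale/=.
rewrite /poisson_p /= factS natrM exprS.
have n0 : n.+1%:R != 0 :> R by rewrite pnatr_eq0.
have f0 : n`!%:R != 0 :> R by rewrite pnatr_eq0 -lt0n fact_gt0.
by field; rewrite f0 nat1r n0.
Qed.

(** Probability that a Gamma variable of shape [n.+1] exceeds [x], that is, that a Poisson variable
    of mean [x] is at most [n]. *)
Definition erlang_tail n x : R := \sum_(i < n.+1) poisson_p x i.

(** The derivatives [p_(i-1) - p_i] of the Poisson weights telescope. *)
Lemma is_derive_erlang_tail c n x :
  is_derive x 1 (fun x => - erlang_tail n (c * x)) (c * poisson_p (c * x) n).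
Proof.
suff : is_derive (c * x) 1 (erlang_tail n) (- poisson_p (c * x) n).
  move=> H.
  have -> : (fun x => - erlang_tail n (c * x)) = (- (erlang_tail n \o *%R c)).
    by [].
  have dc : is_derive x 1 ( *%R c) c.
    by apply: is_derive_eq; rewrite /GRing.scale/= mulr1.
  by apply: is_derive_eq; rewrite /GRing.scale/=; ring.
elim: n => [|n IH].
  rewrite (_ : erlang_tail 0 = fun x => poisson_p x 0); last first.
    by apply/funext => y; rewrite /erlang_tail big_ord_recl big_ord0 addr0.
  by have := is_derive_poisson_p (c * x) 0; rewrite sub0r.
rewrite (_ : erlang_tail n.+1 = erlang_tail n + (fun x => poisson_p x n.+1)); last first.
  by apply/funext => y; rewrite /erlang_tail big_ord_recr.
have := is_derive_poisson_p (c * x) n.+1 => ?.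
by apply: is_derive_eq; ring.
Qed.

Lemma erlang_tail0 n : erlang_tail n 0 = 1.
Proof.
rewrite /erlang_tail big_ord_recl poisson_p0 oppr0 expR0 big1 ?addr0// => i _.
by rewrite /poisson_p exprS !mul0r.
Qed.

Let continuous_erlang c n : continuous (fun x => c * poisson_p (c * x) n).
Proof.
move=> x; apply: cvgM; first exact: cvg_cst.
apply: (@continuous_comp _ _ _ ( *%R c) (fun x => poisson_p x n)).
  exact: mulrl_continuous.
exact: continuous_poisson_p.
Qed.

Lemma integral_erlang c n x : 0 < x ->
  (\int[lam]_(v in `[0%R, x]) (c * poisson_p (c * v) n)%:E =
   (1 - erlang_tail n (c * x))%:E)%E.
Proof.
move=> x0.
have -> : 1 - erlang_tail n (c * x) = - erlang_tail n (c * x) - - erlang_tail n (c * 0).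
  by rewrite mulr0 erlang_tail0 opprK addrC.
apply: (@FTC2_open _ setT (fun v => c * poisson_p (c * v) n)
  (fun x => - erlang_tail n (c * x))) => //.
- exact: openT.
- by move=> y _; exact: is_derive_erlang_tail.
- by move=> y _; exact: continuous_erlang.
Qed.

(** From [x p_n(x) = (n+1) p_(n+1)(x) <= n+1] the weight is at most [(n+1) / x]. *)
Let cvg_poisson_p_pinfty n : poisson_p x n @[x --> +oo] --> (0 : R).
Proof.
apply: (@squeeze_cvgr _ _ _ _ (fun=> 0) (fun x => n.+1%:R * x^-1)).
- near=> x; have x0 : 0 < x by near: x; exact: nbhs_pinfty_gt.
  rewrite poisson_p_ge0 ?(ltW x0)//= ler_pdivlMr// mulrC -poisson_pS ler_piMr//.
  by rewrite poisson_p_le1// ltW.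
- exact: cvg_cst.
- rewrite -[X in _ --> X](mulr0 n.+1%:R); apply: cvgM; first exact: cvg_cst.
  apply/(@gtr0_cvgV0 _ _ _ _ id); last exact: cvg_id.
  exact: nbhs_pinfty_gt.
Unshelve. all: by end_near. Qed.

Lemma integral_erlang_tail c n t : 0 < c -> 0 <= t ->
  (\int[lam]_(v in `[t, +oo[) (c * poisson_p (c * v) n)%:E =
   (erlang_tail n (c * t))%:E)%E.
Proof.
move=> c0 t0.
rewrite (@ge0_continuous_FTC2y _ _ (fun x => - erlang_tail n (c * x)) _ 0)//.
- by rewrite sub0e EFinN oppeK.
- by move=> x tx; have c0' := ltW c0; rewrite mulr_ge0// poisson_p_ge0// mulr_ge0// (le_trans t0).
- by apply: continuous_subspaceT => x; exact: continuous_erlang.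
- rewrite -oppr0; apply: cvgN.
  have -> : 0 = \sum_(i < n.+1) 0 :> R by rewrite big1.
  apply: cvgr_sum => i.
  apply: (@cvg_comp _ _ _ ( *%R c) (fun x => poisson_p x i) _ (pinfty_nbhs R)).
    exact: gt0_cvgMry.
  exact: cvg_poisson_p_pinfty.
- by move=> x _; have [] := is_derive_erlang_tail c n x.
- apply: cvg_at_right_filter.
  have [/derivable1_diffP/differentiable_continuous ? _] := is_derive_erlang_tail c n t.
  by [].
- by move=> x _; rewrite derive1E; have [_ ->] := is_derive_erlang_tail c n x.
Qed.

End erlang.

Section density.
Context {R : realType} {d} {T : measurableType d}.
Context (lam m : {measure set T -> \bar R}) (p : T -> R).
Hypothesis p0 : forall x, 0 <= p x.
Hypothesis mp : measurable_fun setT p.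
Hypothesis mE : forall A, measurable A -> m A = (\int[lam]_(x in A) (p x)%:E)%E.

(** The assumption on sets gives the identity on dyadic atoms, hence for step functions, and both
    sides pass to the limit by monotone convergence. *)
Lemma ge0_integral_density (g : T -> R) : measurable_fun setT g ->
  (forall x, 0 <= g x) ->
  (\int[m]_x (g x)%:E = \int[lam]_x (g x * p x)%:E)%E.
Proof.
move=> mg g0.
have md n : measurable_fun setT (dya g n) by exact: (measurable_dya g0 mg n (phi := id)).
have c0 n i : 0 <= i.+1%:R / 2 ^+ n :> R by rewrite divr_ge0// exprn_ge0.
have mi n i : measurable_fun setT (\1_(dyatom g n i) : T -> R).
  by apply: measurable_indic; exact: measurable_dyatom.
have stepE n : (\int[m]_x (dya g n x)%:E = \int[lam]_x (dya g n x * p x)%:E)%E.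
  transitivity (\sum_(i < n * 2 ^ n) (i.+1%:R / 2 ^+ n)%:E * m (dyatom g n i))%E.
    under eq_integral do rewrite (dya_sum g0 n _ (phi := id))// -sumEFin.
    rewrite ge0_integral_sum//; last first.
      by move=> i; apply/measurable_EFinP; exact: measurable_funM.
    apply: eq_bigr => i _; under eq_integral do rewrite EFinM.
    rewrite ge0_integralZl_EFin//; last exact/measurable_EFinP.
    by rewrite integral_indic ?setIT//; exact: measurable_dyatom.
  under [RHS]eq_integral do rewrite (dya_sum g0 n _ (phi := id))// mulr_suml -sumEFin.
  rewrite ge0_integral_sum//; last 2 first.
  - by move=> i; apply/measurable_EFinP; apply: measurable_funM => //; exact: measurable_funM.
  - by move=> i x _; rewrite lee_fin mulr_ge0// mulr_ge0.
  apply: eq_bigr => i _; under [RHS]eq_integral do rewrite -mulrA EFinM.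
  rewrite [RHS]ge0_integralZl_EFin//; last 2 first.
  - by move=> x _; rewrite lee_fin mulr_ge0.
  - by apply/measurable_EFinP; exact: measurable_funM.
  congr (_ * _)%E; rewrite mE; last exact: measurable_dyatom.
  rewrite integral_mkcond; apply: eq_integral => x _.
  by rewrite patchE indicE; case: ifP => _; rewrite ?mul1r ?mul0r.
have c1 : (\int[m]_x (dya g n x)%:E)%E @[n --> \oo] --> (\int[m]_x (g x)%:E)%E.
  have -> : (\int[m]_x (g x)%:E = \int[m]_x limn (fun n => (dya g n x)%:E))%E.
    apply: eq_integral => x _; apply/esym/cvg_lim => //; apply: cvg_EFin.
      by near=> n.
    exact: cvg_dya.
  apply: cvg_monotone_convergence => //.
  - by move=> n; exact/measurable_EFinP.
  - by move=> n x _; rewrite lee_fin dya_ge0.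
  - by move=> x _ a b ab; rewrite lee_fin dya_nd.
apply: (cvg_unique _ c1) => //.
have -> : (fun n => \int[m]_x (dya g n x)%:E)%E =
    (fun n => \int[lam]_x (dya g n x * p x)%:E)%E by apply/funext.
have -> : (\int[lam]_x (g x * p x)%:E =
           \int[lam]_x limn (fun n => (dya g n x * p x)%:E))%E.
  apply: eq_integral => x _; apply/esym/cvg_lim => //; apply: cvg_EFin.
    by near=> n.
  by apply: cvgM; [exact: cvg_dya|exact: cvg_cst].
apply: cvg_monotone_convergence => //.
- by move=> n; apply/measurable_EFinP; exact: measurable_funM.
- by move=> n x _; rewrite lee_fin mulr_ge0// dya_ge0.
- by move=> x _ a b ab; rewrite lee_fin ler_wpM2r// dya_nd.
Unshelve. all: by end_near. Qed.

End density.

(** * Averages over exponential fading *)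

Section exponential_marks.
Context {R : realType}.
Implicit Types (a : R) (n : nat).
Local Notation lam := (@lebesgue_measure R).

Definition exp1 : probability (measurableTypeR R) R :=
  exponential_distribution_exponential_prob__canonical__probability_measure_Probability
    (@ltr01 R).

Lemma integral_exp1 (g : R -> R) : measurable_fun setT g -> (forall x, 0 <= g x) ->
  (\int[exp1]_x (g x)%:E = \int[lam]_(x in `[0%R, +oo[) (g x * expR (- x))%:E)%E.
Proof.
move=> mg g0; rewrite (@ge0_integral_density _ _ _ lam _ (exponential_pdf 1))//.
- rewrite [RHS]integral_mkcond; apply: eq_integral => x _.
  rewrite /exponential_pdf !patchE; case: ifP => _; last by rewrite mulr0.
  by rewrite mul1r mulN1r.
- by move=> x; exact: exponential_pdf_ge0.
- exact: measurable_exponential_pdf.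
Qed.

(** A Poisson count whose mean is [a] times an Exp(1) variable is geometric: this is its mass at
    [n], and [mark0] is the mass of the nonzero values. *)
Definition markn n a : R := a ^+ n / (1 + a) ^+ n.+1.
Definition mark0 a : R := a / (1 + a).

Lemma integral_exp1_poisson_p a n : 0 <= a ->
  (\int[exp1]_v (poisson_p (a * Num.max v 0) n)%:E = (markn n a)%:E)%E.
Proof.
move=> a0; have a1 : 0 < 1 + a by rewrite ltr_pwDl.
rewrite integral_exp1; last 2 first.
- apply: (@measurableT_comp _ _ _ _ _ _ (fun x => poisson_p x n)).
    by apply: continuous_measurable_fun; exact: continuous_poisson_p.
  by apply: measurable_funM => //; exact: measurable_maxr.
- by move=> v; rewrite poisson_p_ge0// mulr_ge0// le_max lexx orbT.
(* The exponentials of [a * v] and of the mark density merge into an Erlang density of rate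
   [1 + a]. *)
transitivity (\int[lam]_(v in `[0%R, +oo[)
    ((markn n a)%:E * ((1 + a) * poisson_p ((1 + a) * v) n)%:E))%E.
  apply: eq_integral => v; rewrite inE/= in_itv/= andbT => v0; rewrite -EFinM.
  have expE : expR (- ((1 + a) * v)) = expR (- (a * v)) * expR (- v).
    by rewrite -expRD; congr expR; ring.
  congr (_%:E); rewrite max_l// /markn /poisson_p expE.
  rewrite !exprMn exprS; move: (expR _) (expR _) => x y.
  have a1n : (1 + a) ^+ n != 0 by rewrite expf_neq0// gt_eqF.
  have f0 : n`!%:R != 0 :> R by rewrite pnatr_eq0 -lt0n fact_gt0.
  by field; rewrite ?f0 ?a1n ?(gt_eqF a1).
rewrite ge0_integralZl_EFin//.
- by rewrite integral_erlang_tail// mulr0 erlang_tail0 mule1.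
- move=> v; rewrite /= in_itv/= andbT => v0.
  by rewrite lee_fin mulr_ge0 ?(ltW a1)// poisson_p_ge0// mulr_ge0 ?(ltW a1).
- apply/measurable_EFinP/measurable_funTS; apply: measurable_funM => //.
  apply: (@measurableT_comp _ _ _ _ _ _ (fun x => poisson_p x n)).
    by apply: continuous_measurable_fun; exact: continuous_poisson_p.
  exact: measurable_funM.
- by rewrite /markn divr_ge0// exprn_ge0// ltW.
Qed.

Lemma integral_exp1_1expRN a : 0 <= a ->
  (\int[exp1]_v (1 - expR (- (a * Num.max v 0)))%:E = (mark0 a)%:E)%E.
Proof.
move=> a0; have a1 : 0 < 1 + a by rewrite ltr_pwDl.
have mmax : measurable_fun setT (fun v : R => expR (- (a * Num.max v 0))).
  apply: measurableT_comp => //; apply: measurableT_comp => //.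
  by apply: measurable_funM => //; exact: measurable_maxr.
have le1 v : expR (- (a * Num.max v 0)) <= 1.
  by rewrite -expR0 ler_expR oppr_le0 mulr_ge0// le_max lexx orbT.
have : (\int[exp1]_v (1 - expR (- (a * Num.max v 0)))%:E +
        \int[exp1]_v (poisson_p (a * Num.max v 0) 0)%:E = 1)%E.
  rewrite -ge0_integralD//.
  - under eq_integral do rewrite poisson_p0 -EFinD subrK.
    by rewrite integral_cst// mul1e; exact: probability_setT.
  - by move=> v _; rewrite lee_fin subr_ge0.
  - by apply/measurable_EFinP; apply: measurable_funB.
  - by move=> v _; rewrite lee_fin poisson_p0 expR_ge0.
  - by apply/measurable_EFinP; under eq_fun do rewrite poisson_p0.
rewrite integral_exp1_poisson_p// => E.
have -> : (mark0 a)%:E = (1%:E - (markn 0 a)%:E)%E.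
  rewrite -EFinB /markn /mark0; congr (_%:E).
  by rewrite expr0 expr1; field; rewrite gt_eqF.
by rewrite -E addeK.
Qed.

Lemma integral_exp1_id a : 0 <= a -> (\int[exp1]_v (a * Num.max v 0)%:E = a%:E)%E.
Proof.
move=> a0.
rewrite integral_exp1; last 2 first.
- by apply: measurable_funM => //; exact: measurable_maxr.
- by move=> v; rewrite mulr_ge0// le_max lexx orbT.
transitivity (\int[lam]_(v in `[0%R, +oo[) (a%:E * (1 * poisson_p (1 * v) 1)%:E))%E.
  apply: eq_integral => v; rewrite inE/= in_itv/= andbT => v0; rewrite -EFinM.
  by rewrite max_l// /poisson_p !mul1r factS fact0 muln1 divr1 expr1 mulrA.
rewrite ge0_integralZl_EFin//.
- by rewrite integral_erlang_tail// mulr0 erlang_tail0 mule1.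
- by move=> v; rewrite /= in_itv/= andbT => v0; rewrite lee_fin !mul1r poisson_p_ge0.
- apply/measurable_EFinP/measurable_funTS; apply: continuous_measurable_fun.
  by under eq_fun do rewrite !mul1r; exact: continuous_poisson_p.
Qed.

End exponential_marks.

(** * Polar coordinates *)

Section polar.
Context {R : realType}.
Local Notation lam := (@lebesgue_measure R).
Local Notation lam2 := (lam \x lam)%E.

Definition normsq (y : R * R) : R := y.1 ^+ 2 + y.2 ^+ 2.

Lemma measurable_normsq : measurable_fun setT normsq.
Proof. by apply: measurable_funD; apply: measurable_funX. Qed.

Lemma normsq_ge0 y : 0 <= normsq y.
Proof. by rewrite addr_ge0 ?sqr_ge0. Qed.

Lemma dist0E y : dist0 y = Num.sqrt (normsq y).
Proof. by []. Qed.

(** Substitution [x = s sin u]; the resulting integrand [2 s^2 cos^2 u] has primitive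
    [s^2 (u + sin u cos u)]. *)
Lemma integral_half_circle (s : R) : 0 < s ->
  (\int[lam]_(x in `[(- s)%R, s]) (2 * Num.sqrt (s ^+ 2 - x ^+ 2))%:E = (pi * s ^+ 2)%:E)%E.
Proof.
move=> s0; have pi2 : - (pi / 2) < pi / 2 :> R by rewrite gtrN// divr_gt0// pi_gt0.
have dF (x : R) : is_derive x 1 (fun x : R => s * sin x) (s * cos x).
  by have := is_deriveZ s (is_derive_sin x).
have cF' (x : R) : {for x, continuous (fun x : R => s * cos x)}.
  by apply: cvgM; [exact: cvg_cst|exact: continuous_cos].
have FE : (fun x : R => s * sin x) (- (pi / 2)) = - s /\ (fun x : R => s * sin x) (pi / 2) = s.
  by rewrite sinN sin_pihalf mulrN mulr1.
have := @integration_by_substitution_open_incr R setT (fun x => s * sin x)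
  (fun x => s * cos x) (fun x => 2 * Num.sqrt (s ^+ 2 - x ^+ 2)) (- (pi / 2)) (pi / 2)
  openT (fun x _ => dF x) (fun x _ => cF' x) (fun _ _ => I) pi2.
rewrite /= FE.1 FE.2 => -> //; last 2 first.
- by move=> x y xI yI xy; rewrite ltr_pM2l// ltr_sin.
- apply: continuous_subspaceT => x; apply: cvgM; first exact: cvg_cst.
  apply: (@continuous_comp _ _ _ (fun x : R => s ^+ 2 - x ^+ 2) (@Num.sqrt R)).
    by apply: cvgB; [exact: cvg_cst|exact: exprn_continuous].
  exact: sqrt_continuous.
transitivity (\int[lam]_(x in `[(- (pi / 2))%R, (pi / 2)%R]) (2 * s ^+ 2 * cos x ^+ 2)%:E)%E.
  apply: eq_integral => x; rewrite inE/= in_itv/= => xI; congr (_%:E).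
  have c0 : 0 <= cos x by apply: cos_ge0_pihalf.
  have -> : s ^+ 2 - (s * sin x) ^+ 2 = (s * cos x) ^+ 2.
    by rewrite !exprMn cos2sin2; ring.
  by rewrite sqrtr_sqr ger0_norm ?mulr_ge0 ?(ltW s0)//; ring.
have dS (x : R) : is_derive x 1 (fun x : R => s ^+ 2 * (x + sin x * cos x))
    (2 * s ^+ 2 * cos x ^+ 2).
  have dsc : is_derive x 1 ((@sin R) * (@cos R)) (cos x ^+ 2 - sin x ^+ 2).
    by apply: is_derive_eq; rewrite /GRing.scale/=; ring.
  have H := is_deriveZ (s ^+ 2) (is_deriveD (is_derive_id x 1) dsc).
  by apply: (is_derive_eq H); rewrite /GRing.scale/= sin2cos2; ring.
have cS (x : R) : {for x, continuous (fun x : R => 2 * s ^+ 2 * cos x ^+ 2)}.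
  apply: cvgM; first exact: cvg_cst.
  by apply: cvgM; exact: continuous_cos.
rewrite (FTC2_open openT (fun x _ => dS x) (fun x _ => cS x) (fun _ _ => I) pi2).
by rewrite sinN cosN sin_pihalf cos_pihalf !mulr0; congr (_%:E); field.
Qed.

(** Cavalieri: nonempty sections are intervals of length [2 sqrt (r - x^2)]. The parameter is the
    squared radius, in which the area is linear. *)
Lemma disk_area (r : R) : 0 <= r ->
  lam2 [set y | normsq y <= r] = (pi * r)%:E.
Proof.
move=> r0.
have secE x : lam (xsection [set y : R * R | normsq y <= r] x) =
    (2 * Num.sqrt (r - x ^+ 2))%:E.
  have [xr|xr] := leP (x ^+ 2) r.
    have -> : xsection [set y : R * R | normsq y <= r] x =
        `[- Num.sqrt (r - x ^+ 2), Num.sqrt (r - x ^+ 2)]%classic.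
      apply/seteqP; split => y; rewrite /xsection/= inE/= /normsq/= in_itv/= -ler_norml.
        by move=> h; rewrite -(sqrtr_sqr y) ler_wsqrtr// lerBrDl.
      move=> h; rewrite -lerBrDl -(@ler_sqrt _ (y ^+ 2)) ?subr_ge0//.
      by rewrite sqrtr_sqr.
    rewrite lebesgue_measure_itv/= lte_fin.
    have s0 := sqrtr_ge0 (r - x ^+ 2).
    case: ltP => h; first by rewrite -EFinB opprK -mulr2n mulr_natl.
    have -> : Num.sqrt (r - x ^+ 2) = 0 by apply/eqP; rewrite eq_le s0 andbT; lra.
    by rewrite mulr0.
  have -> : xsection [set y : R * R | normsq y <= r] x = set0.
    apply/seteqP; split => y //; rewrite /xsection/= inE/= /normsq/= => h.
    by have := sqr_ge0 y; lra.
  by rewrite measure0 ler0_sqrtr ?mulr0// subr_le0 ltW.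
rewrite /product_measure1; under eq_integral do rewrite /= secE.
have [->|rn0] := eqVneq r 0.
  rewrite integral0_eq ?mulr0// => x _; rewrite ler0_sqrtr ?mulr0//.
  by rewrite sub0r oppr_le0 sqr_ge0.
have rp : 0 < r by rewrite lt_neqAle eq_sym rn0.
have sp : 0 < Num.sqrt r by rewrite sqrtr_gt0.
have := integral_half_circle sp; rewrite sqr_sqrtr// => <-.
rewrite [RHS]integral_mkcond; apply: eq_integral => x _; rewrite patchE.
case: ifPn => //; rewrite notin_setE/= in_itv/= -ler_norml => /negP; rewrite -ltNge => h.
rewrite ler0_sqrtr ?mulr0// subr_le0 -(@ler_sqrt _ r) ?sqr_ge0//.
by rewrite sqrtr_sqr ltW.
Qed.

Let lam2m : {measure set (measurableTypeR R * measurableTypeR R) -> \bar R} := lam2.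

(** Image of the area measure under the squared norm. Linearity of the disk area makes it [pi] times
    Lebesgue measure on the positive half-line. *)
Let pf : {measure set (measurableTypeR R) -> \bar R} :=
  measure_function_pushforward__canonical__measure_function_Measure
    lam2m (measurable_normsq : measurable_fun setT
      (normsq : measurableTypeR R * measurableTypeR R -> measurableTypeR R)).

Let measurable_disk r : measurable [set y : R * R | normsq y <= r].
Proof.
have := measurable_normsq measurableT (measurable_itv `]-oo, r]).
by rewrite setTI; congr (measurable _); apply/seteqP; split => y /=; rewrite in_itv.
Qed.

Let pi_inv_ge0 : 0 <= pi^-1 :> R. Proof. by rewrite invr_ge0 pi_ge0. Qed.

(* On the negative half-line the image of the area measure vanishes, so that
   Lebesgue measure is added there to meet the uniqueness theorem. *)
Let mglue : {measure set (measurableTypeR R) -> \bar R} :=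
  measure_add (mscale (NngNum pi_inv_ge0) pf)
    (mrestr lam (measurable_itv `]-oo, 0%R] : measurable (_ : set (measurableTypeR R)))).

Let pf_itv (a b : R) : a <= b ->
  pf `]a, b]%classic = (pi * (Num.max b 0 - Num.max a 0))%:E.
Proof.
have disk r : lam2 [set y : R * R | normsq y <= r] = (pi * Num.max r 0)%:E.
  have [r0|r0] := leP 0 r; first exact: disk_area.
  rewrite mulr0; have -> : [set y : R * R | normsq y <= r] = set0; last exact: measure0.
  apply/seteqP; split => y //= yr; have := normsq_ge0 y.
  by rewrite leNgt (le_lt_trans yr).
move=> ab; rewrite /= /pushforward.
have -> : normsq @^-1` `]a, b]%classic =
    [set y : R * R | normsq y <= b] `\` [set y | normsq y <= a].
  apply/seteqP; split => y /=; rewrite in_itv/=.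
    by move=> /andP[ay yb]; split => //; apply/negP; rewrite -ltNge.
  by move=> [yb /negP]; rewrite -ltNge => ->.
rewrite (measureD (mu := lam2m)); last 3 first.
- exact: measurable_disk.
- exact: measurable_disk.
- by rewrite /= disk ltry.
have -> : [set y : R * R | normsq y <= b] `&` [set y | normsq y <= a] =
    [set y | normsq y <= a].
  by apply/setIidPr => y /= /le_trans; apply.
by rewrite /= !disk -EFinB mulrBr.
Qed.

Let mglueE (A : set R) :
  mglue A = ((pi^-1)%:E * pf A + lam (A `&` `]-oo, 0%R]))%E.
Proof. exact: measure_addE. Qed.

Let glueE (A : set R) : measurable A -> lam A = mglue A.
Proof.
move=> mA; apply: (lebesgue_measure_unique (mu := mglue)) => // _ [[a b] _ <-].
rewrite mglueE [(a, b).1]/= [(a, b).2]/=.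
have [ba|ab] := leP b a.
  have -> : `]a, b]%classic = set0 :> set R by rewrite set_itv_ge// -leNgt.
  by rewrite set0I !measure0 mule0 adde0.
rewrite pf_itv ?(ltW ab)//.
have -> : `]a, b] `&` `]-oo, 0%R] = `]a, (Num.min b 0)]%classic :> set R.
  apply/seteqP; split => x /=; rewrite !in_itv/= le_min.
    by move=> [/andP[-> ->]].
  by move=> /and3P[-> -> ->].
rewrite !lebesgue_measure_itv/= !lte_fin ab -EFinM.
rewrite mulKf ?gt_eqF ?pi_gt0// lt_min ab/=.
by have [a0|a0] := ltP a 0; have [b0|b0] := leP b 0 => /=;
  rewrite -?EFinD ?adde0; congr (_%:E); lra.
Qed.

(** The radial variable is the squared radius, which absorbs the Jacobian: [pi dx] replaces
    [2 pi r dr]. *)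
Lemma integral_polar (phi : R -> R) : measurable_fun setT phi -> (forall x, 0 <= phi x) ->
  (\int[lam2]_y (phi (normsq y))%:E = pi%:E * \int[lam]_(x in `[0%R, +oo[) (phi x)%:E)%E.
Proof.
move=> mphi phi0.
have -> : (\int[lam]_(x in `[0%R, +oo[) (phi x)%:E =
           \int[mscale (NngNum pi_inv_ge0) pf]_(x in `[0%R, +oo[) (phi x)%:E)%E.
  apply: eq_measure_integral => A mA A0; transitivity (mglue A); first exact: glueE.
  rewrite mglueE.
  (* Only the point 0 is shared by the domain and the glued half-line. *)
  suff -> : lam (A `&` `]-oo, 0%R]) = 0%E by rewrite adde0.
  apply/eqP; rewrite eq_le measure_ge0 andbT.
  apply: (@le_trans _ _ (lam [set 0])); last by rewrite lebesgue_measure_set1.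
  apply: le_measure; rewrite ?inE//; first exact: measurableI.
  move=> x [/A0]; rewrite /= !in_itv/= andbT => x0 x1.
  by apply/eqP; rewrite eq_le x0 x1.
rewrite ge0_integral_mscale//; last 2 first.
- by apply: measurable_funTS; exact/measurable_EFinP.
- by move=> x _; rewrite lee_fin.
rewrite /= muleA -EFinM divff ?gt_eqF ?pi_gt0// mul1e.
have mn : measurable_fun setT
    (normsq : measurableTypeR R * measurableTypeR R -> measurableTypeR R).
  exact: measurable_normsq.
rewrite (ge0_integral_pushforward mn lam2m)//; last 2 first.
- by apply: measurable_funTS; exact/measurable_EFinP.
- by move=> x _; rewrite lee_fin.
have -> : normsq @^-1` `[0%R, +oo[ = setT.
  by apply/seteqP; split => y //= _; rewrite in_itv/= normsq_ge0.
by [].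
Qed.

End polar.

(** * Power substitution *)

Section power_substitution.
Context {R : realType}.
Local Notation lam := (@lebesgue_measure R).

Let oU : open [set x : R | 0 < x].
Proof. exact: open_gt. Qed.

Let itvU (a b : R) : 0 < a -> `[a, b] `<=` [set x | 0 < x].
Proof. by move=> a0 x /=; rewrite in_itv/= => /andP[ax _]; exact: lt_le_trans ax. Qed.

Lemma continuous_powR_pos (e x : R) : 0 < x -> {for x, continuous (fun y : R => powR y e)}.
Proof.
move=> x0; have [/derivable1_diffP/differentiable_continuous + _] := is_derive1_powR e x0.
by [].
Qed.

Let n2_gt0 n : 0 < n.+2%:R^-1 :> R. Proof. by rewrite invr_gt0. Qed.
Let n2_lt1 n : n.+2%:R^-1 < 1 :> R. Proof. by rewrite invf_lt1// ltr1n. Qed.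

Let n2_cvg0 : n.+2%:R^-1 @[n --> \oo] --> (0 : R).
Proof. by have := @cvg_harmonic R; rewrite -(cvg_shiftS (@harmonic R : nat -> R)). Qed.

Lemma integral_powR01 (b : R) : 0 < b ->
  (\int[lam]_(t in `]0%R, 1%R[) (powR t (b - 1))%:E = (b^-1)%:E)%E.
Proof.
move=> b0.
have c1 := @cvg_integral_itv01 R (fun t => powR t (b - 1)) (measurable_powR _)
  (fun t => powR_ge0 t (b - 1)).
apply/esym; apply: (cvg_unique _ _ c1) => //.
have stepE n : (\int[lam]_(t in `[(n.+2%:R^-1)%R, 1%R]) (powR t (b - 1))%:E =
    (b^-1 - b^-1 * powR (n.+2%:R^-1) b)%:E)%E.
  have dF (x : R) : 0 < x -> is_derive x 1 (fun x => b^-1 * powR x b) (powR x (b - 1)).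
    move=> x0; have H := is_deriveZ b^-1 (is_derive1_powR b x0).
    by apply: (is_derive_eq H); rewrite /GRing.scale/= mulKf// gt_eqF.
  rewrite (FTC2_open oU dF (fun x x0 => @continuous_powR_pos (b - 1) x x0)
    (itvU (n2_gt0 n)) (n2_lt1 n)).
  by rewrite powR1 mulr1.
have -> : (fun n => \int[lam]_(t in `[(n.+2%:R^-1)%R, 1%R]) (powR t (b - 1))%:E)%E =
    (fun n => (b^-1 - b^-1 * powR (n.+2%:R^-1) b)%:E) by apply/funext.
apply: cvg_EFin; first by near=> n.
rewrite -[X in _ --> X]subr0 -[X in _ - X](mulr0 b^-1).
apply: cvgB; first exact: cvg_cst.
apply: cvgM; first exact: cvg_cst.
apply: (cvg_at_rightP (fun x : R => powR x b) 0 0).1; first exact: powR_cvg0.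
by split => //; exact: n2_cvg0.
Unshelve. all: by end_near. Qed.

(** Substitution [x = D t^(-dl)], decreasing from infinity to [D] on []0, 1]]. With [x = r^2],
    [D = r0^2] and [dl = 2 / alpha] it reads [t = (r0 / r)^alpha]. *)
Lemma integral_power_subst (h : R -> R) (D dl : R) : 0 < D -> 0 < dl ->
  measurable_fun setT h -> (forall t, 0 <= h t) ->
  (forall t, 0 < t -> {for t, continuous h}) ->
  (\int[lam]_(x in `]D, +oo[) (h (powR (x / D) (- dl^-1)))%:E =
   \int[lam]_(t in `]0%R, 1%R[) (D * dl * h t * powR t (- dl - 1))%:E)%E.
Proof.
move=> D0 dl0 mh h0 ch.
pose F (t : R) := D * powR t (- dl).
pose F' (t : R) := D * (- dl * powR t (- dl - 1)).
pose G (x : R) := h (powR (x / D) (- dl^-1)).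
have dF (t : R) : 0 < t -> is_derive t 1 F (F' t).
  by move=> t0; have H := is_deriveZ D (is_derive1_powR (- dl) t0); apply: (is_derive_eq H).
have cF' (t : R) : 0 < t -> {for t, continuous F'}.
  move=> t0; apply: cvgM; first exact: cvg_cst.
  by apply: cvgM; [exact: cvg_cst|exact: continuous_powR_pos].
have Fdec : {in [set x : R | 0 < x] &, {homo F : x y /~ x < y}}.
  move=> x y; rewrite !inE/= => x0 y0 xy; rewrite /F ltr_pM2l// !powRN ltf_pV2 ?posrE ?powR_gt0//.
  by apply: gt0_ltr_powR => //; rewrite nnegrE ltW.
have GF t : 0 < t -> G (F t) = h t.
  move=> t0; rewrite /G /F mulrAC divff ?gt_eqF// mul1r -powRrM mulrN mulNr opprK.
  by rewrite divff ?gt_eqF// powRr1// ltW.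
have mG : measurable_fun setT G.
  apply: measurableT_comp => //; apply: (measurableT_comp (measurable_powR _)).
  exact: measurable_funM.
have cG (x : R) : 0 < x -> {for x, continuous G}.
  move=> x0; apply: (@continuous_comp R R R (fun x : R => powR (x / D) (- dl^-1)) h).
    apply: (@continuous_comp R R R (fun x : R => x / D) (fun y => powR y (- dl^-1))).
      exact: mulrr_continuous.
    by apply: continuous_powR_pos; rewrite divr_gt0.
  by apply: ch; rewrite powR_gt0// divr_gt0.
have F1 : F 1 = D by rewrite /F powR1 mulr1.
have stepE n : (\int[lam]_(x in `[D, (F n.+2%:R^-1)%R]) (G x)%:E =
    \int[lam]_(t in `[(n.+2%:R^-1)%R, 1%R]) (D * dl * h t * powR t (- dl - 1))%:E)%E.
  rewrite -[X in `[X, _]]F1.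
  rewrite (integration_by_substitution_open_decr oU dF cF' (itvU (n2_gt0 n)) (n2_lt1 n)).
  - apply: eq_integral => t; rewrite inE => /(itvU (n2_gt0 n)) /= t0.
    by rewrite GF// /F'; congr (_%:E); ring.
  - move=> x y /(itvU (n2_gt0 n)) x0 /(itvU (n2_gt0 n)) y0.
    by apply: Fdec; rewrite inE.
  - apply: continuous_in_subspaceT => x; rewrite inE/= F1 in_itv/= => /andP[Dx _].
    by apply: cG; exact: lt_le_trans Dx.
have mk : measurable_fun setT (fun t => D * dl * h t * powR t (- dl - 1)).
  by apply: measurable_funM; [exact: measurable_funM|exact: measurable_powR].
have k0 t : 0 <= D * dl * h t * powR t (- dl - 1).
  by rewrite !mulr_ge0 ?powR_ge0 ?(ltW D0) ?(ltW dl0).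
have c1 := cvg_integral_itv01 mk k0.
apply: (cvg_unique _ _ c1) => //.
have -> : (fun n => \int[lam]_(t in `[(n.+2%:R^-1)%R, 1%R])
      (D * dl * h t * powR t (- dl - 1))%:E)%E =
    (fun n => \int[lam]_(x in `[D, (F n.+2%:R^-1)%R]) (G x)%:E)%E by apply/funext.
have -> : (\int[lam]_(x in `]D, +oo[) (G x)%:E =
    \int[lam]_(x in \bigcup_n `[D, (F n.+2%:R^-1)%R]%classic) (G x)%:E)%E.
  rewrite integral_itv_obnd_cbnd; last by apply/measurable_funTS/measurable_EFinP.
  congr (integral _ _ _); apply/seteqP; split => x /=; rewrite in_itv/= andbT.
    (* [t] is the preimage of [x]; any [n] with [1 / (n+2) < t] gives an interval of the exhaustion
       that contains [x]. *)
    move=> Dx; pose t := powR (x / D) (- dl^-1).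
    have x0 : 0 < x by exact: lt_le_trans Dx.
    have t0 : 0 < t by rewrite powR_gt0// divr_gt0.
    have xF : x = F t.
      rewrite /F /t -powRrM mulrN mulNr opprK mulVf ?gt_eqF// powRr1; last first.
        by rewrite divr_ge0// ltW.
      by rewrite mulrCA divff ?mulr1// gt_eqF.
    exists (Num.truncn t^-1) => //=; rewrite in_itv/= Dx/= xF.
    have : (Num.truncn t^-1).+2%:R^-1 < t.
      rewrite invf_plt ?posrE// (lt_trans (truncnS_gt t^-1))// ltr_nat//.
    by move=> lt_t; apply: ltW; apply: Fdec; rewrite ?inE//=.
  by move=> [n _ /=]; rewrite in_itv/= => /andP[].
apply: ge0_nondecreasing_set_cvg_integral.
- apply/nondecreasing_seqP => n; apply/subsetPset => x /=.
  rewrite !in_itv/= => /andP[-> /= xn]; apply: (le_trans xn); apply: ltW.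
  by apply: Fdec; rewrite ?inE//= ltf_pV2 ?posrE// ltr_nat.
- by move=> n; exact: measurable_itv.
- by move=> n; apply/measurable_funTS/measurable_EFinP.
- by move=> n x _; rewrite lee_fin /G.
Qed.

End power_substitution.

(** * Interference integrals *)

Section marked_integral.
Context {R : realType}.
Local Notation lam := (@lebesgue_measure R).
Local Notation T := (measurableTypeR R * measurableTypeR R * measurableTypeR R)%type.

Let sigma_finite_lam2 : sigma_finite setT (lam \x lam)%E.
Proof. exact: lebesgue_integral_fubini.product_measure_sigma_finite_subproof. Qed.

(* The canonical sigma-finite instance on [\x] only covers subprobabilities. *)
Definition lam2s :
    {sigma_finite_measure set (measurableTypeR R * measurableTypeR R)%type -> \bar R} :=
  HB.pack_for
    {sigma_finite_measure set (measurableTypeR R * measurableTypeR R)%type -> \bar R}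
    (lam \x lam)%E (Measure_isSigmaFinite.Build _ _ _ (lam \x lam)%E sigma_finite_lam2).

Definition marked_measure (mu : R) (mu0 : 0 <= mu) : {measure set T -> \bar R} :=
  mscale (NngNum mu0) (lam2s \x exp1)%E.

(** The positive part of the mark and the exclusion disk are built into the function, so that sums
    run over all points and, for [kp >= 0], every term is nonnegative. *)
Definition path_gain (kp dd al : R) (z : T) : R :=
  kp * Num.max z.2 0 * powR (dist0 z.1) (- al) * \1_[set z | dd < dist0 z.1] z.

Lemma measurable_dist0 : measurable_fun setT (fun z : T => dist0 z.1).
Proof.
apply: (@measurableT_comp _ _ _ _ _ _ (@Num.sqrt R)).
  by apply: continuous_measurable_fun; exact: sqrt_continuous.
exact: (measurableT_comp measurable_normsq).
Qed.

Lemma path_gain_ge0 kp dd al z : 0 <= kp -> 0 <= path_gain kp dd al z.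
Proof.
by move=> kp0; rewrite /path_gain !mulr_ge0 ?powR_ge0// le_max lexx orbT.
Qed.

Lemma measurable_path_gain kp dd al : measurable_fun setT (path_gain kp dd al).
Proof.
apply: measurable_funM; last first.
  apply: measurable_indic; apply: measurable_ltr_set => //; exact: measurable_dist0.
apply: measurable_funM.
  by apply: measurable_funM => //; exact: measurable_maxr.
exact: (measurableT_comp (measurable_powR _) measurable_dist0).
Qed.

Lemma continuous_max0 : continuous (fun x : R => Num.max x 0).
Proof.
move=> x; rewrite (_ : (fun x => Num.max x 0) = (fun x : R => (x + `|x|) / 2)).
  apply: cvgM; last exact: cvg_cst.
  by apply: cvgD; [exact: cvg_id|exact: norm_continuous].
by apply/funext => y; rewrite maxr_absE subr0 addr0.
Qed.

(** The mark is integrated out first, which turns [phi] into [h]; the rest depends on the location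
    through its norm only. The condition [phi 0 = 0] discards the excluded disk, where the gain
    vanishes. *)
Lemma integral_path_gain (mu kp dd al : R) (mu0 : 0 <= mu) (phi h : R -> R) :
  0 <= kp -> 0 < dd -> 0 < al ->
  measurable_fun setT phi -> (forall x, 0 <= x -> 0 <= phi x) -> phi 0 = 0 ->
  (forall a, 0 <= a -> (\int[exp1]_v (phi (a * Num.max v 0)%R)%:E = (h a)%:E)%E) ->
  (forall a, 0 <= a -> {for a, continuous h}) ->
  (\int[marked_measure mu0]_z (phi (path_gain kp dd al z))%:E =
   (mu * pi)%:E * \int[lam]_(t in `]0%R, 1%R[) (dd ^+ 2 * (2 / al) *
     h (kp * powR dd (- al) * t)%R * powR t (- (2 / al) - 1))%:E)%E.
Proof.
move=> kp0 dd0 al0 mphi phi0 phi00 hE ch.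
have h_ge0 a : 0 <= a -> 0 <= h a.
  move=> a0; rewrite -lee_fin -hE//; apply: integral_ge0 => v _.
  by rewrite lee_fin phi0// mulr_ge0// le_max lexx orbT.
have h00 : h 0 = 0.
  have := hE 0 (lexx _); under eq_integral do rewrite mul0r phi00.
  by rewrite integral0 => -[].
(* [h] is controlled at nonnegative arguments only; precomposition with the positive part makes it
   continuous on the whole line. *)
pose hp (a : R) := h (Num.max a 0).
have chp : continuous hp.
  move=> a; apply: (@continuous_comp R R R (fun x => Num.max x 0) h).
    exact: continuous_max0.
  by apply: ch; rewrite le_max lexx orbT.
have mhp : measurable_fun setT hp by exact: continuous_measurable_fun.
have hp0 a : 0 <= hp a by rewrite h_ge0// le_max lexx orbT.
have hpE a : 0 <= a -> hp a = h a by move=> a0; rewrite /hp max_l.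
pose D := dd ^+ 2; have D0 : 0 < D by rewrite exprn_gt0.
pose psi (x : R) := hp (kp * powR x (- (al / 2)) * \1_(`]D, +oo[) x).
have mpsi : measurable_fun setT psi.
  apply: measurableT_comp => //; apply: measurable_funM.
    by apply: measurable_funM => //; exact: measurable_powR.
  by apply: measurable_indic; exact: measurable_itv.
have psi0 x : 0 <= psi x by exact: hp0.
have gainE y v : path_gain kp dd al (y, v) =
    kp * powR (normsq y) (- (al / 2)) * \1_(`]D, +oo[) (normsq y) * Num.max v 0.
  rewrite /path_gain !indicE /=.
  have -> : ((y, v) \in [set z : T | dd < dist0 z.1]) = (normsq y \in `]D, +oo[%classic).
    apply/idP/idP; rewrite !inE/= in_itv/= andbT dist0E => h1.
      by rewrite -(sqr_sqrtr (normsq_ge0 y)) ltr_pXn2r ?nnegrE ?sqrtr_ge0 ?(ltW dd0).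
    have {1}-> : dd = Num.sqrt D by rewrite sqrtr_sqr ger0_norm// ltW.
    by rewrite ltr_sqrt// (lt_trans D0).
  have -> : powR (dist0 y) (- al) = powR (normsq y) (- (al / 2)).
    rewrite dist0E -powR12_sqrt ?normsq_ge0// -powRrM; congr (powR _ _).
    by rewrite mulrN mulrC.
  by rewrite -!mulrA; congr (_ * _); rewrite mulrCA; congr (_ * _); rewrite mulrC.
have a0 y : 0 <= kp * powR (normsq y) (- (al / 2)) * \1_(`]D, +oo[) (normsq y).
  by rewrite !mulr_ge0 ?powR_ge0.
rewrite ge0_integral_mscale//; last 2 first.
- by apply/measurable_EFinP; apply: measurableT_comp => //; exact: measurable_path_gain.
- by move=> z _; rewrite lee_fin phi0// path_gain_ge0.
rewrite (@fubini_tonelli1 _ _ _ _ _ lam2s exp1); last 2 first.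
- by apply/measurable_EFinP; apply: measurableT_comp => //; exact: measurable_path_gain.
- by move=> z; rewrite lee_fin phi0// path_gain_ge0.
transitivity (mu%:E * \int[(lam \x lam)%E]_y (psi (normsq y))%:E)%E.
  congr (_ * _)%E; apply: eq_integral => y _; rewrite /fubini_F.
  under eq_integral do rewrite gainE.
  by rewrite hE// /psi hpE.
rewrite integral_polar// muleA -EFinM; congr (_ * _)%E.
pose H (t : R) := hp (kp * powR dd (- al) * t).
have cH : continuous H.
  move=> t; apply: (@continuous_comp R R R ( *%R (kp * powR dd (- al))) hp).
    exact: mulrl_continuous.
  exact: chp.
have C0 : 0 <= kp * powR dd (- al) by rewrite mulr_ge0// powR_ge0.
have dl0 : 0 < 2 / al by rewrite divr_gt0.
transitivity (\int[lam]_(x in `]D, +oo[) (H (powR (x / D) (- (2 / al)^-1)))%:E)%E.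
  rewrite integral_mkcond [RHS]integral_mkcond; apply: eq_integral => x _.
  rewrite !patchE; case: ifPn; rewrite ?inE ?notin_setE/= in_itv/= andbT => x0; last first.
    rewrite ifF//; apply/negbTE; rewrite notin_setE/= in_itv/= andbT => Dx.
    by apply: x0; rewrite ltW// (lt_trans D0).
  case: ifPn; rewrite ?inE ?notin_setE/= in_itv/= andbT => Dx; last first.
    congr (_%:E); rewrite /psi indicE memNset ?mulr0 ?hpE//.
    by rewrite /= in_itv/= andbT.
  congr (_%:E); rewrite /psi indicE mem_set ?mulr1; last by rewrite /= in_itv/= Dx.
  rewrite /H; congr hp; rewrite -mulrA; congr (_ * _); rewrite invf_div.
  have x1 : 0 < x by rewrite (lt_trans D0).
  rewrite powRM ?invr_ge0 ?(ltW D0)//.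
  have -> : powR D^-1 (- (al / 2)) = powR dd al.
    rewrite -powR_inv1 ?(ltW D0)//.
    by rewrite -powRrM mulN1r opprK /D -powR_mulrn ?(ltW dd0)// -powRrM mulrC divfK.
  by rewrite mulrCA (powRN dd) mulVf ?mulr1// gt_eqF// powR_gt0.
rewrite (@integral_power_subst R H D (2 / al))//.
- apply: eq_integral => t; rewrite inE/= in_itv/= => /andP[t0 _]; congr (_%:E).
  by rewrite /H hpE// mulr_ge0// ltW.
- exact: continuous_measurable_fun.
- by move=> t; exact: hp0.
- by move=> t _; exact: cH.
Qed.

End marked_integral.

(** * Hypergeometric kernels *)

Section hypergeometric.
Context {R : realType}.
Local Notation lam := (@lebesgue_measure R).
Implicit Types (dl ta : R) (n e p : nat).

(** What the power substitution leaves of a mark average of the form [a^e / (1 + a)^p]. *)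
Definition hyp_kernel p e dl ta (t : R) : R :=
  dl * ((ta * t) ^+ e / (1 + ta * t) ^+ p) * powR t (- dl - 1).

Lemma hyp_kernelE p e dl ta t : 0 < t -> hyp_kernel p e dl ta t =
  dl * ta ^+ e * (powR t (e%:R - dl - 1) / (1 + ta * t) ^+ p).
Proof.
move=> t0; rewrite /hyp_kernel exprMn.
have -> : powR t (e%:R - dl - 1) = t ^+ e * powR t (- dl - 1).
  rewrite -powR_mulrn ?(ltW t0)// -powRD; first by rewrite addrA.
  by apply/implyP => _; rewrite gt_eqF.
ring.
Qed.

Let u p e dl ta (t : R) : R := powR t (e%:R - dl - 1) / (1 + ta * t) ^+ p.

Let u_le p e dl ta t : 0 <= ta -> 0 < t -> 0 <= u p e dl ta t <= powR t (e%:R - dl - 1).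
Proof.
move=> ta0 t0.
have d1 : 1 <= (1 + ta * t) ^+ p by rewrite exprn_ege1// lerDl mulr_ge0// ltW.
have dp : 0 < (1 + ta * t) ^+ p by exact: lt_le_trans d1.
rewrite /u mulr_ge0 ?powR_ge0 ?invr_ge0 ?(ltW dp)//=.
by rewrite ler_piMr ?powR_ge0// invf_le1.
Qed.

Let measurable_u p e dl ta : 0 <= ta -> measurable_fun (`]0%R, 1%R[%classic : set R) (u p e dl ta).
Proof.
move=> ta0; apply: open_continuous_measurable_fun; first exact: interval_open.
move=> t; rewrite inE/= in_itv/= => /andP[t0 _].
have d0 : (1 + ta * t) ^+ p != 0.
  by rewrite expf_neq0// gt_eqF// ltr_pwDl// mulr_ge0// ltW.
have cl : ta * x @[x --> t] --> ta * t by exact: mulrl_continuous.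
apply: cvgM; first exact: continuous_powR_pos.
apply: cvgV => //.
apply: (@cvg_comp _ _ _ (fun x => 1 + ta * x) (fun y => y ^+ p) _ (nbhs (1 + ta * t))).
  by apply: cvgD; [exact: cvg_cst|exact: cl].
exact: exprn_continuous.
Qed.

Let integral_u_fin p e dl ta : 0 < dl < 1 -> (0 < e)%N -> 0 <= ta ->
  (\int[lam]_(t in `]0%R, 1%R[) (u p e dl ta t)%:E)%E \is a fin_num.
Proof.
move=> /andP[dl0 dl1] e0 ta0.
have b0 : 0 < e%:R - dl :> R by rewrite subr_gt0 (lt_le_trans dl1)// ler1n.
have b t : `]0%R, 1%R[%classic t -> 0 <= u p e dl ta t <= powR t (e%:R - dl - 1).
  by rewrite /= in_itv/= => /andP[t0 _]; exact: u_le.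
rewrite ge0_fin_numE; last by apply: integral_ge0 => t /b /andP[]; rewrite lee_fin.
apply: (@le_lt_trans _ _ (\int[lam]_(t in `]0%R, 1%R[) (powR t (e%:R - dl - 1))%:E)%E).
  apply: ge0_le_integral => //.
  - by move=> t /b /andP[]; rewrite lee_fin.
  - by apply/measurable_EFinP; exact: measurable_u.
  - by apply/measurable_EFinP/measurable_funTS; exact: measurable_powR.
  - by move=> t /b /andP[_]; rewrite lee_fin.
by rewrite integral_powR01// ltry.
Qed.

(** The condition on [c] says [c = b + 1] with [b = e - dl]: in Euler's integral the factor in
    [1 - t] becomes 1 and the Beta integral equals [1 / b]. Convergence at 0 needs [b > 0], which is
    where [dl < 1] enters. *)
Lemma integral_hyp_kernel p e dl ta c : 0 < dl < 1 -> (0 < e)%N -> 0 <= ta ->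
  c - (e%:R - dl) - 1 = 0 ->
  (\int[lam]_(t in `]0%R, 1%R[) (hyp_kernel p e dl ta t)%:E)%E =
  (dl * ta ^+ e * hyp2F1 p%:R (e%:R - dl) c (- ta) / (e%:R - dl))%:E.
Proof.
move=> dl01 e0 ta0 cE; have /andP[dl0 dl1] := dl01; rewrite /hyp2F1 cE.
have b0 : 0 < e%:R - dl :> R by rewrite subr_gt0 (lt_le_trans dl1)// ler1n.
have -> : Rintegral lam `]0, 1[ (fun t => powR t (e%:R - dl - 1) * powR (1 - t) 0) =
    (e%:R - dl)^-1.
  rewrite /Rintegral; under eq_integral do rewrite powRr0 mulr1.
  by rewrite integral_powR01.
rewrite invrK mulrA mulfK ?gt_eqF// /Rintegral.
transitivity (\int[lam]_(t in `]0%R, 1%R[) ((dl * ta ^+ e)%:E * (u p e dl ta t)%:E))%E.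
  apply: eq_integral => t; rewrite inE/= in_itv/= => /andP[t0 _].
  by rewrite hyp_kernelE// EFinM.
rewrite ge0_integralZl_EFin//; last 3 first.
- by move=> t; rewrite /= in_itv/= => /andP[t0 _]; have /andP[] := u_le p e dl ta0 t0; rewrite lee_fin.
- by apply/measurable_EFinP; exact: measurable_u.
- by rewrite mulr_ge0 ?exprn_ge0 ?(ltW dl0).
rewrite EFinM -(fineK (integral_u_fin p dl01 e0 ta0)); congr (_ * (fine _)%:E)%E.
apply: eq_integral => t; rewrite inE/= in_itv/= => /andP[t0 _]; congr (_%:E).
rewrite powRr0 mulr1 mulNr opprK /u powRN powR_mulrn//.
by rewrite addr_ge0// mulr_ge0// ltW.
Qed.

Lemma measurable_hyp_kernel p e dl ta : 0 <= ta ->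
  measurable_fun (`]0%R, 1%R[%classic : set R) (hyp_kernel p e dl ta).
Proof.
move=> s0; apply: (eq_measurable_fun (fun t => dl * ta ^+ e * u p e dl ta t)).
  by move=> t; rewrite inE/= in_itv/= => /andP[t0 _]; rewrite hyp_kernelE.
by apply: measurable_funM => //; exact: measurable_u.
Qed.

Lemma hyp_kernel_ge0 p e dl ta t : 0 < dl -> 0 <= ta -> 0 < t -> 0 <= hyp_kernel p e dl ta t.
Proof.
move=> dl0 ta0 t0; rewrite hyp_kernelE// !mulr_ge0 ?exprn_ge0 ?(ltW dl0)//.
  exact: powR_ge0.
by rewrite invr_ge0 exprn_ge0// addr_ge0// mulr_ge0// ltW.
Qed.

(** A common bound [C] on the parameters gives the dominating function [dl C^e t^(e - dl - 1)],
    integrable at 0. *)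
Lemma cvg_integral_hyp_kernel p e dl (ta_ : nat -> R) ta C : 0 < dl < 1 -> (0 < e)%N ->
  (forall i, 0 <= ta_ i <= C) -> ta_ i @[i --> \oo] --> ta ->
  fine (\int[lam]_(t in `]0%R, 1%R[) (hyp_kernel p e dl (ta_ i) t)%:E)%E @[i --> \oo] -->
  fine (\int[lam]_(t in `]0%R, 1%R[) (hyp_kernel p e dl ta t)%:E)%E.
Proof.
move=> dl01 e0 taC tata; have /andP[dl0 dl1] := dl01.
have ta0 : 0 <= ta.
  rewrite -(cvg_lim _ tata)//; apply: limr_ge; first by apply/cvg_ex; exists ta.
  by near=> i; have /andP[] := taC i.
have C0 : 0 <= C by have /andP[a b] := taC 0; exact: le_trans b.
have b0 : 0 < e%:R - dl :> R by rewrite subr_gt0 (lt_le_trans dl1)// ler1n.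
have mp : measurable_fun setT (fun t : R => dl * C ^+ e * powR t (e%:R - dl - 1)).
  by apply: measurable_funM => //; exact: measurable_powR.
have mk s : 0 <= s -> measurable_fun (`]0%R, 1%R[%classic : set R)
    (EFin \o hyp_kernel p e dl s).
  by move=> s0; apply/measurable_EFinP; exact: measurable_hyp_kernel.
have fin : (\int[lam]_(t in `]0%R, 1%R[) (hyp_kernel p e dl ta t)%:E)%E \is a fin_num.
  by rewrite (@integral_hyp_kernel p e dl ta (e%:R - dl + 1))//; ring.
have : (\int[lam]_(t in `]0%R, 1%R[) (hyp_kernel p e dl (ta_ i) t)%:E)%E @[i --> \oo] -->
    (\int[lam]_(t in `]0%R, 1%R[) (hyp_kernel p e dl ta t)%:E)%E.
  have mD : measurable (`]0%R, 1%R[%classic : set (measurableTypeR R)).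
    exact: measurable_itv.
  apply: (@dominated_cvg _ _ _ lam _ mD (fun i t => (hyp_kernel p e dl (ta_ i) t)%:E)
    (fun t => (hyp_kernel p e dl ta t)%:E)
    (fun t => (dl * C ^+ e * powR t (e%:R - dl - 1))%:E)) => //.
  - by move=> i; apply: mk; have /andP[] := taC i.
  - move=> t; rewrite /= in_itv/= => /andP[t0 _]; apply: cvg_EFin; first by near=> i.
    have cl : ta_ i * t @[i --> \oo] --> ta * t by apply: cvgM => //; exact: cvg_cst.
    apply: cvgM; last exact: cvg_cst.
    apply: cvgM; first exact: cvg_cst.
    apply: cvgM; first exact: (cvg_comp _ _ cl (@exprn_continuous R e (ta * t))).
    apply: cvgV; first by rewrite expf_neq0// gt_eqF// ltr_pwDl// mulr_ge0// ltW.
    apply: (@cvg_comp _ _ _ (fun i => 1 + ta_ i * t) (fun y => y ^+ p) _ (nbhs (1 + ta * t))).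
      by apply: cvgD; [exact: cvg_cst|exact: cl].
    exact: exprn_continuous.
  - apply/integrableP; split; first exact/measurable_EFinP/measurable_funTS.
    have cc0 : 0 <= dl * C ^+ e by rewrite mulr_ge0 ?exprn_ge0 ?(ltW dl0).
    under eq_integral do
      rewrite gee0_abs ?lee_fin ?(mulr_ge0 cc0 (powR_ge0 _ _))// EFinM.
    rewrite ge0_integralZl_EFin//; last 2 first.
    - by move=> t _; rewrite lee_fin powR_ge0.
    - by apply/measurable_EFinP/measurable_funTS; exact: measurable_powR.
    by rewrite integral_powR01// -EFinM ltry.
  - move=> i t; rewrite /= in_itv/= => /andP[t0 _]; have /andP[ti0 tiC] := taC i.
    rewrite lee_fin ger0_norm ?hyp_kernel_ge0// hyp_kernelE//.
    have /andP[u0 u1] := u_le p e dl ti0 t0.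
    apply: ler_pM => //; first by rewrite mulr_ge0 ?exprn_ge0 ?(ltW dl0).
    by rewrite ler_pM2l// lerXn2r ?nnegrE.
by rewrite -(fineK fin) => /fine_cvgP[].
Unshelve. all: by end_near. Qed.

End hypergeometric.

(** * Toeplitz matrices *)

Lemma big_nat_shift (R : realType) (q M : nat) (F : nat -> R) :
  \sum_(0 <= l < M | (q <= l)%N) F (l - q)%N = \sum_(j < M - q) F j.
Proof.
rewrite (eq_bigl (fun l => xpredT l && (q <= l)%N))// -big_nat_widenl//.
rewrite -{1}(add0n q) big_addn big_mkord.
by apply: eq_bigr => j _; rewrite addnK.
Qed.

Section toeplitz.
Context {R : realType}.
Implicit Types (g : nat -> R) (M : nat).

Definition toeplitz g M : 'M[R]_M :=
  \matrix_(p, q) if (q < p)%N then g (p - q)%N else 0.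

(** Lower triangular Toeplitz matrices multiply like polynomials modulo ['X^M], the coefficient of
    degree [n] filling the [n]-th subdiagonal. *)
Lemma toeplitz_exp g M i (p q : 'I_M) :
  (toeplitz g M ^+ i) p q = if (q <= p)%N then (cpoly g M ^+ i)`_(p - q) else 0.
Proof.
elim: i p q => [|i IH] p q.
  rewrite !expr0 mxE coef1 -val_eqE /= eqn_leq subn_eq0.
  by case: (leqP q p) => qp; rewrite ?andbT ?andbF.
rewrite !exprS mxE.
under eq_bigr => l _ do rewrite mxE IH.
case: (leqP q p) => qp; last first.
  rewrite big1// => l _; case: (ltnP l p) => lp; last by rewrite mul0r.
  by rewrite leqNgt (ltn_trans lp qp) mulr0.
rewrite coefMr.
pose F (j : nat) := (if (j < p - q)%N then g (p - q - j)%N else 0) * (cpoly g M ^+ i)`_j.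
transitivity (\sum_(j < M - q) F j).
  transitivity (\sum_(0 <= l < M | (q <= l)%N) F (l - q)%N).
    rewrite [RHS]big_mkcond /= big_mkord; apply: eq_bigr => l _ /=.
    case: (leqP q l) => ql; last by rewrite mulr0.
    rewrite /F; have -> : (l - q < p - q)%N = (l < p)%N by lia.
    by have -> : (p - q - (l - q) = p - l)%N by lia.
  exact: big_nat_shift.
have le1 : ((p - q).+1 <= M - q)%N by have := ltn_ord p; lia.
rewrite -(big_mkord xpredT F) (@big_cat_nat _ _ _ (p - q).+1)//=.
rewrite [X in _ + X]big_nat_cond [X in _ + X]big1 ?addr0; last first.
  move=> j /andP[/andP[pj _] _]; rewrite /F ltnNge (ltnW pj) /= mul0r//.
rewrite big_mkord; apply: eq_bigr => -[j /= jp] _.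
rewrite /F coef_cpoly; have [jlt|jge] := ltnP j (p - q); last first.
  by have -> : (0 < p - q - j)%N = false by lia.
by have -> : (0 < p - q - j < M)%N by have := ltn_ord p; lia.
Qed.

Lemma col1_entry_toeplitz_exp g M i (m : 'I_M) :
  col1_entry (toeplitz g M ^+ i) m = (cpoly g M ^+ i)`_m.
Proof.
case: M m => [[]//|M] m; rewrite /col1_entry (big_pred1 ord0).
  by rewrite toeplitz_exp /= subn0.
by move=> q /=; rewrite -val_eqE.
Qed.

(** Column [q] contains the first [M - q] coefficients. As these are nonnegative, the largest column
    sum is that of the first column. *)
Lemma mx_norm1_toeplitz_exp g M i : (forall n, 0 <= g n) -> (0 < M)%N ->
  mx_norm1 (toeplitz g M ^+ i) = \sum_(m < M) (cpoly g M ^+ i)`_m.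
Proof.
move=> g0; case: M => // M _.
have c0 j := coef_cpoly_exp_ge0 M.+1 i j g0.
have colE (q : 'I_M.+1) : \sum_(p < M.+1) `|(toeplitz g M.+1 ^+ i) p q| =
    \sum_(j < M.+1 - q) (cpoly g M.+1 ^+ i)`_j.
  under eq_bigr => p _ do rewrite toeplitz_exp.
  transitivity (\sum_(0 <= p < M.+1 | (q <= p)%N) (cpoly g M.+1 ^+ i)`_(p - q)%N).
    rewrite [RHS]big_mkcond /= big_mkord; apply: eq_bigr => p _ /=.
    by case: ifP => _; [rewrite ger0_norm|rewrite normr0].
  exact: (big_nat_shift q M.+1 (fun j => (cpoly g M.+1 ^+ i)`_j)).
rewrite /mx_norm1; apply/eqP; rewrite eq_le; apply/andP; split.
  apply: (big_ind (fun x => x <= _)); first by rewrite sumr_ge0.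
    by move=> x y xS yS; rewrite ge_max xS.
  move=> q _; rewrite colE -(big_mkord xpredT (fun j => (cpoly g M.+1 ^+ i)`_j)).
  rewrite -(big_mkord xpredT (fun j => (cpoly g M.+1 ^+ i)`_j)).
  rewrite [leRHS](@big_cat_nat _ _ _ (M.+1 - q))//=; last by rewrite leq_subr.
  by rewrite lerDl sumr_ge0.
have := colE ord0; rewrite /= subn0 => <-.
by apply: (@le_bigmax_cond _ _ _ _ _ xpredT (fun q => \sum_(p < M.+1) `|(toeplitz g M.+1 ^+ i) p q|)).
Qed.

End toeplitz.

(** * Integrals over compact intervals *)

Section interval_integrals.
Context {R : realType}.
Local Notation leb := (@lebesgue_measure R).

Lemma within_continuous_powR (e b : R) : 0 < e -> 0 < b ->
  {within `[0, b], continuous (fun u => powR u e)}.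
Proof.
move=> e0 b0; apply/continuous_within_itvP => //; split.
- by move=> x; rewrite in_itv/= => /andP[x0 _]; exact: continuous_powR_pos.
- by rewrite powR0 ?gt_eqF//; exact: powR_cvg0.
- by apply: cvg_at_left_filter; exact: continuous_powR_pos.
Qed.

Lemma within_continuous_integrable (f : R -> R) a b :
  {within `[a, b], continuous f} -> leb.-integrable `[a, b] (EFin \o f).
Proof.
by move=> cf; apply: continuous_compact_integrable => //; exact: segment_compact.
Qed.

Lemma Rintegral_sum (I : Type) (r : seq I) (f : I -> R -> R) a b :
  (forall i, {within `[a, b], continuous (f i)}) ->
  Rintegral leb `[a, b] (fun x => \sum_(i <- r) f i x) =
  \sum_(i <- r) Rintegral leb `[a, b] (f i).
Proof.
move=> cf.
have E : (\int[leb]_(x in `[a, b]) (\sum_(i <- r) f i x)%:E =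
    (\sum_(i <- r) Rintegral leb `[a, b] (f i))%:E)%E.
  under eq_integral do rewrite -sumEFin.
  rewrite (@integral_sum _ _ _ leb _ (measurable_itv _) _ (fun i x => (f i x)%:E)); last first.
    by move=> i; exact: within_continuous_integrable.
  rewrite -sumEFin; apply: eq_bigr => i _; rewrite /Rintegral fineK//.
  by apply: integrable_fin_num => //; exact: within_continuous_integrable.
by rewrite {1}/Rintegral E.
Qed.

Lemma cvg_cpoly_term {T : Type} {F : set_system T} {FF : Filter F} (c : R)
    (h_ : T -> R) h (q_ : T -> nat -> R) q M i m :
  h_ x @[x --> F] --> h -> (forall n, q_ x n @[x --> F] --> q n) ->
  c * expR (h_ x) * (cpoly (q_ x) M ^+ i)`_m @[x --> F] -->
  c * expR h * (cpoly q M ^+ i)`_m.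
Proof.
move=> hh hq; apply: cvgM; last exact: cvg_coef_cpoly_exp.
apply: cvgM; first exact: cvg_cst.
by apply: (@cvg_comp _ _ _ h_ expR _ (nbhs h)) => //; exact: continuous_expR.
Qed.

(** Homogeneity: the [i]-th power of the jump polynomial carries [c ^+ i]. With [c = pi] and [s] the
    association exponent this produces the factor [pi ^+ i.+1] over the factorial of [i], the extra
    [pi] coming from the serving density. *)
Lemma sum_cpmf_scale (c : R) (q : nat -> R) M s :
  c * expR (- s) * (\sum_(m < M) cpmf (fun n => c * q n) M m) =
  \sum_(i < M) \sum_(m < M) c ^+ i.+1 / (i`!)%:R * expR (- (c * q 0%N) - s) *
    (cpoly q M ^+ i)`_m.
Proof.
rewrite exchange_big mulr_sumr; apply: eq_bigr => m _.
rewrite /cpmf coef_sum !mulr_sumr; apply: eq_bigr => i _.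
by rewrite cpolyZ exprZn !coefZ expRD exprS; ring.
Qed.

(** Up to the constant [q / Z ^+ i.+1], the integrand is an Erlang density of rate [pi * Z]. *)
Lemma Rintegral_erlang (Z b q : R) i : 0 < b -> Z != 0 ->
  Rintegral leb `[0, b]
    (fun u => pi ^+ i.+1 / (i`!)%:R * expR (- (pi * Z * u)) * (u ^+ i * q)) =
  q / Z ^+ i.+1 * (1 - erlang_tail i (pi * Z * b)).
Proof.
move=> b0 Z0; have E := integral_erlang (pi * Z) i b0.
transitivity (Rintegral leb `[0, b]
    (fun u => q / Z ^+ i.+1 * (pi * Z * poisson_p (pi * Z * u) i))).
  apply: eq_Rintegral => u _; rewrite /poisson_p !exprMn !exprS.
  have Zi : Z ^+ i != 0 by rewrite expf_neq0.
  have fi : (i`!)%:R != 0 :> R by rewrite pnatr_eq0 -lt0n fact_gt0.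
  by field; rewrite ?Z0 ?Zi ?fi.
rewrite RintegralZl//; first by rewrite {1}/Rintegral E.
apply: within_continuous_integrable; apply: continuous_subspaceT => x.
apply: cvgM; first exact: cvg_cst.
apply: (@cvg_comp _ _ _ (fun x => pi * Z * x) (fun y => poisson_p y i) _ (nbhs (pi * Z * x))).
  by apply: cvgM; [exact: cvg_cst|exact: cvg_id].
exact: continuous_poisson_p.
Qed.

Lemma integral_subst_sqr (G : R -> R) b : 0 < b -> {within `[0, b ^+ 2], continuous G} ->
  (\int[leb]_(x in `[0%R, (b ^+ 2)%R]) (G x)%:E =
   \int[leb]_(x in `[0%R, b]) (G (x ^+ 2) * (2 * x))%:E)%E.
Proof.
move=> b0 cG.
have H := @integration_by_substitution_open_incr R setT (fun x => x ^+ 2) (fun x => 2 * x) G 0 b.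
rewrite expr0n/= in H; apply: H => //.
- exact: openT.
- move=> x _.
  have dX : is_derive x 1 (fun y : R => y ^+ 2) (2%:R * x ^+ 1).
    rewrite (_ : (fun y : R => y ^+ 2) = (@id R) ^+ 2); last first.
      by apply/funext => y; rewrite fctE.
    by apply: is_derive_eq; rewrite /GRing.scale/= mulr1 mulr_natl.
  by rewrite expr1 in dX.
- by move=> x _; apply: cvgM; [exact: cvg_cst|exact: cvg_id].
- move=> x y; rewrite !in_itv/= => /andP[x0 _] /andP[y0 _] xy.
  by rewrite ltr_pXn2r// nnegrE.
Qed.

End interval_integrals.

(** * Geometric grids *)

Section geometric_grid.
Context {R : realType}.
Variables (b z : R).
Hypothesis b0 : 0 < b.
Hypothesis z0 : 0 < z.
Hypothesis z1 : z < 1.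

(** The ends of a cell have the fixed ratio [z], hence lie within a factor [z] of every point of the
    cell; a uniform grid has no such control near 0. *)
Definition geom_cell (i : nat) : set R := `]b * z ^+ i.+1, b * z ^+ i].

Lemma geom_cell_bigcup : \bigcup_i geom_cell i = `]0, b]%classic.
Proof.
apply/seteqP; split => x.
  case=> i _; rewrite /geom_cell /= !in_itv/= => /andP[lx xh].
  rewrite (lt_trans _ lx) ?mulr_gt0 ?exprn_gt0//= (le_trans xh)// ler_piMr ?(ltW b0)//.
  by rewrite exprn_ile1 ?ltW.
rewrite /= in_itv/= => /andP[x0 xb].
have ex : exists n, b * z ^+ n.+1 < x.
  have xb0 : 0 < x / b by rewrite divr_gt0.
  have : z ^+ n @[n --> \oo] --> (0 : R) by apply: cvg_expr; rewrite ger0_norm ?ltW.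
  move=> /cvgr0_norm_lt /(_ _ xb0) [N _ /(_ N.+1)].
  rewrite /= leqnSn => /(_ isT); rewrite ger0_norm ?exprn_ge0 ?(ltW z0)// ltr_pdivlMr// => h.
  by exists N; rewrite mulrC.
(* Minimality of the index gives the upper end of the cell. *)
exists (ex_minn ex) => //; case: ex_minnP => n hn hmin.
rewrite /geom_cell /= in_itv/= hn/=; case: n hn hmin => [|n] hn hmin.
  by rewrite expr0 mulr1.
by rewrite leNgt; apply/negP => /hmin; rewrite ltnn.
Qed.

Lemma geom_cell_trivIset : trivIset setT geom_cell.
Proof.
apply: ltn_trivIset => n m mn; rewrite -subset0 => x [].
rewrite /geom_cell /= !in_itv/= => /andP[lx _] /andP[_ xh].
have : b * z ^+ n <= b * z ^+ m.+1 by rewrite ler_pM2l// ler_wiXn2l// ltW.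
by move=> /(le_trans xh) /(lt_le_trans lx); rewrite ltxx.
Qed.

End geometric_grid.

(** * Cumulants of the interference *)

(** The fading has mean 1, so the integral is a kernel with [p = 0] and [e = 1]; its convergence
    amounts to [2 / al < 1]. *)
Lemma integrable_path_gain {R : realType} (mu kp dd al : R) (mu0 : 0 <= mu) : 0 <= kp -> 0 < dd ->
  2 < al -> (\int[marked_measure mu0]_x (path_gain kp dd al x)%:E < +oo)%E.
Proof.
move=> kp0 dd0 al2'; have al0 : 0 < al by exact: lt_trans al2'.
rewrite (@integral_path_gain _ _ _ _ _ mu0 id id)//; last 2 first.
- by move=> a a0; exact: integral_exp1_id.
- by move=> a _; exact: cvg_id.
have C0 : 0 <= kp * powR dd (- al) by rewrite mulr_ge0 ?powR_ge0.
have d01 : 0 < 2 / al < 1 by rewrite divr_gt0//= ltr_pdivrMr// mul1r.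
have -> : (\int[@lebesgue_measure R]_(t in `]0%R, 1%R[) (dd ^+ 2 * (2 / al) *
     id (kp * powR dd (- al) * t)%R * powR t (- (2 / al) - 1))%:E =
   \int[@lebesgue_measure R]_(t in `]0%R, 1%R[) ((dd ^+ 2)%:E *
     (hyp_kernel 0 1 (2 / al) (kp * powR dd (- al)) t)%:E))%E.
  apply: eq_integral => t _; rewrite -EFinM; congr (_%:E).
  by rewrite /hyp_kernel expr0 expr1 divr1; ring.
rewrite ge0_integralZl_EFin ?sqr_ge0//.
- rewrite (@integral_hyp_kernel _ 0 1 _ _ (1%:R - 2 / al + 1))//; last by ring.
  by rewrite -!EFinM ltry.
- move=> t; rewrite /= in_itv/= => /andP[t0 _].
  by rewrite lee_fin hyp_kernel_ge0//; case/andP: d01.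
- by apply/measurable_EFinP; exact: measurable_hyp_kernel.
Qed.

Section tier_model.
Context {R : realType} {K : nat}.
Variables (lam P B alpha : 'I_K -> R) (M : 'I_K -> nat) (lam_u eps beta : R) (k : 'I_K).
Hypothesis lam0 : forall j, 0 < lam j.
Hypothesis P0 : forall j, 0 < P j.
Hypothesis M0 : forall j, (0 < M j)%N.
Hypothesis B0 : forall j, 0 < B j.
Hypothesis al2 : forall j, 2 < alpha j.
Hypothesis lamu0 : 0 < lam_u.
Hypothesis beta0 : 0 < beta.
Local Notation Om := (Omega P B M).
Local Notation dl := (delta alpha).
Local Notation ta j := (tau B M beta j k).
Local Notation leb := (@lebesgue_measure R).

Definition act j : R := Aact lam P B alpha M lam_u eps j * lam j.

Lemma act_ge0 j : 0 <= act j.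
Proof.
apply: mulr_ge0; last exact: ltW.
rewrite /Aact subr_ge0 -expR0 ler_expR oppr_le0 !mulr_ge0 ?pi_ge0 ?(ltW lamu0)//.
by apply: Rintegral_ge0 => x _; exact: expR_ge0.
Qed.

Lemma alpha_gt0 j : 0 < alpha j. Proof. exact: lt_trans (al2 j). Qed.

Lemma delta01 j : 0 < dl j < 1.
Proof.
by rewrite divr_gt0 ?alpha_gt0//= ltr_pdivrMr ?alpha_gt0// mul1r.
Qed.

Lemma Omega_gt0 j : 0 < Om j.
Proof. by rewrite !mulr_gt0 ?ltr0n. Qed.

Lemma tau_gt0 j : 0 < ta j.
Proof. by rewrite divr_gt0// mulr_gt0// divr_gt0// ltr0n. Qed.

(** Exponents of the mark averages: [a / (1 + a)] at index 0 and [a^n / (1 + a)^(n+1)] at the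
    others. *)
Let kp (n : nat) : nat := if n == 0%N then 1%N else n.+1.
Let ke (n : nat) : nat := if n == 0%N then 1%N else n.

(** [varphi] with the argument [tau] freed: when the two distances differ, [tau] is multiplied by a
    power of their ratio. *)
Definition vph (d t : R) (n : nat) : R :=
  fine (\int[leb]_(x in `]0%R, 1%R[) (hyp_kernel (kp n) (ke n) d t x)%:E)%E.

Let ke_gt0 n : (0 < ke n)%N. Proof. by rewrite /ke; case: n. Qed.

Lemma varphiE j n : varphi B alpha M beta j k n = vph (dl j) (ta j) n.
Proof.
have t0 := ltW (tau_gt0 j); have d01 := delta01 j.
rewrite /vph /varphi /kp /ke; case: n => [|n] /=.
  rewrite (@integral_hyp_kernel _ _ _ _ _ (2 - dl j))//=; last by ring.
by rewrite (@integral_hyp_kernel _ _ _ _ _ (n.+2%:R - dl j))//= -natr1; ring.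
Qed.

Lemma vph_ge0 j t n : 0 <= t -> 0 <= vph (dl j) t n.
Proof.
move=> t0; have /andP[d0 _] := delta01 j.
apply: fine_ge0; apply: integral_ge0 => x; rewrite /= in_itv/= => /andP[x0 _].
by rewrite lee_fin hyp_kernel_ge0.
Qed.

(* [sc y * I] is compared with the gain [||h||^2]: the outage event at serving
   distance [y] is [||h||^2 < sc y * I_y]. *)
Definition sc (y : R) : R := beta * powR y (alpha k) / P k.
Local Notation rad j z := (excl_radius P B alpha M k j z).
Definition gain (y z : R) (j : 'I_K) := path_gain (sc y * P j) (rad j z) (alpha j).

(** [y] enters through the received power, [z] through the exclusion radius; at [y = z = x] with
    [x > 0] this is [pi] times [gfun] at [x ^+ 2]. *)
Definition cum (y z : R) (n : nat) : R := pi * \sum_(j < K)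
  act j * powR (Om j / Om k) (dl j) * powR z (2 * (dl j / dl k)) *
  vph (dl j) (ta j * (powR y (alpha k) / powR z (alpha k))) n.

Definition cover (y z : R) : R := \sum_(m < M k) cpmf (cum y z) (M k) m.

Lemma sc_ge0 y : 0 <= sc y.
Proof. by rewrite /sc divr_ge0 ?mulr_ge0 ?powR_ge0// ltW. Qed.

Lemma rad_gt0 j z : 0 < z -> 0 < rad j z.
Proof.
by move=> z0; rewrite mulr_gt0 ?powR_gt0// divr_gt0 ?Omega_gt0.
Qed.

(** Origin of [tau]: on the exclusion boundary the biased powers of the interferer and the server
    coincide, so that for [y = z] the ratio of transmit powers and distances leaves only [beta] and
    the ratios of [M] and [B]. *)
Let gain_const y z j : 0 < z -> sc y * P j * powR (rad j z) (- alpha j) =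
  ta j * (powR y (alpha k) / powR z (alpha k)).
Proof.
move=> z0; have aj := alpha_gt0 j; have O0 : 0 < Om j / Om k by rewrite divr_gt0 ?Omega_gt0.
have -> : powR (rad j z) (- alpha j) = (Om k / Om j) / powR z (alpha k).
  rewrite /excl_radius powRM ?powR_ge0// -!powRrM.
  have -> : 1 / alpha j * - alpha j = -1 by field; rewrite gt_eqF.
  have -> : alpha k / alpha j * - alpha j = - alpha k by field; rewrite gt_eqF.
  by rewrite powR_inv1 ?(ltW O0)// invf_div powRN.
rewrite /sc /tau /Omega.
have z1 : powR z (alpha k) != 0 by rewrite gt_eqF// powR_gt0.
have mM i : (M i)%:R != 0 :> R by rewrite pnatr_eq0 -lt0n.
by field; rewrite z1 ?mM ?gt_eqF.
Qed.

Let rad_sqr z j : 0 < z ->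
  rad j z ^+ 2 = powR (Om j / Om k) (dl j) * powR z (2 * (dl j / dl k)).
Proof.
move=> z0; have aj := alpha_gt0 j; have ak := alpha_gt0 k.
rewrite exprMn -!powR_mulrn ?powR_ge0// -!powRrM; congr (powR _ _ * powR _ _).
  by rewrite mul1r mulrC.
by rewrite /delta; field; rewrite !gt_eqF.
Qed.

Let integral_gain y z j (phi h : R -> R) p e : 0 < z ->
  measurable_fun setT phi -> (forall x, 0 <= x -> 0 <= phi x) -> phi 0 = 0 ->
  (forall a, 0 <= a -> (\int[exp1]_v (phi (a * Num.max v 0)%R)%:E = (h a)%:E)%E) ->
  (forall a, h a = a ^+ e / (1 + a) ^+ p) -> (0 < e)%N ->
  (\int[marked_measure (act_ge0 j)]_x (phi (gain y z j x))%:E)%E =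
  (act j * pi * (powR (Om j / Om k) (dl j) * powR z (2 * (dl j / dl k))) *
   fine (\int[leb]_(x in `]0%R, 1%R[)
     (hyp_kernel p e (dl j) (ta j * (powR y (alpha k) / powR z (alpha k))) x)%:E)%E)%:E.
Proof.
move=> z0 mphi phi0 phi00 hE hE' e0; have /andP[d0 d1] := delta01 j.
have C0 : 0 <= ta j * (powR y (alpha k) / powR z (alpha k)).
  by rewrite mulr_ge0 ?(ltW (tau_gt0 j))// divr_ge0 ?powR_ge0.
rewrite (integral_path_gain (act_ge0 j) _ (rad_gt0 j z0) (alpha_gt0 j) mphi phi0 phi00 hE);
  last 2 first.
- by rewrite mulr_ge0 ?sc_ge0// ltW.
- move=> a a0; rewrite (_ : h = fun a => a ^+ e / (1 + a) ^+ p); last exact/funext.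
  apply: cvgM; first exact: exprn_continuous.
  apply: cvgV; first by rewrite expf_neq0// gt_eqF// ltr_pwDl.
  apply: (@cvg_comp _ _ _ (fun x => 1 + x) (fun y => y ^+ p) _ (nbhs (1 + a))).
    by apply: cvgD; [exact: cvg_cst|exact: cvg_id].
  exact: exprn_continuous.
have fin : (\int[leb]_(x in `]0%R, 1%R[)
     (hyp_kernel p e (dl j) (ta j * (powR y (alpha k) / powR z (alpha k))) x)%:E)%E \is a fin_num.
  rewrite (@integral_hyp_kernel _ p e _ _ (e%:R - dl j + 1))//; first by rewrite d0.
  by ring.
rewrite [in RHS]EFinM fineK// gain_const// -rad_sqr// [in RHS]EFinM -muleA; congr (_ * _)%E.
rewrite -ge0_integralZl_EFin//.
- apply: eq_integral => x _; rewrite -EFinM; congr (_%:E).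
  by rewrite hE' /hyp_kernel /delta; ring.
- move=> x; rewrite /= in_itv/= => /andP[x0 _].
  by rewrite lee_fin hyp_kernel_ge0.
- by apply/measurable_EFinP; exact: measurable_hyp_kernel.
- by rewrite sqr_ge0.
Qed.

Lemma integrable_gain y z j : 0 < z ->
  (\int[marked_measure (act_ge0 j)]_x (gain y z j x)%:E < +oo)%E.
Proof.
move=> z0; apply: integrable_path_gain; rewrite ?rad_gt0 ?al2//.
by rewrite mulr_ge0 ?sc_ge0// ltW.
Qed.

Lemma ppp_cumulant_gain y z : 0 < z ->
  ppp_cumulant (fun j => marked_measure (act_ge0 j)) (gain y z) = cum y z.
Proof.
move=> z0; apply/funext => n; rewrite /ppp_cumulant /cum mulr_sumr.
apply: eq_bigr => j _.
pose phi (x : R) := if n == 0%N then 1 - expR (- x) else poisson_p x n.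
rewrite (@integral_gain y z j phi (fun a => a ^+ ke n / (1 + a) ^+ kp n) (kp n) (ke n))//=.
- by rewrite /vph; ring.
- apply: continuous_measurable_fun => x; rewrite {}/phi; case: n => [|n] /=.
    apply: cvgB; first exact: cvg_cst.
    by apply: continuous_comp; [exact: continuousN|exact: continuous_expR].
  exact: continuous_poisson_p.
- move=> x x0; rewrite {}/phi; case: n => [|n] /=; last exact: poisson_p_ge0.
  by rewrite subr_ge0 -expR0 ler_expR oppr_le0.
- by rewrite {}/phi; case: n => [|n] /=; rewrite ?oppr0 ?expR0 ?subrr// /poisson_p exprS !mul0r.
- move=> a a0; rewrite {}/phi /ke /kp; case: n => [|n] /=.
    by rewrite integral_exp1_1expRN// /mark0 !expr1.
  by rewrite integral_exp1_poisson_p.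
Qed.


Lemma cvg_cover (y_ z_ : nat -> R) (y z : R) : 0 < y -> 0 < z -> (forall i, 0 < z_ i) ->
  y_ i @[i --> \oo] --> y -> z_ i @[i --> \oo] --> z ->
  cover (y_ i) (z_ i) @[i --> \oo] --> cover y z.
Proof.
move=> y0 z0 zi0 yy zz; apply: cvgr_sum => m; apply: cvg_cpmf => // n.
have cp (u_ : nat -> R) (v a : R) : 0 < v -> u_ i @[i --> \oo] --> v ->
    powR (u_ i) a @[i --> \oo] --> powR v a.
  move=> v0 uv; apply: (@cvg_comp _ _ _ u_ (fun x => powR x a) _ (nbhs v)) => //.
  exact: continuous_powR_pos.
apply: cvgM; first exact: cvg_cst.
apply: cvgr_sum => j; apply: cvgM.
  by apply: cvgM; [exact: cvg_cst|exact: cp].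
have ct : ta j * (powR (y_ i) (alpha k) / powR (z_ i) (alpha k)) @[i --> \oo] -->
    ta j * (powR y (alpha k) / powR z (alpha k)).
  apply: cvgM; first exact: cvg_cst.
  apply: cvgM; first exact: cp.
  by apply: cvgV; [rewrite gt_eqF// powR_gt0|exact: cp].
have /cvg_seq_bounded [C [_ hC]] : cvgn
  (fun i => ta j * (powR (y_ i) (alpha k) / powR (z_ i) (alpha k))).
  by apply/cvg_ex; eexists; exact: ct.
apply: (@cvg_integral_hyp_kernel R (kp n) (ke n) (dl j) _ _ (C + 1)
  (delta01 j) (ke_gt0 n) _ ct).
move=> i; have t0 : 0 <= ta j * (powR (y_ i) (alpha k) / powR (z_ i) (alpha k)).
  by rewrite mulr_ge0 ?(ltW (tau_gt0 j))// divr_ge0 ?powR_ge0.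
rewrite t0/= -[leLHS]ger0_norm//.
(* Boundedness is available for every constant strictly above [C]. *)
by have := hC (C + 1); rewrite ltrDl ltr01 => /(_ isT i I).
Qed.

(** Along [(x / r, r * x)] the ratio of the distances is constant, so [vph] is evaluated at a fixed
    argument and [x] enters through a power only. *)
Lemma measurable_cover (r : R) : 0 < r ->
  measurable_fun [set x : R | 0 < x] (fun x => cover (x / r) (r * x)).
Proof.
move=> r0.
pose c := powR r^-1 (alpha k) / powR r (alpha k).
pose cm (x : R) (n : nat) := pi * \sum_(j < K)
  act j * powR (Om j / Om k) (dl j) * powR (r * x) (2 * (dl j / dl k)) *
  vph (dl j) (ta j * c) n.
have cumE (x : R) : 0 < x -> cum (x / r) (r * x) = cm x.
  move=> x0; have E : powR (x / r) (alpha k) / powR (r * x) (alpha k) = c.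
    rewrite /c (@powRM _ x r^-1) ?(ltW x0) ?invr_ge0 ?(ltW r0)//.
    rewrite (@powRM _ r x) ?(ltW x0) ?(ltW r0)// [_ * powR x _]mulrC.
    by rewrite -mulf_div divff ?mul1r// gt_eqF// powR_gt0.
  by apply/funext => n; rewrite /cum E.
apply: (eq_measurable_fun (fun x => \sum_(m < M k) cpmf (cm x) (M k) m)).
  by move=> x; rewrite inE => x0; rewrite /cover (cumE x x0).
apply: measurable_funTS; apply: measurable_sum => m; apply: measurable_cpmf => // n.
apply: measurable_funM => //; apply: measurable_sum => j.
apply: measurable_funM => //; apply: measurable_funM => //.
apply: (measurableT_comp (measurable_powR _)).
exact: measurable_funM.
Qed.

End tier_model.

(** * The outage probability *)

Lemma max0_scale {R : realType} (a v p : R) : 0 <= a -> 0 <= p ->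
  Num.max (a * v * p) 0 = a * Num.max v 0 * p.
Proof.
move=> a0 p0; have [v0|v0] := leP 0 v.
  by rewrite !max_l// !mulr_ge0.
rewrite mulr0 mul0r max_r//.
by rewrite mulr_le0_ge0// mulr_ge0_le0// ltW.
Qed.

Lemma le_EFin_eq {R : realType} (a b : R) (A B : \bar R) :
  a%:E = A -> b%:E = B -> (A <= B)%E -> a <= b.
Proof. by move=> <- <-; rewrite lee_fin. Qed.

Section outage.
Context {R : realType} {K : nat}.
Variables (lam P B alpha : 'I_K -> R) (M : 'I_K -> nat) (lam_u eps beta : R) (k : 'I_K).
Context {d} {Om : measurableType d} (Pr : probability Om R).
Variables (X H : Om -> R) (Phi : 'I_K -> Om -> set ((R * R) * R)).
Hypothesis lam0 : forall j, 0 < lam j.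
Hypothesis P0 : forall j, 0 < P j.
Hypothesis M0 : forall j, (0 < M j)%N.
Hypothesis B0 : forall j, 0 < B j.
Hypothesis al2 : forall j, 2 < alpha j.
Hypothesis lamu0 : 0 < lam_u.
Hypothesis eps0 : 0 < eps.
Hypothesis beta0 : 0 < beta.
Local Notation leb := (@lebesgue_measure R).
Local Notation pdf := (serving_pdf lam P B alpha M eps k).
Local Notation rk := (Rk P B alpha M eps k).
Local Notation mu j := (act lam P B alpha M lam_u eps j).
Local Notation mu0 j := (act_ge0 P B alpha M eps lam0 lamu0 j).
Local Notation cov := (cover lam P B alpha M lam_u eps beta k).
Local Notation scl := (sc P alpha beta k).
Local Notation rad j z := (excl_radius P B alpha M k j z).
Hypothesis mX : measurable_fun setT X.
Hypothesis Xlaw : forall S : set R, measurable S ->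
  Pr (X @^-1` S) = (\int[leb]_(x in S) (pdf x)%:E)%E.
Hypothesis mH : measurable_fun setT H.
Hypothesis Hlaw : forall S : set R, measurable S ->
  Pr (H @^-1` S) = (\int[leb]_(x in S) (gamma_pdf (M k) x)%:E)%E.
Hypothesis ppp : forall j, is_ppp Pr (marked_intensity (mu j)) (Phi j).
Hypothesis indep : mutually_indep Pr (fun s : option (option 'I_K) =>
  match s with
  | None => fin_inter [set X @^-1` S | S in @measurable _ R]
  | Some None => fin_inter [set H @^-1` S | S in @measurable _ R]
  | Some (Some j) => fin_inter
      [set E | exists (A : set ((R * R) * R)) (n : nat),
         [/\ measurable A, (marked_intensity (mu j) A < +oo)%E
           & E = count_eq (Phi j) A n]]
  end).

Let cover_cum y z :
  cov y z = \sum_(m < M k) cpmf (cum lam P B alpha M lam_u eps beta k y z) (M k) m.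
Proof. by []. Qed.

(* Unification would otherwise unfold both sides when comparing two instances. *)
Local Opaque cover.

Let Itf z w := interference P B alpha M k (fun=> z) Phi w.

(** A Gamma variable of integer shape is Erlang: it exceeds [t] when a unit-rate Poisson process has
    fewer than [M k] arrivals by time [t]. *)
Let gamma_tail t : 0 <= t ->
  Pr (H @^-1` `[t, +oo[) = (\sum_(m < M k) poisson_p t m)%:E.
Proof.
move=> t0; rewrite Hlaw; last exact: measurable_itv.
have [n Mn] : exists n, M k = n.+1 by exists (M k).-1; rewrite prednK.
rewrite Mn; have := integral_erlang_tail n (@ltr01 R) t0.
rewrite /erlang_tail mul1r => <-; apply: eq_integral => x.
rewrite inE/= in_itv/= andbT => tx.
by rewrite /gamma_pdf (le_trans t0 tx) /= !mul1r /poisson_p mulrAC.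
Qed.

Let scaled_interference s z w : 0 <= s -> (s%:E * Itf z w =
  \sum_(j < K) \esum_(v in Phi j w) (path_gain (s * P j) (rad j z) (alpha j) v)%:E)%E.
Proof.
move=> s0; rewrite /Itf /interference ge0_sume_distrr; last first.
  move=> j _; rewrite esum_pos_part; apply: esum_ge0 => v _.
  by rewrite lee_fin le_max lexx orbT.
apply: eq_bigr => j _; rewrite esum_pos_part -esumZl//; last first.
  by move=> v; rewrite lee_fin le_max lexx orbT.
rewrite (esum_mkcondr (Phi j w) [set v : (R * R) * R | rad j z < dist0 v.1]).
apply: eq_esum => v _; rewrite /path_gain indicE; case: ifPn => vr; last by rewrite mulr0.
rewrite mulr1 -EFinM; congr (_%:E).
rewrite max0_scale ?powR_ge0 ?(ltW (P0 j))//.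
by rewrite !mulrA.
Qed.

Let Ev y z := [set w | ((scl y)%:E * Itf z w <= (H w)%:E)%E].

Let EvE y z : Ev y z = [set w | (\sum_(j < K) \esum_(v in Phi j w)
  (gain P B alpha M beta k y z j v)%:E <= (H w)%:E)%E].
Proof.
apply/seteqP; split => w; rewrite /Ev /=;
  by rewrite scaled_interference// sc_ge0.
Qed.

Let gain_ge0 y z j v : 0 <= gain P B alpha M beta k y z j v.
Proof. by apply: path_gain_ge0; rewrite mulr_ge0 ?sc_ge0// ltW. Qed.

Let measurable_Ev y z : 0 < z -> measurable (Ev y z).
Proof.
move=> z0; rewrite EvE; apply: measurable_le_EFin => //.
apply: emeasurable_sum => j.
apply: (@measurable_ppp_esum _ _ _ Pr _ _ (marked_measure (mu0 j))).
- exact: ppp.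
- by move=> v; exact: gain_ge0.
- exact: measurable_path_gain.
- exact: integrable_gain.
Qed.

Let prob_Ev (S : set R) y z : measurable S -> 0 < z ->
  Pr (X @^-1` S `&` Ev y z) = (Pr (X @^-1` S) * (cov y z)%:E)%E.
Proof.
move=> mS z0; rewrite EvE.
rewrite (@prob_ppp_le R K d Om Pr _ _ (fun j => marked_measure (mu0 j)) Phi X H (M k))//.
- by rewrite ppp_cumulant_gain// cover_cum.
- by move=> j; exact: measurable_path_gain.
- by move=> j; exact: integrable_gain.
Qed.

(** Taking [S] to be the whole line identifies the explicit sum as a probability. Its bounds and
    monotonicity are then inherited from events, without estimates on [cpmf]. *)
Let coverE y z : 0 < z -> (cov y z)%:E = Pr (Ev y z).
Proof.
move=> z0; have := prob_Ev y measurableT z0; rewrite preimage_setT setTI => ->.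
by rewrite probability_setT mul1e.
Qed.

Let cover_ge0 y z : 0 < z -> 0 <= cov y z.
Proof. by move=> z0; rewrite -lee_fin coverE// measure_ge0. Qed.

Let cover_le1 y z : 0 < z -> cov y z <= 1.
Proof. by move=> z0; rewrite -lee_fin coverE// probability_le1//; exact: measurable_Ev. Qed.

Let Itf_ge0 z w : (0 <= Itf z w)%E.
Proof.
apply: sume_ge0 => j _; rewrite esum_pos_part; apply: esum_ge0 => v _.
by rewrite lee_fin le_max lexx orbT.
Qed.

Let alpha_ge0 j : 0 <= alpha j.
Proof. by rewrite ltW// (lt_trans _ (al2 j)). Qed.

Let Itf_le z z' w : 0 < z -> z <= z' -> (Itf z' w <= Itf z w)%E.
Proof.
move=> z0 zz'; apply: lee_sum => j _; apply: le_ereal_sup => _ [A [fA AS] <-].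
exists A => //; split => // v /AS[Pv rv]; split => //; apply: le_lt_trans rv.
rewrite ler_wpM2l ?powR_ge0//; apply: ge0_ler_powR; rewrite ?nnegrE ?(ltW z0)//.
  by apply: divr_ge0; exact: alpha_ge0.
exact: le_trans (ltW z0) zz'.
Qed.

Let scl_le y y' : 0 <= y -> y <= y' -> scl y <= scl y'.
Proof.
move=> y0 yy'; rewrite ler_pM2r ?invr_gt0// ler_pM2l//.
have y'0 : 0 <= y' by exact: le_trans y0 yy'.
by apply: ge0_ler_powR; rewrite ?nnegrE ?alpha_ge0 ?y'0.
Qed.

(** A shorter link raises the useful power, and a larger exclusion disk removes interferers. *)
Let Ev_sub y y' z z' : 0 <= y' -> y' <= y -> 0 < z -> z <= z' -> Ev y z `<=` Ev y' z'.
Proof.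
move=> y0 yy' z0 zz' w /=; apply: le_trans.
by apply: lee_pmul; rewrite ?lee_fin ?sc_ge0 ?scl_le ?Itf_le.
Qed.

Let cover_mono y y' z z' : 0 <= y' -> y' <= y -> 0 < z -> z <= z' -> cov y z <= cov y' z'.
Proof.
move=> y0 yy' z0 zz'; have z'0 : 0 < z' by exact: lt_le_trans z0 zz'.
apply: (le_EFin_eq (coverE y z0) (coverE y' z'0)); apply: le_measure.
- by apply: mem_set; exact: measurable_Ev.
- by apply: mem_set; exact: measurable_Ev.
- exact: (Ev_sub y0 yy' z0 zz').
Qed.

(** Coverage, cross-multiplied so that zero or infinite interference causes no trouble. *)
Let Gd := [set w | (beta%:E * interference P B alpha M k X Phi w <=
  (P k * H w * powR (X w) (- alpha k))%:E)%E].

Let measurable_Gd : measurable Gd.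
Proof.
apply: measurable_le_EFin; last first.
  apply: measurable_funM; first exact: measurable_funM.
  exact: (measurableT_comp (measurable_powR _)).
apply: emeasurable_funM => //; apply: emeasurable_sum => j.
(* Positive parts bring the terms within reach of the criterion for sums beyond a random
   threshold. *)
under eq_fun do rewrite esum_pos_part.
apply: (@measurable_ppp_esum_random _ _ _ Pr _ _ (marked_measure (mu0 j)) _ (ppp j)
  (fun v => Num.max (P j * v.2 * powR (dist0 v.1) (- alpha j)) 0)
  (fun v => dist0 v.1) (fun w => rad j (X w))).
- by move=> v; rewrite le_max lexx orbT.
- apply: measurable_maxr => //; apply: measurable_funM.
    by apply: measurable_funM.
  exact: (measurableT_comp (measurable_powR _) measurable_dist0).
- exact: measurable_dist0.
- apply: measurable_funM => //.
  exact: (measurableT_comp (measurable_powR _)).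
- by move=> w; rewrite mulr_ge0 ?powR_ge0.
move=> q q0.
have := @integrable_path_gain _ _ (P j) q (alpha j) (mu0 j) (ltW (P0 j)) q0 (al2 j).
congr (_ < _)%E; apply: eq_integral => v _; congr (_%:E); rewrite /path_gain; congr (_ * _).
by rewrite max0_scale ?powR_ge0// ltW.
Qed.

Let GdE w : 0 < X w -> Gd w <-> Ev (X w) (X w) w.
Proof.
move=> x0; rewrite /Gd /Ev /=.
have p0 : 0 < powR (X w) (alpha k) by rewrite powR_gt0.
have c0 : 0 < powR (X w) (alpha k) / P k by rewrite divr_gt0.
rewrite -(lee_pmul2l (x := (powR (X w) (alpha k) / P k)%:E)) ?lte_fin//.
rewrite muleA -!EFinM /sc.
have -> : powR (X w) (alpha k) / P k * beta = beta * powR (X w) (alpha k) / P k by ring.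
have -> : powR (X w) (alpha k) / P k * (P k * H w * powR (X w) (- alpha k)) = H w.
  by rewrite powRN; field; rewrite !gt_eqF.
exact: iff_refl.
Qed.


(** * Averaging over the serving distance *)

Let rk_gt0 : 0 < rk.
Proof. by rewrite /Rk powR_gt0// divr_gt0// Omega_gt0. Qed.

Let Tk_ge0 : 0 <= Tk lam P B alpha M eps k.
Proof.
rewrite /Tk !mulr_ge0 ?pi_ge0 ?(ltW (lam0 k))//.
by apply: Rintegral_ge0 => x _; exact: expR_ge0.
Qed.

Let pdf_ge0 x : 0 <= pdf x.
Proof.
rewrite /serving_pdf; case: ifP => // /andP[x0 _].
rewrite mulr_ge0 ?expR_ge0// mulr_ge0 ?(ltW x0)// divr_ge0//.
by rewrite !mulr_ge0 ?pi_ge0// ltW.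
Qed.

Let D : set R := `]0, rk].

Let DE x : D x <-> (0 < x) && (x <= rk).
Proof. by rewrite /D /= in_itv. Qed.

Let mD : measurable D. Proof. exact: measurable_itv. Qed.

Let measurable_pdf : measurable_fun setT pdf.
Proof.
pose f x := 2 * pi * lam k / Tk lam P B alpha M eps k * x *
    expR (- (pi * \sum_(j < K) lam j
                 * powR (Omega P B M j / Omega P B M k) (delta alpha j)
                 * powR x (2 * (delta alpha j / delta alpha k)))).
have -> : pdf = fun x => f x * \1_D x.
  apply/funext => x; rewrite indicE /serving_pdf.
  have -> : (x \in D) = (0 < x) && (x <= rk) by apply/idP/idP; rewrite inE => /DE.
  by case: ifP => _; rewrite ?mulr1 ?mulr0.
apply: measurable_funM; last exact: measurable_indic.
apply: measurable_funM; first exact: measurable_funM.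
apply: (measurableT_comp (@measurable_expR R)).
apply: measurableT_comp => //; apply: measurable_funM => //.
apply: measurable_sum => j; apply: measurable_funM => //; exact: measurable_powR.
Qed.

Let measurable_pre S : measurable S -> measurable (X @^-1` S).
Proof. by move=> mS; rewrite -[Y in measurable Y]setTI; exact: mX. Qed.

(** Most favourable choice on the cell: path loss from the near end, exclusion radius from the far
    end. *)
Let cell_le (S : set R) lo hi : measurable S -> 0 < lo -> 0 < hi -> S `<=` [set` `]lo, hi]] ->
  (Pr (X @^-1` S `&` Gd) <= Pr (X @^-1` S) * (cov lo hi)%:E)%E.
Proof.
move=> mS lo0 hi0 Sl; rewrite -prob_Ev//; apply: le_measure; rewrite ?inE.
- by apply: measurableI; [exact: measurable_pre|exact: measurable_Gd].
- by apply: measurableI; [exact: measurable_pre|exact: measurable_Ev].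
move=> w [Xw Gw]; split => //; have /= := Sl _ Xw; rewrite in_itv/= => /andP[lx xh].
have x0 := lt_trans lo0 lx; apply: (Ev_sub (ltW lo0) (ltW lx) x0 xh).
exact/(GdE x0).
Qed.

(** Least favourable choice: the two ends are exchanged. *)
Let cell_ge (S : set R) lo hi : measurable S -> 0 < lo -> 0 < hi -> S `<=` [set` `]lo, hi]] ->
  (Pr (X @^-1` S) * (cov hi lo)%:E <= Pr (X @^-1` S `&` Gd))%E.
Proof.
move=> mS lo0 hi0 Sl; rewrite -prob_Ev//; apply: le_measure; rewrite ?inE.
- by apply: measurableI; [exact: measurable_pre|exact: measurable_Ev].
- by apply: measurableI; [exact: measurable_pre|exact: measurable_Gd].
move=> w [Xw Ew]; split => //; have /= := Sl _ Xw; rewrite in_itv/= => /andP[lx xh].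
have x0 := lt_trans lo0 lx; apply/(GdE x0).
exact: (Ev_sub (ltW x0) xh lo0 (ltW lx)).
Qed.

(** One family serves both bounds: for [z < 1], [r = z^-1] overestimates coverage at distance [x]
    and [r = z] underestimates it. *)
Let covr (r x : R) : R := cov (x / r) (r * x).

Let measurable_covr r : 0 < r -> measurable_fun D (fun x => (pdf x * covr r x)%:E).
Proof.
move=> r0; apply/measurable_EFinP; apply: measurable_funM; first exact: measurable_funTS.
apply: (@measurable_funS _ _ _ _ [set x : R | 0 < x]).
- rewrite (_ : [set x : R | 0 < x] = `]0, +oo[%classic); first exact: measurable_itv.
  by apply/seteqP; split => x /=; rewrite in_itv/= andbT.
- by move=> x /DE/andP[].
- exact: measurable_cover.
Qed.

Let covr_ge0 r x : 0 < r -> 0 < x -> 0 <= covr r x.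
Proof. by move=> r0 x0; apply: cover_ge0; exact: mulr_gt0. Qed.

Let integral_pdfM S (c : R) : measurable S -> 0 <= c ->
  (Pr (X @^-1` S) * c%:E = \int[leb]_(x in S) (pdf x * c)%:E)%E.
Proof.
move=> mS c0; rewrite Xlaw// muleC -ge0_integralZl_EFin//.
- by apply: eq_integral => x _; rewrite -EFinM mulrC.
- by move=> x _; rewrite lee_fin.
- by apply/measurable_EFinP; exact: measurable_funTS.
Qed.

Let grid_prob z : 0 < z -> z < 1 ->
  (Pr (X @^-1` D `&` Gd) = \sum_(i <oo) Pr (X @^-1` (geom_cell rk z i) `&` Gd))%E.
Proof.
move=> z0 z1; rewrite /D -(geom_cell_bigcup rk_gt0 z0 z1) preimage_bigcup setI_bigcupl.
have mC i : measurable (X @^-1` (geom_cell rk z i) `&` Gd).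
  by apply: measurableI; [apply: measurable_pre; exact: measurable_itv|exact: measurable_Gd].
rewrite measure_semi_bigcup//; last exact: bigcupT_measurable.
apply/trivIsetP => i j _ _ ij.
have /trivIsetP/(_ i j I I ij) := geom_cell_trivIset rk_gt0 z0 z1.
by rewrite -!subset0 => h w [[wi _] [wj _]]; exact: (h (X w)).
Qed.

Let grid_integral z r : 0 < z -> z < 1 -> 0 < r ->
  (\int[leb]_(x in D) (pdf x * covr r x)%:E =
   \sum_(i <oo) \int[leb]_(x in geom_cell rk z i) (pdf x * covr r x)%:E)%E.
Proof.
move=> z0 z1 r0.
have := @ge0_integral_bigcup _ _ _ leb (geom_cell rk z) (fun x => (pdf x * covr r x)%:E).
rewrite /= (geom_cell_bigcup rk_gt0 z0 z1); apply.
- by move=> i; exact: measurable_itv.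
- exact: measurable_covr.
- by move=> x /DE/andP[x0 _]; rewrite lee_fin mulr_ge0 ?covr_ge0.
- exact: geom_cell_trivIset.
Qed.

Let cell_sub z i : 0 < z -> z < 1 -> geom_cell rk z i `<=` D.
Proof. by move=> z0 z1; rewrite /D -(geom_cell_bigcup rk_gt0 z0 z1); exact: bigcup_sup. Qed.

Let cellP z i x : 0 < z -> z < 1 -> geom_cell rk z i x ->
  [/\ 0 < x, z * x <= rk * z ^+ i.+1 & rk * z ^+ i <= z^-1 * x].
Proof.
move=> z0 z1 cx; have /DE/andP[x0 _] := cell_sub z0 z1 cx.
move: cx; rewrite /geom_cell /= in_itv/= => /andP[lx xh]; split => //.
  by rewrite exprS mulrCA ler_pM2l.
by rewrite [z^-1 * x]mulrC ler_pdivlMr// -mulrA -exprSr ltW.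
Qed.

(** The ends of the cell of [x] lie between [z * x] and [z^-1 * x], so the bound on that cell is at
    most [covr z^-1 x], an expression that no longer refers to the grid. *)
Let prob_le_integral z : 0 < z -> z < 1 ->
  (Pr (X @^-1` D `&` Gd) <= \int[leb]_(x in D) (pdf x * covr z^-1 x)%:E)%E.
Proof.
move=> z0 z1; have zV0 : 0 < z^-1 by rewrite invr_gt0.
rewrite (grid_prob z0 z1) (grid_integral z0 z1)//; apply: lee_nneseries.
  by move=> *; exact: measure_ge0.
move=> i *; have mC : measurable (geom_cell rk z i) by exact: measurable_itv.
have lo0 : 0 < rk * z ^+ i.+1 by rewrite mulr_gt0// exprn_gt0.
have hi0 : 0 < rk * z ^+ i by rewrite mulr_gt0// exprn_gt0.
apply: (le_trans (cell_le mC lo0 hi0 _)) => //.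
rewrite (integral_pdfM mC (cover_ge0 _ hi0)); apply: ge0_le_integral; first exact: mC.
- by move=> x _; rewrite lee_fin; apply: mulr_ge0; [exact: pdf_ge0|exact: cover_ge0].
- apply/measurable_EFinP; apply: measurable_funM; last exact: measurable_cst.
  exact: measurable_funTS.
- by apply: (measurable_funS mD (cell_sub z0 z1)); exact: measurable_covr.
move=> x /(cellP z0 z1)[x0 h1 h2]; rewrite lee_fin; apply: ler_wpM2l; first exact: pdf_ge0.
have xz : x / z^-1 = z * x by rewrite invrK mulrC.
by rewrite /covr xz; exact: (cover_mono (mulr_ge0 (ltW z0) (ltW x0)) h1 hi0 h2).
Qed.

Let integral_le_prob z : 0 < z -> z < 1 ->
  (\int[leb]_(x in D) (pdf x * covr z x)%:E <= Pr (X @^-1` D `&` Gd))%E.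
Proof.
move=> z0 z1; rewrite (grid_prob z0 z1) (grid_integral z0 z1)//; apply: lee_nneseries.
  move=> i *; apply: integral_ge0 => x /(cellP z0 z1)[x0 _ _].
  by rewrite lee_fin; apply: mulr_ge0; [exact: pdf_ge0|exact: covr_ge0].
move=> i *; have mC : measurable (geom_cell rk z i) by exact: measurable_itv.
have lo0 : 0 < rk * z ^+ i.+1 by rewrite mulr_gt0// exprn_gt0.
have hi0 : 0 < rk * z ^+ i by rewrite mulr_gt0// exprn_gt0.
apply: le_trans (cell_ge mC lo0 hi0 _) => //.
rewrite (integral_pdfM mC (cover_ge0 _ lo0)); apply: ge0_le_integral; first exact: mC.
- move=> x /(cellP z0 z1)[x0 _ _].
  by rewrite lee_fin; apply: mulr_ge0; [exact: pdf_ge0|exact: covr_ge0].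
- by apply: (measurable_funS mD (cell_sub z0 z1)); exact: measurable_covr.
- apply/measurable_EFinP; apply: measurable_funM; last exact: measurable_cst.
  exact: measurable_funTS.
move=> x /(cellP z0 z1)[x0 h1 h2]; rewrite lee_fin; apply: ler_wpM2l; first exact: pdf_ge0.
have h2' : rk * z ^+ i <= x / z by rewrite [x / z]mulrC.
exact: (cover_mono (ltW hi0) h2' (mulr_gt0 z0 x0) h1).
Qed.

Let integrable_pdf : leb.-integrable D (EFin \o pdf).
Proof.
apply/integrableP; split; first by apply/measurable_EFinP; exact: measurable_funTS.
under eq_integral do rewrite gee0_abs ?lee_fin//.
rewrite -Xlaw//; apply: le_lt_trans (probability_le1 _ _) (ltry _).
exact: measurable_pre.
Qed.

Let cvg_integral_covr (r_ : nat -> R) : (forall N, 0 < r_ N) -> r_ N @[N --> \oo] --> (1 : R) ->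
  (\int[leb]_(x in D) (pdf x * covr (r_ N) x)%:E)%E @[N --> \oo] -->
  (\int[leb]_(x in D) (pdf x * cov x x)%:E)%E.
Proof.
move=> r0 r1; apply: (@dominated_cvg _ _ _ leb D mD _ _ (EFin \o pdf)).
- by move=> N; exact: measurable_covr.
- move=> x /DE/andP[x0 _]; apply: cvg_EFin; first by apply: nearW => N.
  apply: cvgM; first exact: cvg_cst.
  apply: cvg_cover => //.
  + by move=> N; exact: mulr_gt0.
  + rewrite -[Y in _ --> Y]divr1; apply: cvgM; first exact: cvg_cst.
    by apply: cvgV => //; exact: oner_neq0.
  + rewrite -[Y in _ --> Y]mul1r; apply: cvgM => //; exact: cvg_cst.
- by [].
- exact: integrable_pdf.
- move=> N x /DE/andP[x0 _]; have c0 := covr_ge0 (r0 N) x0.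
  have pc : 0 <= pdf x * covr (r_ N) x by apply: mulr_ge0 => //; exact: pdf_ge0.
  rewrite gee0_abs ?lee_fin//=; apply: ler_piMr; first exact: pdf_ge0.
  by apply: cover_le1; exact: mulr_gt0.
Qed.

Let prob_Gd_D : Pr (X @^-1` D `&` Gd) = (\int[leb]_(x in D) (pdf x * cov x x)%:E)%E.
Proof.
(* Grid ratios in [[1/2, 1[] tending to 1. *)
pose z_ (N : nat) : R := 1 - 2^-1 * @harmonic R N.
have h1 N : 0 < @harmonic R N <= 1.
  by rewrite harmonic_gt0 /harmonic /= invf_le1// ler1n.
have z0 N : 0 < z_ N by rewrite /z_; have := h1 N; lra.
have z1 N : z_ N < 1 by rewrite /z_; have := h1 N; lra.
have zc : z_ N @[N --> \oo] --> (1 : R).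
  rewrite /z_ -[Y in _ --> Y]subr0 -[X in 1 - X](mulr0 2^-1).
  apply: cvgB; first exact: cvg_cst.
  by apply: cvgM; [exact: cvg_cst|exact: cvg_harmonic].
have zV0 N : 0 < (z_ N)^-1 by rewrite invr_gt0.
have zVc : (z_ N)^-1 @[N --> \oo] --> (1 : R).
  by rewrite -[Y in _ --> Y]invr1; apply: cvgV => //; exact: oner_neq0.
have c1 := cvg_integral_covr z0 zc; have c2 := cvg_integral_covr zV0 zVc.
apply/eqP; rewrite eq_le; apply/andP; split.
  rewrite -(cvg_lim _ c2)//; apply: lime_ge; first by apply/cvg_ex; eexists; exact: c2.
  by apply: nearW => N; exact: prob_le_integral.
rewrite -(cvg_lim _ c1)//; apply: lime_le; first by apply/cvg_ex; eexists; exact: c1.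
by apply: nearW => N; exact: integral_le_prob.
Qed.

Let prob_Gd : Pr Gd = (\int[leb]_(x in D) (pdf x * cov x x)%:E)%E.
Proof.
rewrite -prob_Gd_D; have mDG : measurable (X @^-1` D `&` Gd).
  by apply: measurableI; [exact: measurable_pre|exact: measurable_Gd].
have mDC : measurable (X @^-1` (~` D)) by apply: measurable_pre; exact: measurableC.
have E0 : Pr (X @^-1` (~` D)) = 0%E.
  rewrite Xlaw; last exact: measurableC.
  apply: integral0_eq => x nD; rewrite /serving_pdf ifF//.
  by apply/negbTE/negP => /DE.
apply/eqP; rewrite eq_le; apply/andP; split; last first.
  by apply: le_measure; rewrite ?inE//; move=> w [].
rewrite -[leRHS]adde0 -E0; apply: le_trans (measureU2 _ mDG mDC).
apply: le_measure; rewrite ?inE; [exact: measurable_Gd|exact: measurableU|].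
by move=> w Gw; have [Dw|Dw] := pselect (D (X w)); [left|right].
Qed.

(** * Passage to the stated formulas *)

Local Notation g n x := (gfun lam P B alpha M lam_u eps beta k n x).
Local Notation dl := (delta alpha).
Local Notation Omg := (Omega P B M).
Let assoc u := \sum_(j < K) lam j * powR (Omg j / Omg k) (dl j) * powR u (dl j / dl k).
Let term (i m : nat) (x : R) : R := pi ^+ i.+1 / (i`!)%:R *
  expR (- (pi * g 0%N x) - pi * assoc x) * (cpoly (fun n => g n x) (M k) ^+ i)`_m.

Let dl_ratio_gt0 j : 0 < dl j / dl k.
Proof.
have h i : 0 < dl i by rewrite /delta divr_gt0//; exact: lt_trans (al2 i).
by rewrite divr_gt0.
Qed.

Let b0 : 0 < rk ^+ 2. Proof. by rewrite exprn_gt0. Qed.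

Let within_assoc : {within `[0, rk ^+ 2], continuous assoc}.
Proof.
move=> x; rewrite /assoc; apply: cvgr_sum => j; apply: cvgM; first exact: cvg_cst.
exact: (within_continuous_powR (dl_ratio_gt0 j) b0).
Qed.

Let within_gfun n : {within `[0, rk ^+ 2], continuous (fun x => g n x)}.
Proof.
move=> x; rewrite /gfun; apply: cvgr_sum => j; apply: cvgM; first exact: cvg_cst.
exact: (within_continuous_powR (dl_ratio_gt0 j) b0).
Qed.

Let within_term i m : {within `[0, rk ^+ 2], continuous (term i m)}.
Proof.
move=> x; apply: cvg_cpoly_term; last by move=> n; exact: within_gfun.
apply: cvgB.
  by apply: cvgN; apply: cvgM; [exact: cvg_cst|exact: within_gfun].
by apply: cvgM; [exact: cvg_cst|exact: within_assoc].
Qed.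

Let cover_diag x : 0 < x ->
  cov x x = \sum_(m < M k) cpmf (fun n => pi * g n (x ^+ 2)) (M k) m.
Proof.
move=> x0; have px : powR x (alpha k) != 0 by rewrite gt_eqF// powR_gt0.
have E : cum lam P B alpha M lam_u eps beta k x x = fun n => pi * g n (x ^+ 2).
  apply/funext => n; rewrite /cum divff//; apply: congr1; apply: eq_bigr => j _.
  rewrite mulr1 -varphiE// powRrM.
  have -> : powR x 2 = x ^+ 2 by rewrite (@powR_mulrn _ x 2)// ltW.
  by rewrite /act; ring.
by rewrite cover_cum E.
Qed.

(** Integrand in the squared distance [u = x ^+ 2]; the factor [2 * x] of the serving density is the
    Jacobian. *)
Let G u : R := lam k / Tk lam P B alpha M eps k * \sum_(i < M k) \sum_(m < M k) term i m u.

Let pdf_cover x : 0 <= x -> x <= rk -> pdf x * cov x x = G (x ^+ 2) * (2 * x).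
Proof.
(* At 0 both sides vanish: the density by its definition, the right side by the factor [x]. *)
rewrite le_eqVlt => /orP[/eqP<- _|x0 xrk].
  by rewrite /serving_pdf ltxx/= !mul0r !mulr0.
rewrite /serving_pdf x0 xrk/= cover_diag// /G /term.
have := sum_cpmf_scale pi (fun n => g n (x ^+ 2)) (M k) (pi * assoc (x ^+ 2)).
rewrite /= => <-.
have -> : \sum_(j < K) lam j * powR (Omg j / Omg k) (dl j) * powR x (2 * (dl j / dl k)) =
    assoc (x ^+ 2).
  apply: eq_bigr => j _; rewrite powRrM.
  by have -> : powR x 2 = x ^+ 2 by rewrite (@powR_mulrn _ x 2)// ltW.
by ring.
Qed.

Let within_G : {within `[0, rk ^+ 2], continuous G}.
Proof.
move=> x; rewrite /G; apply: cvgM; first exact: cvg_cst.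
by apply: cvgr_sum => i; apply: cvgr_sum => m; exact: within_term.
Qed.

Let prob_Gd_G : Pr Gd = (\int[leb]_(u in `[0%R, (rk ^+ 2)%R]) (G u)%:E)%E.
Proof.
rewrite prob_Gd (integral_subst_sqr rk_gt0 within_G).
transitivity (\int[leb]_(x in `[0%R, rk]) (pdf x * cov x x)%:E)%E; last first.
  apply: eq_integral => x; rewrite inE/= in_itv/= => /andP[x0 xrk].
  by rewrite pdf_cover.
apply: (@integral_itv_obnd_cbnd R 0 (BRight rk)).
have := measurable_covr ltr01; apply: eq_measurable_fun => x _.
by rewrite /covr divr1 mul1r.
Qed.

Lemma outage_formula :
  fine (Pr [set w | ((P k * H w * powR (X w) (- alpha k))%:E
                    < beta%:E * interference P B alpha M k X Phi w)%E]) =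
  1 - lam k / Tk lam P B alpha M eps k *
    \sum_(i < M k) \sum_(m < M k)
      Rintegral lebesgue_measure `[0, rk ^+ 2]
        (fun x => pi ^+ i.+1 / (i`!)%:R *
           expR (- (pi * g 0%N x) - pi * \sum_(j < K) lam j
                          * powR (Omg j / Omg k) (dl j) * powR x (dl j / dl k)) *
           (cpoly (fun n => g n x) (M k) ^+ i)`_m).
Proof.
rewrite (_ : [set w | _] = ~` Gd); last first.
  by apply/seteqP; split => w /=; rewrite ltNge => /negP.
rewrite probability_setC; last exact: measurable_Gd.
have fG : Pr Gd \is a fin_num by apply: fin_num_measure; exact: measurable_Gd.
rewrite -(fineK fG) -EFinB /= prob_Gd_G; congr (1 - _).
transitivity (Rintegral leb `[0, rk ^+ 2] G) => //.
rewrite /G RintegralZl//; last first.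
  apply: within_continuous_integrable => x.
  by apply: cvgr_sum => i; apply: cvgr_sum => m; exact: within_term.
congr (_ * _); rewrite Rintegral_sum; last first.
  by move=> i x; apply: cvgr_sum => m; exact: within_term.
by apply: eq_bigr => i _; rewrite Rintegral_sum// => m; exact: within_term.
Qed.

(** Nonnegativity turns the norm of a power of [Theta] into a sum of polynomial coefficients, and it
    makes [Zk] positive. *)
Let theta_ge0 a n : 0 <= theta lam P B alpha M lam_u eps beta a k n.
Proof.
apply: sumr_ge0 => j _; rewrite mulr_ge0//; last first.
  by rewrite varphiE// vph_ge0// ltW// tau_gt0.
by rewrite mulr_ge0 ?powR_ge0//; exact: (mu0 j).
Qed.

Lemma outage_formula_equal_exponents a : (forall j, alpha j = a) ->
  fine (Pr [set w | ((P k * H w * powR (X w) (- alpha k))%:E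
                    < beta%:E * interference P B alpha M k X Phi w)%E]) =
  1 - lam k / Tk lam P B alpha M eps k *
     \sum_(i < M k)
       mx_norm1 (Theta lam P B alpha M lam_u eps beta a k ^+ i)
         / Zk lam P B alpha M lam_u eps beta a k ^+ i.+1 *
       (1 - erlang_tail i (pi * Zk lam P B alpha M lam_u eps beta a k * rk ^+ 2)).
Proof.
move=> ala; rewrite outage_formula; congr (1 - _ * _); apply: eq_bigr => i _.
set Z := Zk _ _ _ _ _ _ _ _ _ _; pose th n := theta lam P B alpha M lam_u eps beta a k n.
have dlE j : dl j = 2 / a by rewrite /delta ala.
have dl0 : 2 / a != 0 by rewrite -(dlE k) /delta gt_eqF// divr_gt0// (lt_trans _ (al2 k)).
have Om0 j : 0 < Omg j by rewrite Omega_gt0.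
have Ok0 : powR (Omg k) (2 / a) != 0 by rewrite gt_eqF// powR_gt0.
have LE : Lambda lam P B M a / powR (Omg k) (2 / a) =
    \sum_(j < K) lam j * powR (Omg j / Omg k) (2 / a).
  rewrite /Lambda mulr_suml; apply: eq_bigr => j _; rewrite -mulrA; apply: congr1.
  rewrite -[in LHS](divfK (_ : Omg k != 0) (Omg j)) ?gt_eqF//.
  have O1 : 0 <= Omg j / Omg k by rewrite divr_ge0 ?(ltW (Om0 _)).
  by rewrite (@powRM _ (Omg j / Omg k) (Omg k)) ?O1 ?(ltW (Om0 k))// mulfK.
have Z0 : Z != 0.
  rewrite gt_eqF// /Z /Zk ltr_wpDl ?theta_ge0// LE (bigD1 k)//= ltr_pwDl//.
    by rewrite mulr_gt0// powR_gt0// divr_gt0.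
  by apply: sumr_ge0 => j _; rewrite mulr_ge0 ?powR_ge0// ltW.
rewrite (_ : Theta _ _ _ _ _ _ _ _ _ _ = toeplitz th (M k))//.
rewrite mx_norm1_toeplitz_exp//; last by move=> n; exact: theta_ge0.
rewrite -mulrA mulr_suml; apply: eq_bigr => m _; rewrite mulrA.
rewrite -Rintegral_erlang//; apply: eq_Rintegral => x; rewrite inE/= in_itv/= => /andP[x0 _].
(* With equal exponents all ratios of deltas are 1, so [gfun] is linear in [x]: the [i]-th power
   contributes [x ^+ i] and the exponent becomes [- (pi * Z * x)], an Erlang integrand. *)
have pE j : powR x (dl j / dl k) = x by rewrite !dlE divff// powRr1.
have gE n : g n x = x * th n.
  rewrite /th /theta mulr_sumr; apply: eq_bigr => j _; rewrite pE dlE; ring.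
have -> : (fun n => g n x) = fun n => x * th n by apply/funext.
rewrite cpolyZ exprZn coefZ gE; congr (_ * expR _ * _).
rewrite /Z /Zk LE; under eq_bigr do rewrite pE dlE.
by rewrite -mulr_suml -/th /th; ring.
Qed.

End outage.

Theorem theorem2 (R : realType) (K : nat)
  (lam P B alpha : 'I_K -> R) (M : 'I_K -> nat) (lam_u eps beta : R)
  (d : measure_display) (Om : measurableType d) (Pr : probability Om R)
  (k : 'I_K) (X H : Om -> R) (Phi : 'I_K -> Om -> set ((R * R) * R)) :
  (forall j, 0 < lam j) -> (forall j, 0 < P j) -> (forall j, (0 < M j)%N) ->
  (forall j, 0 < B j) -> (forall j, 2 < alpha j) ->
  0 < lam_u -> 0 < eps -> 0 < beta ->
  (* serving distance X_k: density serving_pdf on (0, R_k] *)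
  measurable_fun setT X ->
  (forall S : set R, measurable S ->
     Pr (X @^-1` S) =
     (\int[lebesgue_measure]_(x in S) (serving_pdf lam P B alpha M eps k x)%:E)%E) ->
  (* signal gain ||h||^2 ~ Gamma(M_k, 1) *)
  measurable_fun setT H ->
  (forall S : set R, measurable S ->
     Pr (H @^-1` S) =
     (\int[lebesgue_measure]_(x in S) (gamma_pdf (M k) x)%:E)%E) ->
  (* tier-j active BSs with their Exp(1) fading marks: homogeneous PPP of
     intensity A_j lam_j, independently marked *)
  (forall j, is_ppp Pr
     (marked_intensity (Aact lam P B alpha M lam_u eps j * lam j)) (Phi j)) ->
  (* X, H, Phi_1, ..., Phi_K are mutually independent *)
  mutually_indep Pr (fun s : option (option 'I_K) =>
     match s with
     | None => fin_inter [set X @^-1` S | S in @measurable _ R]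
     | Some None => fin_inter [set H @^-1` S | S in @measurable _ R]
     | Some (Some j) => fin_inter
         [set E | exists (A : set ((R * R) * R)) (n : nat),
            [/\ measurable A,
                (marked_intensity (Aact lam P B alpha M lam_u eps j * lam j) A
                   < +oo)%E
              & E = count_eq (Phi j) A n]]
     end) ->
  let Out := fine (Pr [set w | ((P k * H w * powR (X w) (- alpha k))%:E
                    < beta%:E * interference P B alpha M k X Phi w)%E]) in
  Out = 1 - lam k / Tk lam P B alpha M eps k *
    \sum_(i < M k) \sum_(m < M k)
      Rintegral lebesgue_measure `[0, Rk P B alpha M eps k ^+ 2]
        (fun x => pi ^+ i.+1 / (i`!)%:R *
           expR (- (pi * gfun lam P B alpha M lam_u eps beta k 0 x)
                 - pi * \sum_(j < K) lam j
                          * powR (Omega P B M j / Omega P B M k) (delta alpha j)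
                          * powR x (delta alpha j / delta alpha k)) *
           col1_entry (Qmat lam P B alpha M lam_u eps beta k x ^+ i) m)
  /\
  (forall a : R, (forall j, alpha j = a) ->
   Out = 1 - lam k / Tk lam P B alpha M eps k *
     \sum_(i < M k)
       mx_norm1 (Theta lam P B alpha M lam_u eps beta a k ^+ i)
         / Zk lam P B alpha M lam_u eps beta a k ^+ i.+1 *
       (1 - \sum_(l < i.+1)
              (pi * Zk lam P B alpha M lam_u eps beta a k
                  * Rk P B alpha M eps k ^+ 2) ^+ l / (l`!)%:R *
              expR (- (pi * Zk lam P B alpha M lam_u eps beta a k
                          * Rk P B alpha M eps k ^+ 2)))).
Proof.
move=> lam0 P0 M0 B0 al2 lamu0 eps0 beta0 mX Xlaw mH Hlaw ppp indep Out; split.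
  rewrite /Out (@outage_formula R K lam P B alpha M lam_u eps beta k d Om Pr X H Phi
    lam0 P0 M0 B0 al2 lamu0 eps0 beta0 mX Xlaw mH Hlaw ppp indep).
  congr (1 - _ * _); apply: eq_bigr => i _; apply: eq_bigr => m _.
  (* [Qmat] is convertible to the Toeplitz matrix of [gfun], whose powers carry the polynomial
     coefficients in their first column. *)
  by apply: eq_Rintegral => x _; rewrite -col1_entry_toeplitz_exp.
move=> a ala.
exact: (@outage_formula_equal_exponents R K lam P B alpha M lam_u eps beta k d Om Pr X H Phi
  lam0 P0 M0 B0 al2 lamu0 eps0 beta0 mX Xlaw mH Hlaw ppp indep a ala).
Qed.
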